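(* Let $a,b,c,g>0$ with $\pi:=b-cg>0$. Let $(P_t)_{t\ge0}$ be the semigroup of the Markov process on $\mathbb R_+^*=(0,+\infty)$ with generator $$\mathcal Lf(x)=(a-bx)f'(x)+cx\left(f(x+g)-f(x)\right),$$ and let $\mu_\infty$ be its invariant distribution. Let $\mu_0$ be a starting distribution on $\mathbb R_+^*$ with moments of any order. Then for every $\varepsilon>0$ there exists $C_\varepsilon>0$ such that for all $t\ge0$ $$\left\Vert\mu_0P_t-\mu_\infty P_t\right\Vert_{TV}\le C_\varepsilon e^{-(\alpha\pi-\varepsilon)t}\qquad\text{with}\qquad \alpha=\frac1{2+\frac{b\pi}{ac}}.$$
   Context: The process with generator $\mathcal L$ is a piecewise deterministic Markov process on $(0,+\infty)$: between jumps it follows the flow $\dot x=a-bx$, and it jumps from $x$ to $x+g$ at rate $cx$. When $b-cg>0$ it has a unique invariant distribution, denoted $\mu_\infty$. $\mu P_t$ denotes the law at time $t$ of the process started from $\mu$, and $\|\cdot\|_{TV}$ is the total variation norm. The constant $C_\varepsilon$ may depend on $\mu_0$ and on $a,b,c,g$, but not on $t$. *)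

(* Defs.v *)
From HB Require Import structures.
From mathcomp Require Import all_boot all_order all_algebra.
From mathcomp Require Import all_classical all_reals all_analysis.

Set Implicit Arguments.
Unset Strict Implicit.
Unset Printing Implicit Defensive.

Import Order.TTheory GRing.Theory Num.Theory.
Import numFieldNormedType.Exports.

Local Open Scope classical_set_scope.
Local Open Scope ring_scope.

Section defs.
Context {R : realType}.
Local Notation RR := (measurableTypeR R).

(* The state space (0, +oo) is encoded as a subset of R: measures are measures
   on R carried by this subset, and the values of functions and kernels at
   nonpositive states, or of kernels at negative times, are never used. *)
Definition state_space : set RR := [set x : R | 0 < x].

Definition on_state_space (mu : probability RR R) : Prop :=
  mu state_space = 1%E.

Definition has_all_moments (mu : probability RR R) : Prop :=
  forall n : nat, mu.-integrable state_space (fun x => (x ^+ n)%:E).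

(* P (t, x) A is the probability that the process started from x is in A at
   time t; a kernel on R * R is jointly measurable in (t, x). *)
Record markov_semigroup (P : R.-pker (RR * RR) ~> RR) : Prop := {
  semigroup_state : forall t x : R, 0 <= t -> 0 < x ->
    P (t, x) state_space = 1%E ;
  semigroup_zero : forall (x : R) (A : set RR), 0 < x -> measurable A ->
    P (0, x) A = \d_x A ;
  semigroup_add : forall (s t x : R) (A : set RR),
    0 <= s -> 0 <= t -> 0 < x -> measurable A ->
    P (s + t, x) A = (\int[P (s, x)]_(y in state_space) P (t, y) A)%E
}.

Definition generator (a b c g : R) (f : R -> R) (x : R) : R :=
  (a - b * x) * f^`()%classic x + c * x * (f (x + g) - f x).

Definition bounded_on_state_space (h : R -> R) : Prop :=
  exists M : R, forall x : R, 0 < x -> `|h x| <= M.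

(* The test functions: bounded C^1 functions on (0, +oo) whose image under the
   operator L is bounded. *)
Record test_function (L : (R -> R) -> R -> R) (f : R -> R) : Prop := {
  test_derivable : forall x : R, 0 < x -> derivable f x 1 ;
  test_continuous : forall x : R, 0 < x -> {for x, continuous f^`()%classic} ;
  test_bounded : bounded_on_state_space f ;
  test_image_bounded : bounded_on_state_space (L f)
}.

(* L generates P in the sense of Dynkin's formula
     P_t f (x) = f x + \int_0^t P_s (L f) (x) ds,
   that is, (f, L f) belongs to the full generator of P for all test f. *)
Definition has_generator (P : R.-pker (RR * RR) ~> RR)
    (L : (R -> R) -> R -> R) : Prop :=
  forall f : R -> R, test_function L f ->
  forall t x : R, 0 <= t -> 0 < x ->
    \int[P (t, x)]_(y in state_space) f y =
    f x + \int[lebesgue_measure]_(s in `[0, t])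
            (\int[P (s, x)]_(y in state_space) L f y).

Definition law_at (P : R.-pker (RR * RR) ~> RR) (mu : probability RR R)
    (t : R) (A : set RR) : \bar R :=
  (\int[mu]_(x in state_space) P (t, x) A)%E.

Definition invariant_distribution (P : R.-pker (RR * RR) ~> RR)
    (mu : probability RR R) : Prop :=
  on_state_space mu /\
  forall (t : R) (A : set RR), 0 <= t -> measurable A -> law_at P mu t A = mu A.

(* Total variation distance, normalized to be at most 1 between
   probabilities. *)
Definition tv_dist (mu nu : set RR -> \bar R) : \bar R :=
  ereal_sup [set `|mu A - nu A|%E | A in [set A : set RR | measurable A]].

End defs.

(* Main.v *)
(* Fix a time step h and replace the semigroup by the iterates of the kernel T
   which follows the flow during h, with a jump at the end with probability
   1 - exp(-c h x). On the functions exp(-l x) a step of this chain agrees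
   with P_h up to O(h^2), so its iterates converge to P_t on polynomials in
   exp(-x), and these determine total variation distances.

   For such a polynomial f with |f| <= 1 and for x <= y, the difference
   T^n f y - T^n f x is split according to the number of jumps. As the flow
   approaches a/b, the terms with zero and one jump are of order
   exp(-(a c/b) t), up to a factor linear in t. After summation by parts over
   the jump time, the one-jump term is moreover Lipschitz, with a constant that
   does not depend on f in the limit h -> 0. Hence the remaining term r_n, for
   at least two jumps, satisfies r_(n+1) = T r_n + (a source with increments of
   size O(h)). The kernel T contracts the increments of the cubic
   V x = x + be x^2 + ga x^3 by the factor 1 - (pi/2) h, so r_n has increments
   of order t exp(-kap t) (V y - V x) for each kap <= pi/2 with kap < a c/b. The
   value alpha pi satisfies both constraints. The cubic is integrable for mu_0
   by assumption, and for mu_infty by its drift inequality applied to bounded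
   functions below it. *)
Require Import Defs.
From HB Require Import structures.
From mathcomp Require Import all_boot all_order all_algebra.
From mathcomp Require Import all_classical all_reals all_analysis.
From mathcomp Require Import measurable_realfun.
From mathcomp Require Import ring lra.

Set Implicit Arguments.
Unset Strict Implicit.
Unset Printing Implicit Defensive.

Import Order.TTheory GRing.Theory Num.Theory.
Import numFieldNormedType.Exports.

Local Open Scope classical_set_scope.
Local Open Scope ring_scope.

(** Total variation allows only |f| <= 1, so no bound may involve the derivative of f, and
    contraction of distances is not enough. After no jump the law is a Dirac mass: nothing is
    gained, and the probability of this event limits the rate to a c/b. After one jump the law has a
    density with respect to the jump time, which smooths f; on a time grid this is a Riemann sum,
    and the derivative of f survives only in a factor [1 + h * Cf]. The source in the recursion for
    r_n has a Lipschitz constant of order y^2, one power for the hazard of each of its two jumps,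
    and the derivative of V must dominate it: hence a cubic. The function x alone contracts at rate
    pi; a quarter of it is given up to terms of order h^2 and a quarter to the nonlinear terms of V,
    which leaves pi/2. Exponentials are stable under T, and L acts on them explicitly, so Dynkin's
    formula on explicit functions suffices to compare T with the semigroup. Since 1/(alpha pi) =
    2/pi + b/(a c), the rate alpha pi is below both pi/2 and a c/b; eps pays for the factor linear
    in t. *)

Ltac nneg := repeat first
  [ assumption | apply: ltW; assumption | exact: expR_ge0 | exact: ler0n
  | exact: ler01 | exact: normr_ge0 | exact: sqr_ge0 | apply: exprn_ge0 | rewrite subr_ge0
  | apply: addr_ge0 | apply: mulr_ge0 | rewrite invr_ge0 ].

(** * Elementary bounds on the exponential *)

Section exp_bounds.
Context {R : realType}.
Implicit Types x y : R.

Lemma expRN_le1 x : 0 <= x -> expR (- x) <= 1.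
Proof. by move=> x0; rewrite -expR0 ler_expR oppr_le0. Qed.

Lemma one_subr_expRN_ge0 x : 0 <= x -> 0 <= 1 - expR (- x).
Proof. by move=> x0; rewrite subr_ge0 expRN_le1. Qed.

Lemma one_subr_expRN_le x : 1 - expR (- x) <= x.
Proof. by have := expR_ge1Dx (- x); lra. Qed.

Lemma ler_subr_expRN x y : 0 <= x -> x <= y ->
  0 <= expR (- x) - expR (- y) <= y - x.
Proof.
move=> x0 xy; have -> : expR (- y) = expR (- x) * expR (- (y - x)).
  by rewrite -expRD; congr expR; ring.
have := one_subr_expRN_le (y - x).
have : 0 <= 1 - expR (- (y - x)) by apply: one_subr_expRN_ge0; lra.
by have := expRN_le1 x0; have := expR_ge0 (- x); nra.
Qed.

End exp_bounds.

(** * Summation by parts against monotone weights *)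

Section summation_by_parts.
Context {R : realDomainType}.

Lemma abel_nondecreasing (v D : nat -> R) (e : R) N :
  (forall m, 0 <= v m) -> (forall m, v m <= v m.+1) ->
  (forall m, `|D m| <= e) ->
  `|\sum_(m < N) v m * (D m - D m.+1)| <= 2 * (v N * e).
Proof.
move=> v0 vS De.
(* The boundary term makes the bound inductive: with it, only increments of [v] are added from [N]
   to [N.+1], and they telescope. *)
suff : `|\sum_(m < N) v m * (D m - D m.+1) + v N * D N| <= v N * e.
  have : `|v N * D N| <= v N * e by rewrite normrM ger0_norm// ler_wpM2l.
  by rewrite !ler_norml => /andP[? ?] /andP[? ?]; apply/andP; lra.
elim: N => [|N]; first by rewrite big_ord0 add0r normrM ger0_norm// ler_wpM2l.
rewrite big_ord_recr/=.
set s := \sum_(_ < _) _ => IH.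
have -> : s + v N * (D N - D N.+1) + v N.+1 * D N.+1 =
    s + v N * D N + (v N.+1 - v N) * D N.+1 by ring.
apply: le_trans (ler_normD _ _) _; rewrite normrM (ger0_norm (x := _ - _)) ?subr_ge0//.
have -> : v N.+1 * e = v N * e + (v N.+1 - v N) * e by ring.
by apply: lerD => //; rewrite ler_wpM2l ?subr_ge0.
Qed.

(** In the application [k] is the one-jump weight, which is monotone in a direction that depends on
    the side from which the flow approaches its limit. A nonincreasing [k] is [k 0] minus a
    nondecreasing sequence, which doubles the constant. *)
Lemma abel_monotone (k u D : nat -> R) (K e : R) N :
  (forall m, 0 <= k m <= K) -> (forall m, 0 <= u m) ->
  (forall m, u m <= u m.+1) ->
  (forall m, k m <= k m.+1) \/ (forall m, k m.+1 <= k m) ->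
  (forall m, `|D m| <= e) ->
  `|\sum_(m < N) k m * u m * (D m - D m.+1)| <= 4 * (K * u N * e).
Proof.
move=> kK u0 uS kmon De.
have K0 : 0 <= K by have /andP[] := kK 0%N; exact: le_trans.
have e0 : 0 <= e by apply: le_trans (De 0%N).
have KN : 0 <= K * u N * e by rewrite !mulr_ge0.
case: kmon => kS.
  have := @abel_nondecreasing (fun m => k m * u m) D e N.
  have -> : 4 * (K * u N * e) = 2 * (K * u N * e) + 2 * (K * u N * e) by ring.
  move=> /(_ _ _ De) H; apply: le_trans (H _ _) _.
  - by move=> m; rewrite mulr_ge0//; have /andP[] := kK m.
  - by move=> m; apply: ler_pM => //; have /andP[] := kK m.
  - have : k N * u N * e <= K * u N * e.
      by rewrite !ler_wpM2r//; have /andP[] := kK N.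
    by lra.
pose k' m := k 0%N - k m.
have k'S m : k' m <= k' m.+1 by rewrite /k'; have := kS m; lra.
have k'0 m : 0 <= k' m.
  by elim: m => [|m IH]; [rewrite /k' subrr|exact: le_trans (k'S m)].
have k'K m : k' m <= K by rewrite /k'; have := kK m; have := kK 0%N; lra.
have H1 := @abel_nondecreasing (fun m => k' m * u m) D e N.
have H3 := @abel_nondecreasing (fun m => k 0%N * u m) D e N.
have -> : \sum_(m < N) k m * u m * (D m - D m.+1) =
    \sum_(m < N) k 0%N * u m * (D m - D m.+1) -
    \sum_(m < N) k' m * u m * (D m - D m.+1).
  by rewrite -sumrB; apply: eq_bigr => m _; rewrite /k'; ring.
apply: le_trans (ler_normB _ _) _.
have -> : 4 * (K * u N * e) = 2 * (K * u N * e) + 2 * (K * u N * e) by ring.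
apply: lerD.
  apply: le_trans (H3 _ _ De) _ => [m|m|].
  - by rewrite mulr_ge0//; have /andP[] := kK 0%N.
  - by rewrite ler_wpM2l//; have /andP[] := kK 0%N.
  - by rewrite ler_wpM2l// !ler_wpM2r//; have /andP[] := kK 0%N.
apply: le_trans (H1 _ _ De) _ => [m|m|].
- by rewrite mulr_ge0.
- by apply: ler_pM.
- by rewrite ler_wpM2l// !ler_wpM2r.
Qed.

End summation_by_parts.

(** * The discretised kernel and its coupling *)

Section scheme.
Context {R : realType}.
Variables xs rho th g : R.
Hypotheses (xs0 : 0 <= xs) (rho0 : 0 < rho) (rho1 : rho < 1).
Hypotheses (th0 : 0 <= th) (g0 : 0 < g).
Implicit Types (x y : R) (u V f : R -> R).

Definition flow x : R := xs + rho * (x - xs).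

Definition step u x : R :=
  expR (- (th * x)) * u (flow x) + (1 - expR (- (th * x))) * u (flow x + g).

Lemma flow_ge0 x : 0 <= x -> 0 <= flow x.
Proof.
move=> x0; have -> : flow x = xs * (1 - rho) + rho * x by rewrite /flow; ring.
by rewrite addr_ge0// mulr_ge0// ?subr_ge0 ltW.
Qed.

Lemma flow_le x y : x <= y -> flow x <= flow y.
Proof. by move=> xy; rewrite /flow lerD2l ler_wpM2l ?lerD2r// ltW. Qed.

(** Monotone coupling: neither copy jumps with weight [ey], both jump with weight [1 - ex], and only
    the larger one jumps with the remaining weight [ex - ey]. The order is kept in each case, so the
    hypothesis applies three times, and the same identity for [V] reassembles the right side. *)
Lemma step_contract V u r x y :
  (forall x y, 0 <= x -> x <= y -> `|u y - u x| <= r * (V y - V x)) ->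
  0 <= x -> x <= y -> `|step u y - step u x| <= r * (step V y - step V x).
Proof.
move=> uV x0 xy; have y0 := le_trans x0 xy.
rewrite /step; set X := flow x; set Y := flow y.
have XY : X <= Y by exact: flow_le.
have X0 : 0 <= X by exact: flow_ge0.
set ex := expR (- (th * x)); set ey := expR (- (th * y)).
have ey0 : 0 <= ey by exact: expR_ge0.
have ex1 : 0 <= 1 - ex by apply: one_subr_expRN_ge0; rewrite mulr_ge0.
have exy : 0 <= ex - ey.
  suff /andP[] : 0 <= ex - ey <= th * y - th * x by [].
  by apply: ler_subr_expRN; [rewrite mulr_ge0|rewrite ler_wpM2l].
have E w : ey * w Y + (1 - ey) * w (Y + g) - (ex * w X + (1 - ex) * w (X + g)) =
  ey * (w Y - w X) + (1 - ex) * (w (Y + g) - w (X + g)) +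
  (ex - ey) * (w (Y + g) - w X) by ring.
rewrite !E; apply: le_trans (ler_normD _ _) _.
apply: le_trans (lerD (ler_normD _ _) (lexx _)) _.
rewrite !normrM (ger0_norm ey0) (ger0_norm ex1) (ger0_norm exy).
rewrite 2![r * (_ + _)]mulrDr !(mulrCA r).
apply: lerD; [apply: lerD|].
- by rewrite ler_wpM2l// uV.
- by rewrite ler_wpM2l// uV// ?lerD2r// addr_ge0// ltW.
- by rewrite ler_wpM2l// uV//; apply: le_trans XY _; rewrite lerDl ltW.
Qed.

Lemma step_le u v x : (forall x, 0 <= x -> u x <= v x) -> 0 <= x ->
  step u x <= step v x.
Proof.
move=> uv x0; have X0 := flow_ge0 x0.
apply: lerD; rewrite ler_wpM2l ?expR_ge0 ?one_subr_expRN_ge0 ?mulr_ge0// uv//.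
by rewrite addr_ge0// ltW.
Qed.

End scheme.

(** * Decomposition by the number of jumps *)

Section onejump.
Context {R : realType}.
Variables xs rho th g : R.
Hypotheses (xs0 : 0 <= xs) (rho0 : 0 < rho) (rho1 : rho < 1).
Hypotheses (th0 : 0 <= th) (g0 : 0 < g) (rho_th : rho * expR (th * g) <= 1).
Implicit Types (x y : R) (u V f : R -> R) (i j m n N : nat).

Local Notation phi := (flow xs rho).
Local Notation T := (step xs rho th g).

Definition nflow n x : R := xs + rho ^+ n * (x - xs).

Definition cumflow n x : R := \sum_(j < n) nflow j x.

Definition nojump f n x : R := expR (- (th * cumflow n x)) * f (nflow n x).

(** The unperturbed path survives every step but [i] and jumps at step [i]: the second factor trades
    the survival factor of step [i] for its jump probability. *)
Definition onejump_weight n i x : R :=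
  expR (- (th * cumflow n x)) * (expR (th * nflow i x) - 1).

(** Extra survival factor of the [m] steps after a jump, along which the path is raised by
    [g * rho ^+ j]. *)
Definition later_hazard m : R := expR (- (th * g * \sum_(j < m) rho ^+ j)).

(* The summand [m] is the contribution of a single jump [m] steps before the
   final time [n]. *)
Definition onejump f n x : R :=
  \sum_(m < n) onejump_weight n (n - m.+1) x * later_hazard m *
               f (nflow n x + g * rho ^+ m).

Lemma nflow0 x : nflow 0 x = x.
Proof. by rewrite /nflow expr0 mul1r subrKC. Qed.

Lemma nflowS n x : nflow n (phi x) = nflow n.+1 x.
Proof. by rewrite /nflow /flow exprSr; ring. Qed.

Lemma nflow_add n x y : nflow n (x + y) = nflow n x + rho ^+ n * y.
Proof. by rewrite /nflow; ring. Qed.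

Lemma cumflowS n x : cumflow n.+1 x = x + cumflow n (phi x).
Proof.
rewrite /cumflow big_ord_recl/= nflow0; congr (_ + _).
by apply: eq_bigr => i _; rewrite nflowS.
Qed.

Lemma cumflow_add n x y :
  cumflow n (x + y) = cumflow n x + y * \sum_(j < n) rho ^+ j.
Proof.
rewrite /cumflow mulr_sumr -big_split/=; apply: eq_bigr => i _.
by rewrite nflow_add mulrC.
Qed.

Lemma nojumpS f n x :
  expR (- (th * x)) * nojump f n (phi x) = nojump f n.+1 x.
Proof.
rewrite /nojump nflowS cumflowS mulrA -expRD; congr (expR _ * _); ring.
Qed.

(** Conditioning on the first step: either no jump now and one later, or a jump now and none later.
    The second case is the new summand [m = n]. *)
Lemma onejumpS f n x :
  expR (- (th * x)) * onejump f n (phi x) +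
    (1 - expR (- (th * x))) * nojump f n (phi x + g) = onejump f n.+1 x.
Proof.
rewrite /onejump big_ord_recr/= subnn; congr (_ + _).
  rewrite mulr_sumr; apply: eq_bigr => -[m mn] _ /=.
  rewrite nflowS /onejump_weight cumflowS !mulrA -expRD nflowS subSn//.
  by congr (expR _ * _ * _ * _); ring.
rewrite /nojump /later_hazard /onejump_weight nflow0 nflow_add nflowS [rho ^+ n * g]mulrC.
rewrite !mulrA; congr (_ * _).
rewrite mulrBr mulr1 -expRD mulrBl -expRD.
rewrite mulrBl mul1r -!expRD cumflow_add cumflowS.
by congr (expR _ - expR _); ring.
Qed.

(** Taken as a remainder, so that paths with several jumps never have to be enumerated. *)
Definition morejumps f n x : R := iter n T f x - nojump f n x - onejump f n x.

Lemma morejumps0 f x : morejumps f 0 x = 0.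
Proof.
rewrite /morejumps /onejump /nojump /cumflow !big_ord0 mulr0 oppr0 expR0.
by rewrite nflow0 mul1r addr0 subrr.
Qed.

(** The source term is a jump in the first step followed by exactly one more; any other path with
    two jumps or more has at least two of them after the first step. *)
Lemma morejumpsS f n x : morejumps f n.+1 x =
  T (morejumps f n) x +
  (1 - expR (- (th * x))) * onejump f n (phi x + g).
Proof.
by rewrite /morejumps /= -nojumpS -onejumpS /step; ring.
Qed.

Lemma nflow_ge n x : 0 <= x -> xs * (1 - rho ^+ n) <= nflow n x.
Proof.
move=> x0; have -> : nflow n x = xs * (1 - rho ^+ n) + rho ^+ n * x.
  by rewrite /nflow; ring.
by rewrite lerDl mulr_ge0// exprn_ge0// ltW.
Qed.

Lemma exprn_rho_le1 n : 0 <= rho ^+ n <= 1.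
Proof. by rewrite exprn_ge0 ?exprn_ile1 ?ltW. Qed.

Lemma nflow_ge0 n x : 0 <= x -> 0 <= nflow n x.
Proof.
move=> x0; apply: le_trans (nflow_ge n x0).
by rewrite mulr_ge0// subr_ge0; have /andP[] := exprn_rho_le1 n.
Qed.

Lemma nflow_le n x : 0 <= x -> nflow n x <= x + xs.
Proof.
move=> x0; have /andP[r0 r1] := exprn_rho_le1 n.
have -> : nflow n x = rho ^+ n * x + (1 - rho ^+ n) * xs by rewrite /nflow; ring.
by apply: lerD; rewrite ler_piMl// gerBl.
Qed.

Lemma nflowB n x y : nflow n y - nflow n x = rho ^+ n * (y - x).
Proof. by rewrite /nflow; ring. Qed.

Lemma nflow_homo n x y : x <= y -> nflow n x <= nflow n y.
Proof.
move=> xy; rewrite -subr_ge0 nflowB mulr_ge0 ?subr_ge0//.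
by have /andP[] := exprn_rho_le1 n.
Qed.

Lemma sum_rho_le n : \sum_(j < n) rho ^+ j <= (1 - rho)^-1.
Proof.
have r0 : 0 < 1 - rho by rewrite subr_gt0.
rewrite -[leRHS]mul1r ler_pdivlMr// mulrC.
have -> : (1 - rho) * (\sum_(j < n) rho ^+ j) = 1 - rho ^+ n.
  have := subrX1 rho n.
  by rewrite -[rho - 1]opprB mulNr => /(congr1 -%R); rewrite opprK opprB.
by rewrite lerBlDr lerDl; have /andP[] := exprn_rho_le1 n.
Qed.

(** Survival bound over [n - 1] steps, since one step is set aside for the jump. The term in
    [(1 - rho)^-1] pays for the time during which the flow may still be below [xs]. *)
Definition decay n : R :=
  expR (- (th * xs * (n%:R - 1)) + th * xs * (1 - rho)^-1).

Definition otherflow n i x : R := \sum_(j < n | val j != i) nflow j x.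

Lemma cumflowE n i x : (i < n)%N -> cumflow n x = nflow i x + otherflow n i x.
Proof. by move=> ni; rewrite /cumflow (bigD1 (Ordinal ni)). Qed.

(** Taking step [i] out of the exponent leaves a survival factor times a jump probability, with no
    growing exponential. *)
Lemma onejump_weightE n i x : (i < n)%N -> onejump_weight n i x =
  expR (- (th * otherflow n i x)) * (1 - expR (- (th * nflow i x))).
Proof.
move=> ni; rewrite /onejump_weight (cumflowE _ ni) !mulrBr mulr1 -!expRD mulr1.
by congr (expR _ - expR _); ring.
Qed.

Lemma otherflow_ge n i x : (i < n)%N -> 0 <= x ->
  xs * (n%:R - 1) - xs * (1 - rho)^-1 <= otherflow n i x.
Proof.
move=> ni x0; rewrite /otherflow.
apply: (@le_trans _ _ (\sum_(j < n | val j != i) xs * (1 - rho ^+ j))); last first.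
  by apply: ler_sum => j _; exact: nflow_ge.
rewrite -mulrBr -mulr_sumr ler_wpM2l// sumrB.
have -> : \sum_(j < n | val j != i) (1 : R) = n%:R - 1.
  have : \sum_(j < n) (1 : R) = n%:R by rewrite sumr_const card_ord.
  by rewrite (bigD1 (Ordinal ni))//= => <-; rewrite addrAC subrr add0r.
rewrite lerB//; apply: le_trans (sum_rho_le n).
rewrite [leRHS](bigID (fun j : 'I_n => val j != i))/= lerDl sumr_ge0// => j _.
by have /andP[] := exprn_rho_le1 j.
Qed.

Lemma otherhazard_le n i x : (i < n)%N -> 0 <= x ->
  expR (- (th * otherflow n i x)) <= decay n.
Proof.
move=> ni x0; rewrite ler_expR; have := otherflow_ge ni x0.
by move=> /(ler_wpM2l th0); lra.
Qed.

Lemma nojump_norm_le f n x : (forall w, 0 <= w -> `|f w| <= 1) ->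
  (0 < n)%N -> 0 <= x -> `|nojump f n x| <= decay n.
Proof.
move=> f1 n0 x0; rewrite /nojump normrM ger0_norm ?expR_ge0//.
(* Step 0 is dropped from the exponent so that the bound is the same [decay n] as in the presence of
   one jump. *)
have := @otherhazard_le n 0 x n0 x0.
apply: le_trans; rewrite -[leRHS]mulr1 ler_pM ?expR_ge0 ?f1 ?nflow_ge0//.
by rewrite ler_expR lerN2 ler_wpM2l// (cumflowE _ n0) lerDr nflow_ge0.
Qed.

Lemma onejump_weight_ge0 n i x : 0 <= x -> 0 <= onejump_weight n i x.
Proof.
move=> x0; rewrite mulr_ge0 ?expR_ge0// subr_ge0 -[X in X <= _]expR0.
by rewrite ler_expR mulr_ge0// nflow_ge0.
Qed.

Lemma onejump_weight_le n i x : (i < n)%N -> 0 <= x ->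
  onejump_weight n i x <= decay n * (th * (x + xs)).
Proof.
move=> ni x0; rewrite onejump_weightE// ler_pM ?expR_ge0 ?otherhazard_le//.
  by rewrite one_subr_expRN_ge0// mulr_ge0// nflow_ge0.
apply: le_trans (one_subr_expRN_le _) _.
by rewrite ler_wpM2l// nflow_le.
Qed.

Lemma otherflowB n i x y : x <= y ->
  0 <= otherflow n i y - otherflow n i x <= (1 - rho)^-1 * (y - x).
Proof.
move=> xy; rewrite /otherflow -sumrB.
under eq_bigr do rewrite nflowB.
rewrite -mulr_suml mulr_ge0 ?subr_ge0 ?sumr_ge0//=; last first.
  by move=> j _; have /andP[] := exprn_rho_le1 j.
rewrite ler_wpM2r ?subr_ge0//; apply: le_trans (sum_rho_le n).
rewrite [leRHS](bigID (fun j : 'I_n => val j != i))/= lerDl sumr_ge0// => j _.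
by have /andP[] := exprn_rho_le1 j.
Qed.

(** Product rule for survival factor and jump probability. The geometric factor [rho ^+ i] is kept
    because its sum over the jump times is at most [(1 - rho)^-1]. *)
Lemma onejump_weightB n i x y : (i < n)%N -> 0 <= x -> x <= y ->
  `|onejump_weight n i y - onejump_weight n i x| <=
  decay n * (y - x) * (th * (1 - rho)^-1 * (th * (y + xs)) + th * rho ^+ i).
Proof.
move=> ni x0 xy; have y0 := le_trans x0 xy.
rewrite !onejump_weightE//.
set Ex := expR (- (th * otherflow n i x)).
set Ey := expR (- (th * otherflow n i y)).
set qx := 1 - expR (- (th * nflow i x)).
set qy := 1 - expR (- (th * nflow i y)).
have Ex_le : Ex <= decay n by exact: otherhazard_le.
have Ex0 : 0 <= Ex by exact: expR_ge0.
have ci := exprn_rho_le1 i.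
have qy0 : 0 <= qy by rewrite one_subr_expRN_ge0// mulr_ge0// nflow_ge0.
have qy_le : qy <= th * (y + xs).
  by apply: le_trans (one_subr_expRN_le _) _; rewrite ler_wpM2l// nflow_le.
have /andP[q1 q2] : 0 <= qy - qx <= th * rho ^+ i * (y - x).
  rewrite -mulrA -nflowB mulrBr.
  have -> : qy - qx = expR (- (th * nflow i x)) - expR (- (th * nflow i y)).
    by rewrite /qx /qy; ring.
  by apply: ler_subr_expRN; rewrite ?mulr_ge0 ?nflow_ge0// ler_wpM2l// nflow_homo.
have /andP[oB0 oB1] := otherflowB n i xy.
have Exy0 : Ey <= Ex.
  by rewrite ler_expR lerN2 ler_wpM2l// -subr_ge0.
have Exy : Ex - Ey <= Ex * (th * (1 - rho)^-1 * (y - x)).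
  have -> : Ey = Ex * expR (- (th * (otherflow n i y - otherflow n i x))).
    by rewrite -expRD; congr expR; ring.
  rewrite -[X in X - _]mulr1 -mulrBr ler_wpM2l//.
  by apply: le_trans (one_subr_expRN_le _) _; rewrite -mulrA ler_wpM2l.
have -> : Ey * qy - Ex * qx = - ((Ex - Ey) * qy) + Ex * (qy - qx) by ring.
apply: le_trans (ler_normD _ _) _; rewrite normrN !normrM.
rewrite (ger0_norm qy0) (ger0_norm q1) (ger0_norm Ex0) ger0_norm ?subr_ge0//.
have -> : decay n * (y - x) * (th * (1 - rho)^-1 * (th * (y + xs)) + th * rho ^+ i) =
  decay n * (th * (1 - rho)^-1 * (y - x)) * (th * (y + xs)) +
  decay n * (th * rho ^+ i * (y - x)) by ring.
have S0 : 0 <= (1 - rho)^-1 by rewrite invr_ge0 subr_ge0 ltW.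
apply: lerD.
  apply: ler_pM => //; first by rewrite subr_ge0.
  by apply: le_trans Exy _; rewrite ler_wpM2r// !mulr_ge0// subr_ge0.
by apply: ler_pM => //; rewrite -subr_ge0.
Qed.

Lemma later_hazard_ge0 m : 0 <= later_hazard m.
Proof. exact: expR_ge0. Qed.

Lemma later_hazard_le1 m : later_hazard m <= 1.
Proof.
apply: expRN_le1; rewrite !mulr_ge0// ?(ltW g0)//.
by apply: sumr_ge0 => j _; have /andP[] := exprn_rho_le1 j.
Qed.

Lemma onejump_norm_le f n x : (forall w, 0 <= w -> `|f w| <= 1) -> 0 <= x ->
  `|onejump f n x| <= n%:R * (decay n * (th * (x + xs))).
Proof.
move=> f1 x0; rewrite /onejump; apply: le_trans (ler_norm_sum _ _ _) _.
rewrite mulr_natl -[X in _ *+ X](card_ord n) -sumr_const.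
apply: ler_sum => m _; rewrite -[leRHS]mulr1 normrM ler_pM//; last first.
  by rewrite f1// addr_ge0 ?nflow_ge0// mulr_ge0 ?(ltW g0)//;
    have /andP[] := exprn_rho_le1 m.
rewrite normrM !ger0_norm ?later_hazard_ge0 ?onejump_weight_ge0//.
rewrite -[leRHS]mulr1 ler_pM ?later_hazard_ge0 ?later_hazard_le1 ?onejump_weight_ge0//.
by rewrite onejump_weight_le//; case: m => m mn /=; rewrite ltn_subrL/=; case: n mn.
Qed.

Lemma onejump_weight_monotone n x :
  (forall m, onejump_weight n (n - m.+1) x <= onejump_weight n (n - m.+2) x) \/
  (forall m, onejump_weight n (n - m.+2) x <= onejump_weight n (n - m.+1) x).
Proof.
have mono m : rho ^+ (n - m.+1) <= rho ^+ (n - m.+2).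
  by rewrite ler_wiXn2l ?(ltW rho0) ?(ltW rho1)//; apply: leq_sub2l.
have [xxs|xxs] := leP xs x; [left|right] => m;
  rewrite ler_wpM2l ?expR_ge0// lerD2r ler_expR ler_wpM2l// /nflow lerD2l.
- by rewrite ler_wpM2r ?subr_ge0.
- by rewrite ler_wnM2r// subr_le0 ltW.
Qed.

(* [F] plays the role of an antiderivative of [f]. *)
Record antiderivative_bounds (f F : R -> R) (Cf : R) : Prop := {
  ab_bounded : forall w, 0 <= w -> `|f w| <= 1 ;
  ab_lipschitz : forall w w', 0 <= w -> w <= w' -> `|F w' - F w| <= w' - w ;
  ab_ge0 : 0 <= Cf ;
  ab_quadratic : forall w w' s s', 0 <= w -> w <= w' -> 0 <= s' -> s' <= s ->
    `|(f (w' + s) - f (w + s)) * (s - s') -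
      (F (w' + s) - F (w + s) - (F (w' + s') - F (w + s')))| <=
    Cf * (s - s') ^+ 2 * (w' - w) }.

(** The sum is a Riemann sum over the points [g * rho ^+ m] with spacings [del m]: [f] times [del m]
    is replaced by increments of [F], after which summation by parts needs only the bound [w' - w]
    on [D]. The error [e] of this replacement is quadratic in [del m] and the spacings add up to at
    most [g], hence [Cf * g]. The power [rho ^+ n] in the denominator comes from the smallest
    spacing. *)
Lemma weighted_shift_le f F Cf n x w w' :
  antiderivative_bounds f F Cf -> 0 <= x -> 0 <= w -> w <= w' ->
  `|\sum_(m < n) onejump_weight n (n - m.+1) x * later_hazard m *
     (f (w' + g * rho ^+ m) - f (w + g * rho ^+ m))| <=
  decay n * (th * (x + xs)) * (w' - w) *
    (4 / (g * (1 - rho) * rho ^+ n) + Cf * g).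
Proof.
case=> _ Flip Cf0 fF x0 w0 ww'.
case: n => [|n].
  rewrite big_ord0 normr0; apply: mulr_ge0.
    by rewrite mulr_ge0 ?subr_ge0// mulr_ge0 ?expR_ge0// mulr_ge0// addr_ge0.
  apply: addr_ge0; last by rewrite mulr_ge0// ltW.
  by rewrite expr0 mulr1 divr_ge0// mulr_ge0 ?(ltW g0)// subr_ge0 ltW.
set N := n.+1; set Bd := decay N * (th * (x + xs)).
have r0 : 0 < 1 - rho by rewrite subr_gt0.
have rp m : 0 < rho ^+ m by rewrite exprn_gt0.
pose del m := g * rho ^+ m * (1 - rho).
have del0 m : 0 < del m by rewrite !mulr_gt0.
pose k m := onejump_weight N (N - m.+1) x.
pose u m := later_hazard m / del m.
pose D m := F (w' + g * rho ^+ m) - F (w + g * rho ^+ m).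
pose e m := (f (w' + g * rho ^+ m) - f (w + g * rho ^+ m)) * del m - (D m - D m.+1).
have grm m : 0 <= g * rho ^+ m by rewrite mulr_ge0 ?(ltW g0) ?(ltW (rp m)).
have kB m : 0 <= k m <= Bd.
  by rewrite onejump_weight_ge0// onejump_weight_le// ltn_subrL.
have Bd0 : 0 <= Bd by have /andP[] := kB 0%N; exact: le_trans.
have u0 m : 0 <= u m by rewrite divr_ge0 ?later_hazard_ge0 ?ltW.
have De m : `|D m| <= w' - w.
  have -> : w' - w = (w' + g * rho ^+ m) - (w + g * rho ^+ m) by ring.
  by apply: Flip; rewrite ?lerD2r ?addr_ge0.
(* From [m] to [m.+1] the spacing is multiplied by [rho] and the survival factor by at least
   [expR (- (th * g))]; by [rho_th] the quotient cannot decrease. For the process this is the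
   condition b >= c g. *)
have uS m : u m <= u m.+1.
  rewrite /u ler_pdivrMr// mulrAC ler_pdivlMr//.
  have -> : later_hazard m * del m.+1 = rho * later_hazard m * del m.
    by rewrite /del exprS; ring.
  rewrite ler_wpM2r ?(ltW (del0 m))//.
  have -> : later_hazard m = later_hazard m.+1 * expR (th * g * rho ^+ m).
    by rewrite /later_hazard -expRD big_ord_recr/=; congr expR; ring.
  rewrite mulrCA ler_piMr ?later_hazard_ge0//; apply: le_trans rho_th.
  rewrite ler_wpM2l ?(ltW rho0)// ler_expR ler_piMr ?mulr_ge0 ?(ltW g0)//.
  by have /andP[] := exprn_rho_le1 m.
have ee m : `|e m| <= Cf * del m ^+ 2 * (w' - w).
  have dE : del m = g * rho ^+ m - g * rho ^+ m.+1 by rewrite /del exprS; ring.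
  rewrite /e dE; apply: fF => //.
  by rewrite exprS ler_wpM2l ?(ltW g0)// ler_piMl ?ltW.
have -> : \sum_(m < N) k m * later_hazard m *
     (f (w' + g * rho ^+ m) - f (w + g * rho ^+ m)) =
   \sum_(m < N) k m * u m * (D m - D m.+1) + \sum_(m < N) k m * u m * e m.
  rewrite -big_split/=; apply: eq_bigr => m _; rewrite /e /u.
  by field; rewrite gt_eqF.
apply: le_trans (ler_normD _ _) _; rewrite mulrDr; apply: lerD.
  apply: le_trans (abel_monotone N kB u0 uS (onejump_weight_monotone N x) De) _.
  rewrite /u /del.
  have -> : Bd * (w' - w) * (4 / (g * (1 - rho) * rho ^+ N)) =
    4 * (Bd * (1 / (g * rho ^+ N * (1 - rho))) * (w' - w)).
    by field; rewrite !gt_eqF.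
  rewrite ler_wpM2l// ler_wpM2r ?subr_ge0// ler_wpM2l//.
  by rewrite ler_wpM2r ?later_hazard_le1// invr_ge0 ltW// !mulr_gt0.
apply: le_trans (ler_norm_sum _ _ _) _.
apply: (@le_trans _ _ (\sum_(m < N) Bd * (Cf * (w' - w)) * del m)).
  apply: ler_sum => m _; rewrite normrM ger0_norm; last first.
    by rewrite mulr_ge0//; have /andP[] := kB m.
  have /andP[km0 kmB] := kB m.
  have -> : k m * u m * `|e m| = k m * (u m * `|e m|) by ring.
  have -> : Bd * (Cf * (w' - w)) * del m = Bd * (Cf * ((w' - w) * del m)) by ring.
  apply: ler_pM => //; first by rewrite mulr_ge0.
  apply: (@le_trans _ _ (u m * (Cf * del m ^+ 2 * (w' - w)))).
    by rewrite ler_wpM2l.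
  have -> : u m * (Cf * del m ^+ 2 * (w' - w)) =
     later_hazard m * (Cf * ((w' - w) * del m)) by rewrite /u; field; rewrite gt_eqF.
  by rewrite ler_piMl ?later_hazard_le1// !mulr_ge0 ?subr_ge0// ltW.
have -> : Bd * (w' - w) * (Cf * g) = Bd * (Cf * (w' - w)) * g by ring.
rewrite -mulr_sumr ler_wpM2l//.
  by rewrite (mulr_ge0 Bd0)// mulr_ge0// subr_ge0.
rewrite /del -mulr_suml -mulr_sumr -mulrA ler_piMr ?(ltW g0)//.
by rewrite -ler_pdivlMr// mul1r sum_rho_le.
Qed.

(** After [n] steps the two paths differ by [rho ^+ n * (y - x)], which cancels the power of [rho]
    in the denominator of [weighted_shift_le]. The regularity of [f] enters only through
    [th * Cf * g], which vanishes with the time step. *)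
Lemma onejump_lipschitz f F Cf n x y :
  antiderivative_bounds f F Cf -> 0 <= x -> x <= y ->
  `|onejump f n y - onejump f n x| <= decay n * (y - x) *
   ((y + xs) * (th * (1 - rho)^-1 * (n%:R * th) +
                4 * (th * (1 - rho)^-1) / g + th * Cf * g) +
    th * (1 - rho)^-1).
Proof.
move=> fF x0 xy; have y0 := le_trans x0 xy.
have f1 := ab_bounded fF; have Cf0 := ab_ge0 fF.
have r0 : 0 < 1 - rho by rewrite subr_gt0.
have S0 : 0 <= (1 - rho)^-1 by rewrite invr_ge0 ltW.
have rp m : 0 < rho ^+ m by rewrite exprn_gt0.
have -> : onejump f n y - onejump f n x =
  \sum_(m < n) (onejump_weight n (n - m.+1) y - onejump_weight n (n - m.+1) x) *
     later_hazard m * f (nflow n y + g * rho ^+ m) +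
  \sum_(m < n) onejump_weight n (n - m.+1) x * later_hazard m *
     (f (nflow n y + g * rho ^+ m) - f (nflow n x + g * rho ^+ m)).
  by rewrite /onejump -sumrB -big_split; apply: eq_bigr => m _ /=; ring.
have -> : decay n * (y - x) *
   ((y + xs) * (th * (1 - rho)^-1 * (n%:R * th) +
                4 * (th * (1 - rho)^-1) / g + th * Cf * g) +
    th * (1 - rho)^-1) =
  decay n * (y - x) * (th * (1 - rho)^-1 * (th * (y + xs)) * n%:R +
    th * (1 - rho)^-1) +
  decay n * (th * (y + xs)) * (y - x) * (4 / (g * (1 - rho)) + Cf * g).
  by field; rewrite !gt_eqF.
apply: le_trans (ler_normD _ _) _; apply: lerD; last first.
  have := weighted_shift_le n fF x0 (nflow_ge0 n x0) (nflow_homo n xy).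
  move=> /le_trans; apply; rewrite nflowB.
  have -> : decay n * (th * (x + xs)) * (rho ^+ n * (y - x)) *
   (4 / (g * (1 - rho) * rho ^+ n) + Cf * g) =
   decay n * (th * (x + xs)) * (y - x) * (4 / (g * (1 - rho)) + Cf * g * rho ^+ n).
    by field; rewrite !gt_eqF.
  have d0 : 0 <= decay n by exact: expR_ge0.
  have yx : 0 <= y - x by rewrite subr_ge0.
  apply: ler_pM.
  - by rewrite !mulr_ge0// addr_ge0.
  - apply: addr_ge0; first by rewrite divr_ge0// mulr_ge0 ?(ltW g0) ?(ltW r0).
    by rewrite mulr_ge0 ?(ltW (rp n))// mulr_ge0// ltW.
  - by rewrite ler_wpM2r// ler_wpM2l// ler_wpM2l// lerD2r.
  - rewrite lerD2l ler_piMr ?mulr_ge0 ?(ltW g0)//.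
    by have /andP[] := exprn_rho_le1 n.
apply: le_trans (ler_norm_sum _ _ _) _.
apply: (@le_trans _ _ (\sum_(m < n) decay n * (y - x) *
    (th * (1 - rho)^-1 * (th * (y + xs)) + th * rho ^+ (n - m.+1)))).
  apply: ler_sum => m _.
  apply: le_trans (onejump_weightB (i := n - m.+1) _ x0 xy); last first.
    by case: m => m mn /=; rewrite ltn_subrL/=; case: n mn.
  rewrite !normrM -mulrA ler_piMr// mulr_ile1//.
    by rewrite ger0_norm ?later_hazard_ge0// later_hazard_le1.
  by rewrite f1// addr_ge0 ?nflow_ge0// mulr_ge0 ?(ltW g0) ?(ltW (rp m)).
rewrite -mulr_sumr ler_wpM2l//.
  by rewrite mulr_ge0 ?expR_ge0// subr_ge0.
rewrite big_split/= sumr_const card_ord -[X in X + _ <= _]mulr_natr lerD2l.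
rewrite -mulr_sumr ler_wpM2l//.
rewrite (reindex_inj rev_ord_inj)/=.
under eq_bigr => j _ do rewrite subnSK// subKn ?(ltnW (ltn_ord j))//.
exact: sum_rho_le.
Qed.

End onejump.

Section expRN_upper.
Context {R : realType}.

Lemma expRN_le_quadratic (u : R) : 0 <= u -> expR (- u) <= 1 - u + u ^+ 2.
Proof.
move=> u0; have e0 : 0 < expR u by exact: expR_gt0.
rewrite expRN -[leLHS]mul1r ler_pdivrMr//.
apply: (@le_trans _ _ ((1 - u + u ^+ 2) * (1 + u))).
  have -> : (1 - u + u ^+ 2) * (1 + u) = 1 + u ^+ 3 by ring.
  by rewrite lerDl exprn_ge0.
rewrite ler_wpM2l ?expR_ge1Dx//.
have -> : 1 - u + u ^+ 2 = (1 - u / 2) ^+ 2 + 3 * (u / 2) ^+ 2 by field.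
by rewrite addr_ge0 ?sqr_ge0// mulr_ge0 ?sqr_ge0.
Qed.

End expRN_upper.

(** * Increments of x^2 and x^3 over one step *)

Section cubic.
Context {R : realType}.
Variables a c g h eta rho : R.
Hypotheses (a0 : 0 < a) (c0 : 0 < c) (g0 : 0 < g) (h0 : 0 <= h) (h1 : h <= 1).
Hypotheses (eta0 : 0 <= eta) (eta_le : eta <= a * h).
Hypotheses (rho0 : 0 <= rho) (rho_le1 : rho <= 1) (r_le1 : rho + c * h * g <= 1).

Let th := c * h.

Definition cst2 : R := 2 * a + 2 * g * (c * a) + c * g ^+ 2.

Definition cst3 : R := 3 * a + 6 * g * (c * a) + 3 * g ^+ 2 * c +
  (3 * a ^+ 2 + 3 * g * (c * a ^+ 2) + 3 * g ^+ 2 * (c * a) + c * g ^+ 3).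

(** The left side bounds the increment of x^2 over one coupled step, divided by [y - x]. Its leading
    coefficient is at most [(rho + th * g) ^+ 2], hence at most the factor [rho + th * g] of the
    linear function; the rest is of order [h]. *)
Lemma quadratic_increment x y : 0 <= x -> x <= y ->
  rho * ((rho * x + eta) + (rho * y + eta)) +
  th * (2 * g * (rho * y + eta) + g ^+ 2) + th * x * (2 * g * rho) <=
  (rho + th * g) * (x + y) + h * cst2.
Proof.
move=> x0 xy.
have th0 : 0 <= th by rewrite mulr_ge0// ltW.
have xy0 : 0 <= x + y by lra.
have thg : 0 <= th * g by rewrite mulr_ge0// ltW.
have -> : rho * ((rho * x + eta) + (rho * y + eta)) +
  th * (2 * g * (rho * y + eta) + g ^+ 2) + th * x * (2 * g * rho) =
  (rho ^+ 2 + 2 * (th * g) * rho) * (x + y) +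
  (2 * (rho * eta) + 2 * g * (th * eta) + th * g ^+ 2) by ring.
apply: lerD.
  rewrite ler_wpM2r//.
  apply: (@le_trans _ _ ((rho + th * g) ^+ 2)).
    have -> : (rho + th * g) ^+ 2 = rho ^+ 2 + 2 * (th * g) * rho + (th * g) ^+ 2 by ring.
    by rewrite lerDl sqr_ge0.
  by rewrite expr2 ler_piMl// addr_ge0.
have re : rho * eta <= a * h by apply: le_trans eta_le; rewrite ler_piMl.
have te : th * eta <= c * a * h.
  have -> : c * a * h = c * (a * h) by ring.
  rewrite /th -mulrA ler_wpM2l ?(ltW c0)//.
  by apply: le_trans eta_le; rewrite ler_piMl.
have := ler_wpM2l (ltW g0) te.
by rewrite /cst2 /th; lra.
Qed.

(** As for x^2, now with [(rho + th * g) ^+ 3]. The remainder grows with [x + y], so that it has to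
    be absorbed by the quadratic part of [V]; this forces [ga] to be small compared with [be]. *)
Lemma cubic_increment x y : 0 <= x -> x <= y ->
  rho * ((rho * x + eta) ^+ 2 + (rho * x + eta) * (rho * y + eta) +
         (rho * y + eta) ^+ 2) +
  th * (3 * g * (rho * y + eta) ^+ 2 + 3 * g ^+ 2 * (rho * y + eta) + g ^+ 3) +
  th * x * (rho * (3 * g * ((rho * x + eta) + (rho * y + eta)) + 3 * g ^+ 2)) <=
  (rho + th * g) * (x ^+ 2 + x * y + y ^+ 2) + h * cst3 * (1 + (x + y)).
Proof.
move=> x0 xy.
have y0 : 0 <= y by lra.
have th0 : 0 <= th by rewrite mulr_ge0// ltW.
have xy0 : 0 <= x + y by lra.
have thg : 0 <= th * g by rewrite mulr_ge0// ltW.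
have g2 : 0 <= g ^+ 2 by rewrite sqr_ge0.
set s := x + y; set Q := x ^+ 2 + x * y + y ^+ 2.
have Q0 : 0 <= Q by rewrite /Q !addr_ge0 ?sqr_ge0 ?mulr_ge0.
have -> : rho * ((rho * x + eta) ^+ 2 + (rho * x + eta) * (rho * y + eta) +
         (rho * y + eta) ^+ 2) +
  th * (3 * g * (rho * y + eta) ^+ 2 + 3 * g ^+ 2 * (rho * y + eta) + g ^+ 3) +
  th * x * (rho * (3 * g * ((rho * x + eta) + (rho * y + eta)) + 3 * g ^+ 2)) =
  (rho ^+ 3 + 3 * (th * g) * rho ^+ 2) * Q +
  ((3 * (rho ^+ 2 * eta) + 6 * g * (rho * (th * eta)) + 3 * g ^+ 2 * (th * rho)) * s +
  (3 * (rho * eta ^+ 2) + 3 * g * (th * eta ^+ 2) + 3 * g ^+ 2 * (th * eta) +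
   th * g ^+ 3)) by rewrite /s /Q; ring.
apply: lerD.
  rewrite ler_wpM2r//.
  apply: (@le_trans _ _ ((rho + th * g) ^+ 3)).
    have -> : (rho + th * g) ^+ 3 = rho ^+ 3 + 3 * (th * g) * rho ^+ 2 +
      (3 * rho * (th * g) ^+ 2 + (th * g) ^+ 3) by ring.
    by rewrite lerDl addr_ge0 ?exprn_ge0// mulr_ge0 ?sqr_ge0// mulr_ge0.
  by rewrite exprS ler_piMr ?exprn_ile1// addr_ge0.
have re : rho * eta <= a * h by apply: le_trans eta_le; rewrite ler_piMl.
have rre : rho ^+ 2 * eta <= a * h.
  by rewrite expr2 -mulrA; apply: le_trans re; rewrite ler_piMl// mulr_ge0.
have te : th * eta <= c * a * h.
  have -> : c * a * h = c * (a * h) by ring.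
  rewrite /th -mulrA ler_wpM2l ?(ltW c0)//.
  by apply: le_trans eta_le; rewrite ler_piMl.
have rte : rho * (th * eta) <= c * a * h.
  by apply: le_trans te; rewrite ler_piMl// mulr_ge0.
have eta_a : eta <= a by apply: le_trans eta_le _; rewrite ler_piMr// ltW.
have ee : eta ^+ 2 <= a ^+ 2 * h.
  have -> : a ^+ 2 * h = a * (a * h) by ring.
  by rewrite expr2 ler_pM.
have ree : rho * eta ^+ 2 <= a ^+ 2 * h.
  by apply: le_trans ee; rewrite ler_piMl// sqr_ge0.
have tee : th * eta ^+ 2 <= c * a ^+ 2 * h.
  have -> : c * a ^+ 2 * h = c * (a ^+ 2 * h) by ring.
  rewrite /th -mulrA ler_wpM2l ?(ltW c0)//.
  by apply: le_trans ee; rewrite ler_piMl// sqr_ge0.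
have tr : th * rho <= c * h by rewrite ler_piMr.
(* [k1] collects the coefficients of [x + y] and [k2] the constant terms; [cst3] is their sum. *)
pose k1 := 3 * a + 6 * g * (c * a) + 3 * g ^+ 2 * c.
pose k2 := 3 * a ^+ 2 + 3 * g * (c * a ^+ 2) + 3 * g ^+ 2 * (c * a) + c * g ^+ 3.
have k10 : 0 <= k1.
  by rewrite /k1; do ?apply: addr_ge0; do ?apply: mulr_ge0; rewrite ?sqr_ge0 ?ler0n ?(ltW a0) ?(ltW c0) ?(ltW g0).
have k20 : 0 <= k2.
  by rewrite /k2; do ?apply: addr_ge0; do ?apply: mulr_ge0; rewrite ?exprn_ge0 ?sqr_ge0 ?ler0n ?(ltW a0) ?(ltW c0) ?(ltW g0).
have b1 : 3 * (rho ^+ 2 * eta) + 6 * g * (rho * (th * eta)) + 3 * g ^+ 2 * (th * rho) <= h * k1.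
  have := ler_wpM2l (ltW g0) rte; have := ler_wpM2l g2 tr.
  by rewrite /k1; lra.
have b2 : 3 * (rho * eta ^+ 2) + 3 * g * (th * eta ^+ 2) + 3 * g ^+ 2 * (th * eta) +
   th * g ^+ 3 <= h * k2.
  have := ler_wpM2l (ltW g0) tee; have := ler_wpM2l g2 te.
  by rewrite /k2 /th; lra.
have -> : h * cst3 * (1 + s) = h * k1 * s + h * k2 + (h * k1 + h * k2 * s).
  by rewrite /cst3 /k1 /k2; ring.
apply: (@le_trans _ _ (h * k1 * s + h * k2)).
  by apply: lerD => //; rewrite ler_wpM2r.
by rewrite lerDl addr_ge0 ?mulr_ge0.
Qed.

End cubic.

(** * Estimates for the chain, uniform in the time step *)

Section drift.
Context {R : realType}.
Variables a b c g : R.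
Hypotheses (a0 : 0 < a) (b0 : 0 < b) (c0 : 0 < c) (g0 : 0 < g).
Let p := b - c * g.
Hypothesis p0 : 0 < p.

Definition cubic (be ga x : R) : R := x + be * x ^+ 2 + ga * x ^+ 3.

Definition chain h : (R -> R) -> R -> R := step (a / b) (expR (- (b * h))) (c * h) g.

(** The bound on [b * h] keeps [1 - rho] above [b * h / 2]; the bound on [b ^+ 2 * h] limits the
    second-order excess of [rho] to a quarter of [p * h]. *)
Definition small_step h : Prop :=
  [/\ 0 < h, h <= 1, b * h <= 2^-1 & b ^+ 2 * h <= p / 4].

Lemma small_stepP : exists2 h0 : R, 0 < h0 & forall h, 0 < h -> h <= h0 -> small_step h.
Proof.
pose h0 := Num.min 1 (Num.min (2^-1 / b) (p / 4 / b ^+ 2)).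
exists h0.
  by rewrite !lt_min ltr01 !divr_gt0 ?exprn_gt0.
move=> h hp; rewrite !le_min => /and3P[h1 h2 h3]; split => //.
  by rewrite mulrC -ler_pdivlMr.
by rewrite mulrC -ler_pdivlMr// exprn_gt0.
Qed.

Section small.
Variable h : R.
Hypothesis hs : small_step h.

Let rho := expR (- (b * h)).

Lemma rho_gt0 : 0 < rho. Proof. exact: expR_gt0. Qed.

Lemma rho_lt1 : rho < 1.
Proof. by case: hs => hp _ _ _; rewrite -expR0 ltr_expR oppr_lt0 mulr_gt0. Qed.

Lemma rho_contract : rho + c * h * g <= 1 - (p * h) * (3 / 4).
Proof.
case: hs => hp h1 h2 h3.
have := @expRN_le_quadratic _ (b * h) _; rewrite -/rho => /(_ _).
have H : b ^+ 2 * h * h <= p / 4 * h by rewrite ler_wpM2r// ltW.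
move=> Q; have {}Q : rho <= 1 - b * h + (b * h) ^+ 2 by apply: Q; rewrite mulr_ge0 ?ltW.
by move: H; rewrite /p in Q * => H; rewrite /p in H *; lra.
Qed.

Lemma onem_rho_le : 1 - rho <= b * h.
Proof. exact: one_subr_expRN_le. Qed.

Lemma onem_rho_inv : (1 - rho)^-1 <= 2 / (b * h).
Proof.
case: hs => hp h1 h2 h3.
have bh : 0 < b * h by rewrite mulr_gt0.
have Q : rho <= 1 - b * h + (b * h) ^+ 2 by apply: expRN_le_quadratic; rewrite ltW.
have r1 := rho_lt1.
have Q2 : (b * h) ^+ 2 <= (b * h) * 2^-1 by rewrite expr2 ler_wpM2l// ltW.
rewrite -[leLHS]mul1r ler_pdivrMr ?subr_gt0//.
rewrite mulrAC ler_pdivlMr// mul1r.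
by lra.
Qed.

Lemma rho_jump : rho * expR (c * h * g) <= 1.
Proof.
case: hs => hp _ _ _; rewrite -expRD -expR0 ler_expR.
by have := mulr_ge0 (ltW p0) (ltW hp); rewrite /p; lra.
Qed.

Lemma eta_bounds : 0 <= a / b * (1 - rho) <= a * h.
Proof.
have ab : 0 <= a / b by rewrite divr_ge0// ltW.
rewrite mulr_ge0//=; last by rewrite subr_ge0 ltW// rho_lt1.
have -> : a * h = a / b * (b * h) by field; rewrite gt_eqF.
by rewrite ler_wpM2l// onem_rho_le.
Qed.

Variables be ga : R.
Hypotheses (be0 : 0 < be) (ga0 : 0 < ga).
Hypotheses (be_small : be * cst2 a c g + ga * cst3 a c g <= p / 4).
Hypothesis (ga_small : ga * cst3 a c g <= be * (p / 4)).

Local Notation V := (cubic be ga).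
Local Notation T := (chain h).

(** [rho_contract] supplies the factor [1 - (p * h) * (3 / 4)]. In the quotient by [y - x], the
    remainders cost at most [p * h / 4] of the constant term, by [be_small], and the same fraction
    of the term linear in [x + y], by [ga_small]. *)
Lemma chain_cubicB x y : 0 <= x -> x <= y ->
  T V y - T V x <= (1 - p * h / 2) * (V y - V x).
Proof.
move=> x0 xy; case: (hs) => hp h1 _ _.
have y0 : 0 <= y by exact: le_trans xy.
have /andP[eta0 eta_le] := eta_bounds.
have [r0 r1] := (ltW rho_gt0, ltW rho_lt1).
set eta := a / b * (1 - rho) in eta0 eta_le.
have fl z : flow (a / b) rho z = rho * z + eta by rewrite /flow /eta; ring.
rewrite /chain /step -/rho !fl.
set X := rho * x + eta; set Y := rho * y + eta.
set qx := 1 - expR (- (c * h * x)); set qy := 1 - expR (- (c * h * y)).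
have X0 : 0 <= X by rewrite /X addr_ge0// mulr_ge0.
have Y0 : 0 <= Y by rewrite /Y addr_ge0// mulr_ge0.
have XY : X <= Y by rewrite /X /Y lerD2r ler_wpM2l.
have ch0 : 0 <= c * h by rewrite mulr_ge0 ?ltW.
have q1 : qy - qx <= c * h * (y - x).
  have /andP[_] : 0 <= expR (- (c * h * x)) - expR (- (c * h * y)) <= c * h * y - c * h * x.
    by apply: ler_subr_expRN; [rewrite mulr_ge0|rewrite ler_wpM2l].
  by rewrite /qy /qx mulrBr; lra.
have q2 : qx <= c * h * x by exact: one_subr_expRN_le.
pose D z := V (z + g) - V z.
have DE z : D z = g + be * (2 * g * z + g ^+ 2) +
   ga * (3 * g * z ^+ 2 + 3 * g ^+ 2 * z + g ^+ 3) by rewrite /D /cubic; ring.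
have gp := ltW g0; have bep := ltW be0; have gap := ltW ga0.
have D0 : 0 <= D Y.
  by rewrite DE; nneg.
have DD : D Y - D X = (Y - X) * (be * (2 * g) + ga * (3 * g * (X + Y) + 3 * g ^+ 2)).
  by rewrite !DE; ring.
have DD0 : 0 <= D Y - D X.
  by rewrite DD; nneg.
(* Jump probabilities are replaced by the hazards that bound them; they multiply the nonnegative
   quantities [D Y] and [D Y - D X]. *)
apply: (@le_trans _ _ ((V Y - V X) + c * h * (y - x) * D Y + c * h * x * (D Y - D X))).
  have := ler_wpM2r D0 q1; have := ler_wpM2r DD0 q2.
  by rewrite /qy /qx /D; lra.
have YX : Y - X = rho * (y - x) by rewrite /X /Y; ring.
have d0 : 0 <= y - x by rewrite subr_ge0.
have -> : (V Y - V X) + c * h * (y - x) * D Y + c * h * x * (D Y - D X) =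
  (y - x) * ((rho + c * h * g) +
   be * (rho * (X + Y) + c * h * (2 * g * Y + g ^+ 2) + c * h * x * (2 * g * rho)) +
   ga * (rho * (X ^+ 2 + X * Y + Y ^+ 2) +
     c * h * (3 * g * Y ^+ 2 + 3 * g ^+ 2 * Y + g ^+ 3) +
     c * h * x * (rho * (3 * g * (X + Y) + 3 * g ^+ 2)))).
  have -> : V Y - V X = (Y - X) * (1 + be * (X + Y) + ga * (X ^+ 2 + X * Y + Y ^+ 2)).
    by rewrite /cubic; ring.
  by rewrite DD DE YX; ring.
have -> : (1 - p * h / 2) * (V y - V x) = (y - x) * ((1 - p * h / 2) *
   (1 + be * (x + y) + ga * (x ^+ 2 + x * y + y ^+ 2))) by rewrite /cubic; ring.
rewrite ler_wpM2l//.
have rc := rho_contract.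
have ph0 : 0 <= p * h by rewrite mulr_ge0 ?ltW.
have r_le1 : rho + c * h * g <= 1 by lra.
have B2 := quadratic_increment c0 g0 (ltW hp) h1 eta0 eta_le r0 r1 r_le1 x0 xy.
have B3 := cubic_increment a0 c0 g0 (ltW hp) h1 eta0 eta_le r0 r1 r_le1 x0 xy.
apply: (@le_trans _ _ ((rho + c * h * g) +
  be * ((rho + c * h * g) * (x + y) + h * cst2 a c g) +
  ga * ((rho + c * h * g) * (x ^+ 2 + x * y + y ^+ 2) + h * cst3 a c g * (1 + (x + y))))).
  by apply: lerD; [rewrite lerD2l ler_wpM2l|rewrite ler_wpM2l].
have s0 : 0 <= x + y by rewrite addr_ge0.
have Q0 : 0 <= x ^+ 2 + x * y + y ^+ 2 by rewrite !addr_ge0 ?sqr_ge0 ?mulr_ge0.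
set Q := x ^+ 2 + x * y + y ^+ 2 in Q0 *; set s := x + y in s0 *.
have E1 := ler_wpM2l (ltW hp) be_small.
have E2 := ler_wpM2r s0 (ler_wpM2l (ltW hp) ga_small).
have M0 : 0 <= 1 + be * s + ga * Q by rewrite !addr_ge0 ?mulr_ge0.
have E3 := ler_wpM2r M0 rc.
have E4 : 0 <= p * h * (ga * Q) by nneg.
have E5 : 0 <= p * h * (be * s) by nneg.
by lra.
Qed.

(** Comparison with the state 0, where [V] vanishes and no jump occurs, turns the contraction of
    increments into a drift inequality; the flow moves 0 by at most [a * h]. *)
Lemma chain_cubic_le x : 0 <= x ->
  T V x <= (1 - p * h / 2) * V x + (a + be * a ^+ 2 + ga * a ^+ 3) * h.
Proof.
move=> x0; case: (hs) => hp h1 _ _.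
have := chain_cubicB (lexx 0) x0.
have -> : V 0 = 0 by rewrite /cubic !expr0n/= !mulr0 !addr0.
have /andP[eta0 eta_le] := eta_bounds.
have -> : T V 0 = V (a / b * (1 - rho)).
  rewrite /chain /step mulr0 oppr0 expR0 subrr mul0r addr0 mul1r /flow -/rho.
  by congr V; ring.
set eta := a / b * (1 - rho) in eta0 eta_le *.
have eta_a : eta <= a by apply: le_trans eta_le _; rewrite ler_piMr// ltW.
have ee : eta ^+ 2 <= a * (a * h) by rewrite expr2 ler_pM.
have eee : eta ^+ 3 <= a * (a * (a * h)) by rewrite exprS ler_pM ?sqr_ge0.
have := ler_wpM2l (ltW be0) ee; have := ler_wpM2l (ltW ga0) eee.
by rewrite /cubic; lra.
Qed.

Lemma decay_le n : decay (a / b) rho (c * h) n <=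
  expR (a * c / b + 2 * (a * c) / b ^+ 2) * expR (- (a * c / b * (n%:R * h))).
Proof.
case: (hs) => hp h1 _ _; rewrite -expRD ler_expR.
have ac : 0 <= a * c / b by rewrite divr_ge0 ?mulr_ge0 ?ltW.
have -> : - (c * h * (a / b) * (n%:R - 1)) + c * h * (a / b) / (1 - rho) =
  a * c / b * h + a * c / b * (h * (1 - rho)^-1) - a * c / b * (n%:R * h) by ring.
rewrite lerD2r; apply: lerD; first by rewrite ler_piMr.
have -> : 2 * (a * c) / b ^+ 2 = a * c / b * (h * (2 / (b * h))).
  by field; rewrite !gt_eqF.
by rewrite ler_wpM2l// ler_wpM2l ?(ltW hp)// onem_rho_inv.
Qed.

Definition cst_jump : R :=
  c ^+ 2 / g + c * (2 * c / b * c + 4 * (2 * c / b) / g + c * g) + c * (2 * c / b) / g.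

(** This is the increment of the source in [morejumpsS]. By the product rule, the increment of the
    first jump probability meets the size of [onejump], and the first jump probability meets its
    Lipschitz bound; both products carry a factor [h]. *)
Lemma jump_onejump_lipschitz f F Cf n x y :
  antiderivative_bounds f F Cf -> 0 <= x -> x <= y ->
  `|(1 - expR (- (c * h * y))) *
      onejump (a / b) rho (c * h) g f n (flow (a / b) rho y + g) -
    (1 - expR (- (c * h * x))) *
      onejump (a / b) rho (c * h) g f n (flow (a / b) rho x + g)| <=
  h * decay (a / b) rho (c * h) n * (1 + n%:R * h) * (1 + h * Cf) * cst_jump *
    ((y - x) * (y + 2 * (a / b) + g) ^+ 2).
Proof.
move=> fF x0 xy; case: (hs) => hp h1 _ _.
have y0 : 0 <= y by exact: le_trans xy.
have f1 := ab_bounded fF; have Cf0 := ab_ge0 fF.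
have xs0 : 0 <= a / b by rewrite divr_ge0// ltW.
have th0 : 0 <= c * h by rewrite mulr_ge0 ?ltW.
have S0 : 0 <= (1 - rho)^-1 by rewrite invr_ge0 subr_ge0 ltW// rho_lt1.
set xs := a / b in xs0 *; set th := c * h in th0 *.
set qx := 1 - expR (- (th * x)); set qy := 1 - expR (- (th * y)).
set Y := flow xs rho y + g; set X := flow xs rho x + g.
set H := onejump _ _ _ _ _ _; set dn := decay _ _ _ _.
set B := y + 2 * xs + g.
have dn0 : 0 <= dn by exact: expR_ge0.
have nh0 : 0 <= n%:R * h by rewrite mulr_ge0// ltW.
have hC0 : 0 <= h * Cf by rewrite mulr_ge0// ltW.
have d0 : 0 <= y - x by rewrite subr_ge0.
have gB : g <= B by rewrite /B; lra.
have B0 : 0 <= B by apply: le_trans gB; rewrite ltW.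
have X0 : 0 <= X.
  by rewrite addr_ge0 ?(ltW g0)// flow_ge0// ?rho_gt0// rho_lt1.
have XY : X <= Y by rewrite /X /Y lerD2r flow_le// rho_gt0.
have Y0 : 0 <= Y by exact: le_trans XY.
have YB : Y + xs <= B.
  have := @nflow_le _ xs rho xs0 rho_gt0 rho_lt1 1 y y0.
  by rewrite /nflow expr1 /Y /B /flow; lra.
have YX : Y - X <= y - x.
  have -> : Y - X = rho * (y - x) by rewrite /Y /X /flow; ring.
  by rewrite ler_piMl// ltW// rho_lt1.
have /andP[q0 q1] : 0 <= qy - qx <= th * (y - x).
  have -> : qy - qx = expR (- (th * x)) - expR (- (th * y)) by rewrite /qx /qy; ring.
  by rewrite mulrBr; apply: ler_subr_expRN; [rewrite mulr_ge0|rewrite ler_wpM2l].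
have qx0 : 0 <= qx by rewrite one_subr_expRN_ge0// mulr_ge0.
have q2 : qx <= th * B.
  apply: le_trans (one_subr_expRN_le _) _; rewrite ler_wpM2l//.
  by rewrite /B; have := ltW g0; lra.
have H1 : `|H Y| <= n%:R * (dn * (th * B)).
  apply: le_trans (onejump_norm_le xs0 rho_gt0 rho_lt1 th0 g0 n f1 Y0) _.
  by rewrite ler_wpM2l// ler_wpM2l// ler_wpM2l.
have thS : th * (1 - rho)^-1 <= 2 * c / b.
  have -> : 2 * c / b = th * (2 / (b * h)) by rewrite /th; field; rewrite !gt_eqF.
  by rewrite ler_wpM2l// onem_rho_inv.
have thS0 : 0 <= th * (1 - rho)^-1 by rewrite mulr_ge0.
set Th := 2 * c / b in thS *.
have Th0 : 0 <= Th by exact: le_trans thS.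
have H2 : `|H Y - H X| <= dn * (y - x) * (B * (Th * (n%:R * th) + 4 * Th / g + th * Cf * g) + Th).
  apply: le_trans (onejump_lipschitz xs0 rho_gt0 rho_lt1 th0 g0 rho_jump n fF X0 XY) _.
  have nth0 : 0 <= n%:R * th by rewrite mulr_ge0.
  have gi : 0 <= g^-1 by rewrite invr_ge0 ltW.
  apply: ler_pM.
  - by rewrite mulr_ge0// subr_ge0.
  - by nneg.
  - by rewrite ler_wpM2l.
  - apply: lerD => //; apply: ler_pM => //.
    + by nneg.
    + by nneg.
    + by rewrite lerD2r; apply: lerD; [rewrite ler_wpM2r|rewrite ler_wpM2r// ler_wpM2l].
have -> : qy * H Y - qx * H X = (qy - qx) * H Y + qx * (H Y - H X) by ring.
apply: le_trans (ler_normD _ _) _; rewrite !normrM (ger0_norm q0) (ger0_norm qx0).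
apply: (@le_trans _ _ (th * (y - x) * (n%:R * (dn * (th * B))) +
  th * B * (dn * (y - x) * (B * (Th * (n%:R * th) + 4 * Th / g + th * Cf * g) + Th)))).
  by apply: lerD; apply: ler_pM.
have -> : th * (y - x) * (n%:R * (dn * (th * B))) +
  th * B * (dn * (y - x) * (B * (Th * (n%:R * th) + 4 * Th / g + th * Cf * g) + Th)) =
  h * dn * (y - x) * (c ^+ 2 * (n%:R * h) * B +
   c * B ^+ 2 * (Th * c * (n%:R * h) + 4 * Th / g + c * g * (h * Cf)) + c * Th * B).
  by rewrite /th; ring.
have -> : h * dn * (1 + n%:R * h) * (1 + h * Cf) * cst_jump * ((y - x) * B ^+ 2) =
  h * dn * (y - x) * (((1 + n%:R * h) * (1 + h * Cf)) * cst_jump * B ^+ 2) by ring.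
rewrite ler_wpM2l//; first by rewrite mulr_ge0// mulr_ge0// ltW.
set M := (1 + n%:R * h) * (1 + h * Cf).
have M1 : 1 <= M by have := mulr_ge0 nh0 hC0; rewrite /M; lra.
have Mn : n%:R * h <= M by have := mulr_ge0 nh0 hC0; rewrite /M; lra.
have MC : h * Cf <= M by have := mulr_ge0 nh0 hC0; rewrite /M; lra.
(* Terms linear in [B] are raised to quadratic ones by [g <= B], so that a single weight serves for
   all of them. *)
have BB : B <= B ^+ 2 / g by rewrite ler_pdivlMr// expr2 ler_wpM2l.
have B20 : 0 <= B ^+ 2 by rewrite sqr_ge0.
have cp := ltW c0; have gp := ltW g0.
have gi : 0 <= g^-1 by rewrite invr_ge0.
have M0 : 0 <= M by exact: le_trans M1.
have -> : M * cst_jump * B ^+ 2 = c ^+ 2 * M * (B ^+ 2 / g) +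
  c * B ^+ 2 * (Th * c * M + 4 * Th / g * M + c * g * M) + c * Th * M * (B ^+ 2 / g).
  by rewrite /cst_jump -/Th; ring.
apply: lerD; first apply: lerD.
- by apply: ler_pM => //; [nneg|rewrite ler_wpM2l ?sqr_ge0].
- have cB : 0 <= c * B ^+ 2 by nneg.
  have Tc : 0 <= Th * c by nneg.
  have cg : 0 <= c * g by nneg.
  have Tg : 0 <= 4 * Th / g by nneg.
  apply: (ler_wpM2l cB); apply: lerD; first apply: lerD.
  + exact: ler_wpM2l.
  + by rewrite ler_peMr.
  + exact: ler_wpM2l.
- have cT : 0 <= c * Th by nneg.
  by apply: ler_pM => //; rewrite ler_peMr.
Qed.

Variable kap : R.
Hypotheses (kap0 : 0 < kap) (kap_p : kap <= p / 2) (kap_ac : kap < a * c / b).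

Let cst_decay : R := (1 + (a * c / b - kap)^-1) * expR (a * c / b + 2 * (a * c) / b ^+ 2).

(** The strict gap between [kap] and [a * c / b] absorbs the factor linear in time. *)
Lemma decay_linear n : decay (a / b) rho (c * h) n * (1 + n%:R * h) <=
  cst_decay * expR (- (kap * (n%:R * h))).
Proof.
case: (hs) => hp h1 _ _.
have t0 : 0 <= n%:R * h by rewrite mulr_ge0// ltW.
set t := n%:R * h in t0 *.
set del := a * c / b - kap.
have del0 : 0 < del by rewrite subr_gt0.
apply: (@le_trans _ _ (expR (a * c / b + 2 * (a * c) / b ^+ 2) *
  expR (- (a * c / b * t)) * (1 + t))).
  by rewrite ler_wpM2r ?decay_le// addr_ge0.
rewrite /cst_decay -/del.
have -> : expR (- (a * c / b * t)) = expR (- (kap * t)) * expR (- (del * t)).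
  by rewrite -expRD; congr expR; rewrite /del; ring.
have e1 : expR (- (del * t)) * (1 + t) <= 1 + del^-1.
  rewrite expRN mulrC ler_pdivrMr ?expR_gt0//.
  apply: (@le_trans _ _ ((1 + del^-1) * (1 + del * t))).
    have -> : (1 + del^-1) * (1 + del * t) = 1 + t + (del^-1 + del * t).
      by field; rewrite gt_eqF.
    by rewrite lerDl addr_ge0 ?invr_ge0 ?mulr_ge0// ltW.
  by rewrite ler_wpM2l ?expR_ge1Dx// addr_ge0// invr_ge0 ltW.
have := ler_wpM2l (mulr_ge0 (expR_ge0 (a * c / b + 2 * (a * c) / b ^+ 2)) (expR_ge0 (- (kap * t)))) e1.
by apply: le_trans_eq; [|ring] || lra.
Qed.

Let cst_weight : R := 2 / ga + 2 * (2 * (a / b) + g) ^+ 2.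

Lemma square_weight x y : 0 <= x -> x <= y ->
  (y - x) * (y + 2 * (a / b) + g) ^+ 2 <= cst_weight * (V y - V x).
Proof.
move=> x0 xy; have y0 : 0 <= y by exact: le_trans xy.
have d0 : 0 <= y - x by rewrite subr_ge0.
have bep := ltW be0; have gap := ltW ga0.
have cw : 0 <= cst_weight by rewrite addr_ge0 ?divr_ge0// mulr_ge0 ?sqr_ge0.
have -> : V y - V x = (y - x) * ((1 + ga * y ^+ 2) + (be * (x + y) + ga * (x * (x + y)))).
  by rewrite /cubic; ring.
rewrite [leRHS]mulrCA ler_wpM2l//.
apply: (@le_trans _ _ (cst_weight * (1 + ga * y ^+ 2))); last first.
  by rewrite ler_wpM2l// lerDl addr_ge0// mulr_ge0 ?addr_ge0// mulr_ge0// addr_ge0.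
set m := 2 * (a / b) + g.
have -> : cst_weight * (1 + ga * y ^+ 2) = (2 * y ^+ 2 + 2 * m ^+ 2) +
   (2 / ga + 2 * m ^+ 2 * (ga * y ^+ 2)).
  by rewrite /cst_weight -/m; field; rewrite gt_eqF.
have -> : (y + 2 * (a / b) + g) ^+ 2 = 2 * y ^+ 2 + 2 * m ^+ 2 - (y - m) ^+ 2.
  by rewrite /m; ring.
have := sqr_ge0 (y - m).
have : 0 <= 2 / ga + 2 * m ^+ 2 * (ga * y ^+ 2) by nneg.
by lra.
Qed.

Let cst_lip : R := cst_decay * cst_jump * cst_weight.

(** Duhamel's formula by induction: a step multiplies the previous bound by [1 - p * h / 2], at most
    [expR (- (kap * h))], and each source adds a term of order [h] with the same exponential, hence
    the factor [n%:R * h]. The term [kap * h] in the exponent makes up for the source of index [n]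
    entering at index [n.+1]. *)
Lemma morejumps_lipschitz f F Cf n x y :
  antiderivative_bounds f F Cf -> 0 <= x -> x <= y ->
  `|morejumps (a / b) rho (c * h) g f n y - morejumps (a / b) rho (c * h) g f n x| <=
  cst_lip * (1 + h * Cf) * (n%:R * h) * expR (- (kap * (n%:R * h)) + kap * h) *
  (V y - V x).
Proof.
move=> fF; case: (hs) => hp h1 _ _.
have Cf0 := ab_ge0 fF.
have xs0 : 0 <= a / b by rewrite divr_ge0// ltW.
have th0 : 0 <= c * h by rewrite mulr_ge0 ?ltW.
have hC0 : 0 <= h * Cf by rewrite mulr_ge0// ltW.
have cd0 : 0 <= cst_decay.
  by rewrite mulr_ge0 ?expR_ge0// addr_ge0// invr_ge0 subr_ge0 ltW.
have cp := ltW c0; have gp := ltW g0; have bp := ltW b0.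
have cj0 : 0 <= cst_jump.
  by rewrite /cst_jump !addr_ge0// ?mulr_ge0 ?invr_ge0 ?addr_ge0 ?mulr_ge0 ?invr_ge0 ?ler0n// ?sqr_ge0.
have cw0 : 0 <= cst_weight.
  by rewrite addr_ge0 ?divr_ge0 ?(ltW ga0)// mulr_ge0 ?sqr_ge0.
have cl0 : 0 <= cst_lip by rewrite /cst_lip mulr_ge0// mulr_ge0.
have VV u v : 0 <= u -> u <= v -> 0 <= V v - V u.
  move=> u0 uv; have := square_weight u0 uv.
  have : 0 < cst_weight.
    by rewrite ltr_pwDl ?divr_gt0// mulr_ge0 ?sqr_ge0.
  move=> cw H; rewrite -(pmulr_rge0 _ cw); apply: le_trans H.
  by rewrite mulr_ge0 ?sqr_ge0// subr_ge0.
elim: n x y => [|n IH] x y x0 xy.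
  by rewrite !morejumps0 subrr normr0 mul0r mulr0 !mul0r.
rewrite !morejumpsS.
set Rn := morejumps _ _ _ _ _ n.
have -> (u1 u2 v1 v2 : R) : u1 + u2 - (v1 + v2) = (u1 - v1) + (u2 - v2) by ring.
apply: le_trans (ler_normD _ _) _.
set r := cst_lip * (1 + h * Cf) * (n%:R * h) * expR (- (kap * (n%:R * h)) + kap * h) in IH.
have r0 : 0 <= r.
  by rewrite /r; nneg.
have E : cst_lip * (1 + h * Cf) * (n.+1%:R * h) *
   expR (- (kap * (n.+1%:R * h)) + kap * h) * (V y - V x) =
  r * expR (- (kap * h)) * (V y - V x) +
  h * (cst_decay * expR (- (kap * (n%:R * h)))) * (1 + h * Cf) * cst_jump *
    (cst_weight * (V y - V x)).
  have -> : - (kap * (n.+1%:R * h)) + kap * h = - (kap * (n%:R * h)).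
    by rewrite -natr1; ring.
  have -> : r * expR (- (kap * h)) = cst_lip * (1 + h * Cf) * (n%:R * h) *
      expR (- (kap * (n%:R * h))).
    rewrite /r -mulrA -expRD; congr (_ * expR _); ring.
  by rewrite /cst_lip -natr1; ring.
rewrite E; apply: lerD.
  apply: le_trans (step_contract xs0 rho_gt0 rho_lt1 th0 g0 IH x0 xy) _.
  rewrite -mulrA ler_wpM2l//.
  apply: le_trans (chain_cubicB x0 xy) _.
  rewrite ler_wpM2r ?VV//.
  apply: le_trans (expR_ge1Dx _).
  by rewrite lerD2l lerN2 mulrAC ler_wpM2r// ltW.
apply: le_trans (jump_onejump_lipschitz n fF x0 xy) _.
apply: ler_pM.
- rewrite !mulr_ge0// ?expR_ge0// ?addr_ge0// ?mulr_ge0//; exact: ltW.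
- by rewrite mulr_ge0 ?sqr_ge0// subr_ge0.
- rewrite ler_wpM2r// ler_wpM2r ?addr_ge0// -mulrA ler_wpM2l ?(ltW hp)//.
  exact: decay_linear.
- exact: square_weight.
Qed.

Let cst_total : R :=
  2 * cst_decay + 2 * (c * cst_decay * (1 + a / b)) + cst_lip * expR kap.

Lemma cst_total_ge0 : 0 <= cst_total.
Proof.
have cp := ltW c0; have gp := ltW g0; have bp := ltW b0; have ap := ltW a0.
have gap := ltW ga0; have dp : 0 <= a * c / b - kap by rewrite subr_ge0 ltW.
by rewrite /cst_total /cst_lip /cst_decay /cst_jump /cst_weight; nneg.
Qed.

(** Only the remainder requires a comparison of [x] with [y]; the parts with at most one jump are
    small at each point separately. *)
Lemma chain_total_variation f F Cf n x y :
  antiderivative_bounds f F Cf -> (0 < n)%N -> 0 <= x -> x <= y ->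
  `|iter n T f y - iter n T f x| <=
  cst_total * (1 + n%:R * h) * expR (- (kap * (n%:R * h))) * (1 + h * Cf) *
  (1 + (V x + V y)).
Proof.
move=> fF n0 x0 xy; case: (hs) => hp h1 _ _.
have y0 : 0 <= y by exact: le_trans xy.
have f1 := ab_bounded fF; have Cf0 := ab_ge0 fF.
have xs0 : 0 <= a / b by rewrite divr_ge0// ltW.
have th0 : 0 <= c * h by rewrite mulr_ge0 ?ltW.
have cp := ltW c0; have gp := ltW g0; have bp := ltW b0.
have bep := ltW be0; have gap := ltW ga0.
have t0 : 0 <= n%:R * h by rewrite mulr_ge0// ltW.
have dl := decay_linear n.
set dn := decay _ _ _ _ in dl.
have dn0 : 0 <= dn by exact: expR_ge0.
set A := nojump (a / b) rho (c * h) f n; set H := onejump (a / b) rho (c * h) g f n.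
set Rn := morejumps (a / b) rho (c * h) g f n.
have TE z : iter n T f z = A z + H z + Rn z by rewrite /Rn /morejumps -/A -/H; ring.
rewrite !TE.
set t := n%:R * h in t0 dl *; set e := expR (- (kap * t)) in dl *.
have e0 : 0 <= e by exact: expR_ge0.
set W := 1 + (V x + V y).
have Vge z : 0 <= z -> z <= V z by move=> z0; rewrite /cubic -addrA lerDl; nneg.
have xV := Vge _ x0; have yV := Vge _ y0.
have W1 : 1 <= W by rewrite /W; lra.
have W0 : 0 <= W by exact: le_trans W1.
have xyW : x + y + 2 * (a / b) <= 2 * (1 + a / b) * W.
  by rewrite /W; have := mulr_ge0 xs0 (addr_ge0 (le_trans x0 xV) (le_trans y0 yV)); lra.
have cd0 : 0 <= cst_decay.
  by rewrite mulr_ge0 ?expR_ge0// addr_ge0// invr_ge0 subr_ge0 ltW.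
have dn1 : dn <= cst_decay * e by apply: le_trans dl; rewrite ler_peMr// lerDl.
have Ab z : 0 <= z -> `|A z| <= cst_decay * e.
  move=> z0; apply: le_trans dn1.
  exact: (nojump_norm_le xs0 rho_gt0 rho_lt1 th0 f1 n0 z0).
have Hb z : 0 <= z -> `|H z| <= cst_decay * e * (c * (z + a / b)).
  move=> z0; apply: le_trans (onejump_norm_le xs0 rho_gt0 rho_lt1 th0 g0 n f1 z0) _.
  rewrite -/dn.
  have -> : n%:R * (dn * (c * h * (z + a / b))) = dn * t * (c * (z + a / b)).
    by rewrite /t; ring.
  rewrite ler_wpM2r//; first by nneg.
  by apply: le_trans dl; rewrite ler_wpM2l// lerDr.
have hC0 : 0 <= h * Cf by rewrite mulr_ge0// ltW.
have cj0 : 0 <= cst_jump by rewrite /cst_jump; nneg.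
have cl0 : 0 <= cst_lip by rewrite /cst_lip /cst_weight; nneg.
have Rb : `|Rn y - Rn x| <= cst_lip * expR kap * ((1 + t) * e * (1 + h * Cf) * W).
  apply: le_trans (morejumps_lipschitz n fF x0 xy) _; rewrite -/t expRD -/e.
  have -> : cst_lip * (1 + h * Cf) * t * (e * expR (kap * h)) * (V y - V x) =
    cst_lip * expR (kap * h) * (t * e * (1 + h * Cf) * (V y - V x)) by ring.
  have VB : 0 <= V y - V x.
    have -> : V y - V x = (y - x) * (1 + be * (x + y) + ga * (x ^+ 2 + x * y + y ^+ 2)).
      by rewrite /cubic; ring.
    by apply: mulr_ge0; [rewrite subr_ge0|nneg].
  apply: ler_pM => //; [by nneg|by nneg| |].
    by rewrite ler_wpM2l// ler_expR ler_piMr// ltW.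
  apply: ler_pM => //; [by nneg| |].
    by rewrite ler_wpM2r; [|nneg|rewrite ler_wpM2r// lerDr].
  by rewrite /W; lra.
have -> : A y + H y + Rn y - (A x + H x + Rn x) =
  A y - A x + (H y - H x) + (Rn y - Rn x) by ring.
apply: le_trans (ler_normD _ _) _.
apply: le_trans (lerD (ler_normD _ _) (lexx _)) _.
apply: le_trans (lerD (lerD (ler_normB _ _) (ler_normB _ _)) (lexx _)) _.
have -> : cst_total * (1 + t) * e * (1 + h * Cf) * W =
  2 * cst_decay * ((1 + t) * e * (1 + h * Cf) * W) +
  2 * (c * cst_decay * (1 + a / b)) * ((1 + t) * e * (1 + h * Cf) * W) +
  cst_lip * expR kap * ((1 + t) * e * (1 + h * Cf) * W).
  by rewrite /cst_total; ring.
apply: lerD => //.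
have eM : e <= (1 + t) * e * (1 + h * Cf).
  rewrite mulrAC ler_peMl// -[leLHS]mulr1 ler_pM// ?lerDl//.
have eMW : e * W <= (1 + t) * e * (1 + h * Cf) * W by rewrite ler_wpM2r.
have eM1 : e <= (1 + t) * e * (1 + h * Cf) * W by apply: le_trans eMW; rewrite ler_peMr.
apply: lerD.
  apply: le_trans (lerD (Ab _ y0) (Ab _ x0)) _.
  have -> : cst_decay * e + cst_decay * e = 2 * cst_decay * e by ring.
  by rewrite ler_wpM2l//; nneg.
apply: le_trans (lerD (Hb _ y0) (Hb _ x0)) _.
have -> : cst_decay * e * (c * (y + a / b)) + cst_decay * e * (c * (x + a / b)) =
  c * cst_decay * e * (x + y + 2 * (a / b)) by ring.
apply: (@le_trans _ _ (c * cst_decay * e * (2 * (1 + a / b) * W))).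
  by rewrite ler_wpM2l//; nneg.
have -> : c * cst_decay * e * (2 * (1 + a / b) * W) =
  2 * (c * cst_decay * (1 + a / b)) * (e * W) by ring.
by rewrite ler_wpM2l//; nneg.
Qed.

Let cst_growth : R := (a + be * a ^+ 2 + ga * a ^+ 3) * (2 / p).

Lemma chain_growth n x : 0 <= x ->
  iter n T V x <= expR (- (p / 2 * (n%:R * h))) * V x + cst_growth.
Proof.
move=> x0; case: (hs) => hp h1 h2 _.
have xs0 : 0 <= a / b by rewrite divr_ge0// ltW.
have th0 : 0 <= c * h by rewrite mulr_ge0 ?ltW.
have bep := ltW be0; have gap := ltW ga0; have ap := ltW a0.
pose s := 1 - p * h / 2.
have s0 : 0 <= s.
  have : 0 <= c * g * h by rewrite !mulr_ge0// ltW.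
  by rewrite /s /p; lra.
(* [cst_growth] is the fixed point of the affine recursion that the drift inequality defines. *)
have sK : s * cst_growth + (a + be * a ^+ 2 + ga * a ^+ 3) * h = cst_growth.
  by rewrite /s /cst_growth; field; rewrite gt_eqF.
have V0 z : 0 <= z -> 0 <= V z by move=> z0; rewrite /cubic; nneg.
have K0 : 0 <= cst_growth.
  by rewrite /cst_growth mulr_ge0 ?divr_ge0 ?(ltW p0)//; nneg.
apply: (@le_trans _ _ (s ^+ n * V x + cst_growth * (1 - s ^+ n))); last first.
  apply: lerD; last by rewrite ler_piMr// lerBlDr lerDl exprn_ge0.
  rewrite ler_wpM2r ?V0//.
  have -> : expR (- (p / 2 * (n%:R * h))) = expR (- (p * h / 2)) ^+ n.
    by rewrite -expRM_natl; congr expR; ring.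
  apply: lerXn2r; rewrite ?nnegrE ?expR_ge0//.
  exact: expR_ge1Dx.
elim: n x x0 => [|n IH] x x0.
  by rewrite /= expr0 mul1r subrr mulr0 addr0.
rewrite iterS.
apply: le_trans (step_le xs0 rho_gt0 rho_lt1 th0 g0 IH x0) _.
set K := cst_growth in sK *.
have -> : step (a / b) rho (c * h) g (fun z => s ^+ n * V z + K * (1 - s ^+ n)) x =
  s ^+ n * T V x + K * (1 - s ^+ n) by rewrite /chain /step -/rho; ring.
have := ler_wpM2l (exprn_ge0 n s0) (chain_cubic_le x0).
rewrite -/s => H; apply: le_trans (lerD H (lexx _)) _.
set k := (a + _ + _) * h in sK *.
have -> : k = K - s * K by apply: (addrI (s * K)); rewrite sK; ring.
by rewrite exprSr le_eqVlt; apply/orP; left; apply/eqP; ring.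
Qed.

End small.

(** [be], [ga] and [K] are fixed before [h], which lets the step tend to 0 afterwards; of [f], only
    the factor [1 + h * Cf] remains. *)
Lemma chain_estimates (kap : R) :
  0 < kap -> kap <= p / 2 -> kap < a * c / b ->
  exists be ga K h0, [/\ 0 < be, 0 < ga, 0 < K, 0 < h0 &
  forall h, 0 < h -> h <= h0 ->
    (forall n x, 0 <= x -> iter n (chain h) (cubic be ga) x <=
      expR (- (p / 2 * (n%:R * h))) * cubic be ga x + K) /\
    (forall f F Cf n x y, antiderivative_bounds f F Cf -> (0 < n)%N ->
      0 <= x -> x <= y ->
      `|iter n (chain h) f y - iter n (chain h) f x| <=
      K * (1 + n%:R * h) * expR (- (kap * (n%:R * h))) * (1 + h * Cf) *
      (1 + (cubic be ga x + cubic be ga y)))].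
Proof.
move=> kap0 kap_p kap_ac.
have ap := ltW a0; have cp := ltW c0; have gp := ltW g0.
have C2 : 0 < cst2 a c g.
  by rewrite /cst2 -addrA ltr_pwDl ?mulr_gt0//; nneg.
have C3 : 0 < cst3 a c g.
  by rewrite /cst3 -!addrA ltr_pwDl ?mulr_gt0//; nneg.
(* [be] and [ga] share the margin [p / 4] equally; the second entry of the minimum [m] provides
   [ga_small]. *)
pose be := p / 8 / cst2 a c g.
have be0 : 0 < be by rewrite !divr_gt0.
pose m := Num.min (p / 8) (be * (p / 4)).
have m0 : 0 < m by rewrite lt_min !mulr_gt0 ?invr_gt0.
pose ga := m / cst3 a c g.
have ga0 : 0 < ga by rewrite divr_gt0.
have gaE : ga * cst3 a c g = m by rewrite /ga mulfVK// gt_eqF.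
have beE : be * cst2 a c g = p / 8 by rewrite /be mulfVK// gt_eqF.
have be_small : be * cst2 a c g + ga * cst3 a c g <= p / 4.
  rewrite beE gaE; apply: (@le_trans _ _ (p / 8 + p / 8)); last by lra.
  by rewrite lerD2l ge_min lexx.
have ga_small : ga * cst3 a c g <= be * (p / 4) by rewrite gaE ge_min lexx orbT.
have [h0 h00 Hs] := small_stepP.
pose K1 : R := (a + be * a ^+ 2 + ga * a ^+ 3) * (2 / p).
have bep := ltW be0; have gap := ltW ga0; have pp := ltW p0.
have K10 : 0 <= K1 by rewrite /K1; nneg.
have K2 := cst_total_ge0 ga0 kap_ac.
set k2 := (X in 0 <= X) in K2.
have K12 : 0 <= K1 + k2 by rewrite addr_ge0.
exists be, ga, (1 + K1 + k2), h0; split => //.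
  by rewrite -addrA ltr_pwDl.
move=> h hp hh0; have hs := Hs h hp hh0; split.
  move=> n x x0.
  have := chain_growth hs be0 ga0 be_small ga_small n x0.
  by move=> /le_trans; apply; rewrite lerD2l -/p -/K1; lra.
move=> f F Cf n x y fF n0 x0 xy.
have := chain_total_variation hs be0 ga0 be_small ga_small kap0 kap_p kap_ac fF n0 x0 xy.
rewrite -/k2 => /le_trans; apply.
have := ltW hp; have := ab_ge0 fF; have y0 := le_trans x0 xy => Cf0 hp'.
rewrite -!mulrA ler_wpM2r//; first by rewrite /cubic; nneg.
by lra.
Qed.

End drift.

(** * Polynomials in exp(-x) and their antiderivatives *)

Section exp_poly.
Context {R : realType}.
Implicit Types (p : {poly R}) (l x : R).

Definition expN l x : R := expR (- (l * x)).

Definition exp_poly p x : R := p.[expR (- x)].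

Lemma exp_polyE p x : exp_poly p x = \sum_(k < size p) p`_k * expN k%:R x.
Proof.
rewrite /exp_poly horner_coef; apply: eq_bigr => k _.
by rewrite /expN -mulrN expRM_natl.
Qed.

Lemma is_derive_expN l x : is_derive x 1 (expN l) (- l * expN l x).
Proof.
have -> : expN l = expR \o ( *%R (- l)) by apply/funext => y; rewrite /expN/= mulNr.
have := is_derive1_comp (is_derive_expR (- l * x)) (is_deriveZ (- l) (is_derive_id x 1)).
by move=> H; apply: trigger_derive H _; rewrite /GRing.scale/= mulr1 mulrC.
Qed.

Definition exp_prim (k : nat) x : R := if k == 0%N then x else - (expN k%:R x / k%:R).

Lemma is_derive_exp_prim k x : is_derive x 1 (exp_prim k) (expN k%:R x).
Proof.
rewrite /exp_prim; case: k => [|k] /=.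
  by rewrite /expN mul0r oppr0 expR0; exact: is_derive_id.
have -> : (fun x => - (expN k.+1%:R x / k.+1%:R)) = (- k.+1%:R^-1) *: expN k.+1%:R.
  by apply/funext => y; rewrite fctE /GRing.scale/=; ring.
apply: trigger_derive (is_deriveZ _ (is_derive_expN _ _)) _.
have l0 : k.+1%:R != 0 :> R by rewrite pnatr_eq0.
by rewrite /GRing.scale/=; set l := k.+1%:R in l0 *; field.
Qed.

Definition exp_poly_prim p x : R := \sum_(k < size p) p`_k * exp_prim k x.

Lemma is_derive_exp_poly_prim p x : is_derive x 1 (exp_poly_prim p) (exp_poly p x).
Proof.
have -> : exp_poly_prim p = \sum_(k < size p) (p`_k *: exp_prim k).
  by apply/funext => y; rewrite fct_sumE.
rewrite exp_polyE; apply: is_derive_sum => k.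
exact/is_deriveZ/is_derive_exp_prim.
Qed.

(** An exponential of a sum is a product, so the left side factors: [E' - E] is Lipschitz in [w],
    and the last factor is a Taylor remainder of second order in [s - s']. For [k = 0] both terms on
    the left vanish. *)
Lemma expN_quadratic (k : nat) w w' s s' : 0 <= w -> w <= w' -> 0 <= s' -> s' <= s ->
  `|(expN k%:R (w' + s) - expN k%:R (w + s)) * (s - s') -
    (exp_prim k (w' + s) - exp_prim k (w + s) -
     (exp_prim k (w' + s') - exp_prim k (w + s')))| <=
  k%:R ^+ 2 * ((s - s') ^+ 2 * (w' - w)).
Proof.
move=> w0 ww' s'0 s's; rewrite /exp_prim; case: k => [|k] /=.
  rewrite /expN !mul0r subrr mul0r.
  by rewrite (_ : _ - _ = 0) ?normr0 ?expr0n/= ?mul0r//; ring.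
set l : R := k.+1%:R; have l0 : 0 < l by rewrite ltr0n.
have expND u v : expN l (u + v) = expN l u * expN l v.
  by rewrite /expN -expRD; congr expR; ring.
have [D sE] : exists D, s = s' + D by exists (s - s'); ring.
have D0 : 0 <= D by move: s's; rewrite sE lerDl.
rewrite {}sE !(expND _ (s' + D)) !(expND _ s') (expND s' D).
have -> : s' + D - s' = D by ring.
set E := expN l w; set E' := expN l w'; set S := expN l s'; set G := expN l D.
have -> : (E' * (S * G) - E * (S * G)) * D -
   (- (E' * (S * G) / l) - - (E * (S * G) / l) - (- (E' * S / l) - - (E * S / l))) =
  (E' - E) * (S * ((l * D * G - (1 - G)) / l)) by field; rewrite gt_eqF.
have lD0 : 0 <= l * D by nneg.
have [G0 G1] : 0 <= G /\ G <= 1 by split; [exact: expR_ge0|exact: expRN_le1].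
have G2 : 1 - G <= l * D by exact: one_subr_expRN_le.
have G3 : l * D * G <= 1 - G.
  have : 1 + l * D <= expR (l * D) by exact: expR_ge1Dx.
  rewrite -(ler_pM2l (expR_gt0 (- (l * D)))) -expRD addNr expR0 -/(expN l D) -/G.
  by lra.
have S0 : 0 <= S by exact: expR_ge0.
have S1 : S <= 1 by apply: expRN_le1; nneg.
have E1 : 0 <= E - E' <= l * (w' - w).
  by rewrite mulrBr; apply: ler_subr_expRN; [nneg|rewrite ler_wpM2l// ltW].
have /andP[E2 E3] := E1.
rewrite !normrM distrC (ger0_norm E2) (ger0_norm S0).
have -> : l ^+ 2 * (D ^+ 2 * (w' - w)) = (l * (w' - w)) * (1 * ((l * D) ^+ 2 / l)).
  by field; rewrite gt_eqF.
apply: ler_pM => //; first by nneg.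
apply: ler_pM => //.
have li : 0 <= l^-1 by nneg.
rewrite (ger0_norm li) ler_wpM2r// distrC ger0_norm ?subr_ge0//.
have : l * D * (1 - G) <= (l * D) ^+ 2 by rewrite expr2 ler_wpM2l.
by lra.
Qed.

(** The antiderivative is Lipschitz with constant 1 by the mean value theorem. [Cf] depends on the
    coefficients of [p], which is harmless since it only occurs multiplied by the time step. *)
Lemma exp_poly_antiderivative p :
  (forall z, 0 <= z <= 1 -> `|p.[z]| <= 1) ->
  exists Cf, antiderivative_bounds (exp_poly p) (exp_poly_prim p) Cf.
Proof.
move=> p1; exists (\sum_(k < size p) `|p`_k| * k%:R ^+ 2).
have f1 w : 0 <= w -> `|exp_poly p w| <= 1.
  by move=> w0; apply: p1; rewrite expR_ge0 expRN_le1.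
split => //.
- move=> w w' w0 ww'.
  have [|c] := MVT_segment ww' (fun x _ => is_derive_exp_poly_prim p x).
    apply/continuous_subspaceT => x; apply/differentiable_continuous/derivable1_diffP.
    by have [] := is_derive_exp_poly_prim p x.
  rewrite in_itv/= => /andP[cw _] ->; rewrite normrM (ger0_norm (x := w' - w)) ?subr_ge0//.
  by rewrite ler_piMl ?subr_ge0// f1// (le_trans w0).
- by apply: sumr_ge0 => k _; nneg.
- move=> w w' s s' w0 ww' s'0 s's; rewrite !exp_polyE /exp_poly_prim.
  rewrite -!sumrB mulr_suml -sumrB -mulrA mulr_suml.
  apply: le_trans (ler_norm_sum _ _ _) _; apply: ler_sum => k _.
  rewrite -!mulrBr -mulrA -mulrBr normrM -mulrA ler_wpM2l//.
  exact: expN_quadratic.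
Qed.

End exp_poly.

(** * Means of bounded functions over the state space *)

Section mean.
Context {R : realType}.
Local Notation RR := (measurableTypeR R).
Local Notation S := (@state_space R).

Lemma measurable_state_space : measurable S.
Proof.
have -> : S = `]0, +oo[%classic by apply/seteqP; split => x /=; rewrite in_itv/= andbT.
exact: measurable_itv.
Qed.

Variable m : {measure set RR -> \bar R}.
Hypothesis m1 : m S = 1%E.

Local Notation mean f := (\int[m]_(y in S) f y).

(** Boundedness is asked only where the measures live: [expN l] with [0 < l] is unbounded on the
    negative half-line. *)
Record bounded_measurable (f : R -> R) : Prop := {
  bm_measurable : measurable_fun (setT : set RR) f ;
  bm_bounded : bounded_on_state_space f }.

Lemma bm_integrable f : bounded_measurable f -> m.-integrable S (EFin \o f).
Proof.
move=> [mf [M fM]]; apply: measurable_bounded_integrable.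
- exact: measurable_state_space.
- by rewrite m1 ltry.
- exact: measurable_funS mf.
- exists `|M|; split => // N /ltW MN x Sx; apply: le_trans MN.
  by apply: le_trans (fM x Sx) (ler_norm _).
Qed.

Lemma mean_cst r : mean (fun=> r) = r.
Proof. by rewrite Rintegral_cst ?m1/= ?mulr1//; exact: measurable_state_space. Qed.

Lemma mean_le f1 f2 : bounded_measurable f1 -> bounded_measurable f2 ->
  (forall x, 0 < x -> f1 x <= f2 x) -> mean f1 <= mean f2.
Proof.
move=> b1 b2 f12; apply: le_Rintegral => //; try exact: bm_integrable.
exact: measurable_state_space.
Qed.

Lemma meanB f1 f2 : bounded_measurable f1 -> bounded_measurable f2 ->
  mean (fun x => f1 x - f2 x) = mean f1 - mean f2.
Proof.
move=> b1 b2; apply: RintegralB; try exact: bm_integrable.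
exact: measurable_state_space.
Qed.

Lemma meanD f1 f2 : bounded_measurable f1 -> bounded_measurable f2 ->
  mean (fun x => f1 x + f2 x) = mean f1 + mean f2.
Proof.
move=> b1 b2; apply: RintegralD; try exact: bm_integrable.
exact: measurable_state_space.
Qed.

Lemma meanZ k f : bounded_measurable f ->
  mean (fun x => k * f x) = k * mean f.
Proof.
move=> b1; apply: RintegralZl; try exact: bm_integrable.
exact: measurable_state_space.
Qed.

Lemma bm_cst r : bounded_measurable (fun=> r).
Proof. by split => //; exists `|r|. Qed.

Lemma bmB f1 f2 : bounded_measurable f1 -> bounded_measurable f2 ->
  bounded_measurable (fun x => f1 x - f2 x).
Proof.
move=> [mf1 [M1 fM1]] [mf2 [M2 fM2]]; split; first exact: measurable_funB.
exists (M1 + M2) => x x0; apply: le_trans (ler_normB _ _) _.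
by apply: lerD; [exact: fM1|exact: fM2].
Qed.

Lemma bmD f1 f2 : bounded_measurable f1 -> bounded_measurable f2 ->
  bounded_measurable (fun x => f1 x + f2 x).
Proof.
move=> [mf1 [M1 fM1]] [mf2 [M2 fM2]]; split; first exact: measurable_funD.
exists (M1 + M2) => x x0; apply: le_trans (ler_normD _ _) _.
by apply: lerD; [exact: fM1|exact: fM2].
Qed.

Lemma bmM f1 f2 : bounded_measurable f1 -> bounded_measurable f2 ->
  bounded_measurable (fun x => f1 x * f2 x).
Proof.
move=> [mf1 [M1 fM1]] [mf2 [M2 fM2]]; split; first exact: measurable_funM.
exists (M1 * M2) => x x0; rewrite normrM.
by apply: ler_pM => //; [exact: fM1|exact: fM2].
Qed.

Lemma bmZ k f : bounded_measurable f -> bounded_measurable (fun x => k * f x).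
Proof. by apply: bmM; exact: bm_cst. Qed.

Lemma bm_norm f : bounded_measurable f -> bounded_measurable (fun x => `|f x|).
Proof.
move=> [mf [M fM]]; split; first exact: measurableT_comp.
by exists M => x x0; rewrite normr_id fM.
Qed.

Lemma mean_dist_le f1 f2 e : bounded_measurable f1 -> bounded_measurable f2 ->
  (forall x, 0 < x -> `|f1 x - f2 x| <= e) -> `|mean f1 - mean f2| <= e.
Proof.
move=> b1 b2 f12; rewrite -meanB// ler_norml; apply/andP; split.
  rewrite -[leLHS]mean_cst; apply: mean_le; [exact: bm_cst|exact: bmB|move=> x /f12].
  by rewrite ler_norml => /andP[].
rewrite -[leRHS]mean_cst; apply: mean_le; [exact: bmB|exact: bm_cst|move=> x /f12].
by rewrite ler_norml => /andP[].
Qed.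

Lemma mean_sum n (F : 'I_n -> R -> R) : (forall i, bounded_measurable (F i)) ->
  bounded_measurable (fun x => \sum_(i < n) F i x) /\
  mean (fun x => \sum_(i < n) F i x) = \sum_(i < n) mean (F i).
Proof.
elim: n F => [|n IH] F bF.
  have -> : (fun x => \sum_(i < 0) F i x) = cst 0 by apply/funext => x; rewrite big_ord0.
  by split; [exact: bm_cst|rewrite mean_cst big_ord0].
have [b IHm] := IH (fun i => F (lift ord0 i)) (fun i => bF _).
have -> : (fun x => \sum_(i < n.+1) F i x) =
    (fun x => F ord0 x + \sum_(i < n) F (lift ord0 i) x).
  by apply/funext => x; rewrite big_ord_recl.
split; first exact: bmD.
by rewrite meanD// IHm big_ord_recl.
Qed.

End mean.

Section Rintegral_itv.
Context {R : realType}.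

Lemma Rintegral_itv_dist_le (phi : R -> R) (h k e : R) : 0 <= h ->
  measurable_fun (`[0, h] : set R) phi ->
  (forall s, 0 <= s <= h -> `|phi s - k| <= e) ->
  `|\int[lebesgue_measure]_(s in `[0, h]) phi s - h * k| <= e * h.
Proof.
move=> h0 mphi phik.
have mu : lebesgue_measure (`[0, h]%classic : set R) = h%:E.
  by rewrite lebesgue_measure_itv/= lte_fin; case: ltgtP h0 => // [_|<-] _; rewrite ?oppr0 ?adde0 ?subr0.
have cE r : \int[lebesgue_measure]_(s in `[0, h]) r = r * h :> R.
  by rewrite Rintegral_cst//= mu.
have ib (f : R -> R) M : measurable_fun (`[0, h] : set R) f ->
    (forall s, 0 <= s <= h -> `|f s| <= M) ->
    (@lebesgue_measure R).-integrable `[0, h] (EFin \o f).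
  move=> mf fM; apply: measurable_bounded_integrable => //.
    by move: (ltry h); rewrite -mu.
  exists `|M|; split => // N /ltW MN x /=; rewrite in_itv/= => Sx.
  by apply: le_trans MN; apply: le_trans (fM x Sx) (ler_norm _).
have iphi : (@lebesgue_measure R).-integrable `[0, h] (EFin \o phi).
  apply: (ib _ (e + `|k|)) => // s /phik sk.
  by rewrite -[phi s](subrK k); apply: le_trans (ler_normD _ _) _; rewrite lerD2r.
have icst r : (@lebesgue_measure R).-integrable `[0, h] (EFin \o (fun=> r)).
  by apply: (ib _ `|r|).
have H1 : \int[lebesgue_measure]_(s in `[0, h]) (k - e) <=
    \int[lebesgue_measure]_(s in `[0, h]) phi s :> R.
  apply: le_Rintegral => //= s.
  by rewrite in_itv/= => /phik; rewrite ler_norml => /andP[? ?]; lra.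
have H2 : \int[lebesgue_measure]_(s in `[0, h]) phi s <=
    \int[lebesgue_measure]_(s in `[0, h]) (k + e) :> R.
  apply: le_Rintegral => //= s.
  by rewrite in_itv/= => /phik; rewrite ler_norml => /andP[? ?]; lra.
move: H1 H2; rewrite !cE ler_norml; set J := Rintegral _ _ _ => H1 H2.
by clearbody J; clear - H1 H2; apply/andP; split; lra.
Qed.

End Rintegral_itv.

(** * Kernel composition and Dynkin's formula *)

Section semigroup.
Context {R : realType}.
Local Notation RR := (measurableTypeR R).
Local Notation S := (@state_space R).
Variable P : R.-pker (RR * RR) ~> RR.
Hypothesis hP : markov_semigroup P.

Definition mean_at (t x : R) (f : R -> R) : R := \int[P (t, x)]_(y in S) f y.

Let PS t x : 0 <= t -> 0 < x -> P (t, x) S = 1%E.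
Proof. exact: semigroup_state. Qed.

Lemma measurable_integral_state (f : R -> R) :
  measurable_fun (setT : set RR) f -> (forall x, 0 < x -> 0 <= f x) ->
  measurable_fun setT (fun q : RR * RR => (\int[P q]_(y in S) (f y)%:E)%E).
Proof.
move=> mf f0.
have -> : (fun q : RR * RR => (\int[P q]_(y in S) (f y)%:E)%E) =
   (fun q => (\int[P q]_y (((EFin \o f) \_ S) y))%E).
  by apply/funext => q; rewrite integral_mkcond.
apply: measurable_fun_integral_kernel.
- by move=> U mU; exact: measurable_kernel.
- by move=> z; apply: erestrict_ge0 => x /f0; rewrite lee_fin.
- apply/(measurable_restrictT _ measurable_state_space).
  by apply/measurable_EFinP; exact: measurable_funS mf.
Qed.

Lemma measurable_mean (f : R -> R) :
  measurable_fun (setT : set RR) f -> (forall x, 0 < x -> 0 <= f x) ->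
  measurable_fun setT (fun q : RR * RR => mean_at q.1 q.2 f).
Proof.
move=> mf f0.
have -> : (fun q : RR * RR => mean_at q.1 q.2 f) =
    fine \o (fun q : RR * RR => (\int[P q]_(y in S) (f y)%:E)%E).
  by apply/funext => -[].
apply: measurableT_comp; first exact: fine_measurable.
exact: measurable_integral_state.
Qed.

Lemma mean_at_le (M t x : R) (f : R -> R) : bounded_measurable f ->
  (forall x, 0 < x -> `|f x| <= M) -> 0 <= t -> 0 < x -> `|mean_at t x f| <= M.
Proof.
move=> bf fM t0 x0.
have := @mean_dist_le _ (P (t, x)) (PS t0 x0) f (fun=> 0) M bf (bm_cst 0).
rewrite (mean_cst (PS t0 x0)) subr0; apply => y y0; rewrite subr0; exact: fM.
Qed.

Lemma bm_mean_at (t : R) (f : R -> R) : 0 <= t -> bounded_measurable f ->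
  (forall x, 0 < x -> 0 <= f x) -> bounded_measurable (fun y => mean_at t y f).
Proof.
move=> t0 bf f0; case: (bf) => mf [M fM]; split; last first.
  by exists M => x x0; exact: mean_at_le.
have -> : (fun y => mean_at t y f) =
   (fun q : RR * RR => mean_at q.1 q.2 f) \o (fun y => (t, y)) by [].
apply: measurableT_comp; first exact: measurable_mean.
exact: measurable_fun_pair.
Qed.

(** Composition with [\;] passes both the source point and the intermediate state to the second
    kernel, hence the product domain; only the intermediate state matters. *)
Definition kernel_at (t : R) (q : (RR * RR) * RR) : {measure set RR -> \bar R} :=
  P (t, q.2).

Section kernel_at.
Variable t : R.

Let measurable_kernel_at U : measurable U -> measurable_fun setT (kernel_at t ^~ U).
Proof.
move=> mU.
have -> : kernel_at t ^~ U = (P ^~ U) \o (fun q : (RR * RR) * RR => (t : RR, q.2)) by [].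
apply: measurableT_comp; first exact: measurable_kernel.
exact: measurable_fun_pair.
Qed.

HB.instance Definition _ := isKernel.Build _ _ _ _ _ (kernel_at t) measurable_kernel_at.

Let kernel_at_prob q : kernel_at t q setT = 1%E.
Proof. exact: prob_kernel. Qed.

HB.instance Definition _ :=
  Kernel_isProbability.Build _ _ _ _ _ (kernel_at t) kernel_at_prob.

End kernel_at.

Lemma integral_state_full (m : {measure set RR -> \bar R}) (f : RR -> \bar R) :
  m setT = 1%E -> m S = 1%E -> measurable_fun setT f -> (forall x, 0 <= f x)%E ->
  (\int[m]_y f y = \int[m]_(y in S) f y)%E.
Proof.
move=> mT mS mf f0.
have mSC : measurable (~` S) by apply: measurableC; exact: measurable_state_space.
have N0 : m (~` S) = 0%E.
  have E : m setT = (m (setT `\` S) + m (setT `&` S))%E.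
    exact: (measureDI m measurableT measurable_state_space).
  have {}E : (m (~` S) + 1 = 1)%E by rewrite -[RHS]mT E setTD setTI mS.
  have : (m (~` S) + 1 - 1 = 1 - 1 :> \bar R)%E by rewrite E.
  by rewrite addeK// subee.
rewrite (ge0_negligible_integral mSC measurableT mf (fun x _ => f0 x) N0).
by rewrite setTD setCK.
Qed.

(** Fubini for mixtures: [m] agrees with the composition of [l] and [kernel_at t]. With [l] the
    semigroup this gives the Chapman-Kolmogorov equation for functions, with [l] constant the
    invariance of means. *)
Lemma integral_mixture (l : R.-sfker (RR * RR) ~> RR) (q : RR * RR)
    (m : {measure set RR -> \bar R}) (t : R) (f : R -> R) :
  0 <= t -> l q setT = 1%E -> l q S = 1%E ->
  (forall A, measurable A -> m A = (\int[l q]_(y in S) P (t, y) A)%E) ->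
  bounded_measurable f -> (forall x, 0 < x -> 0 <= f x) ->
  \int[m]_(x in S) f x = \int[l q]_(y in S) mean_at t y f.
Proof.
move=> t0 lT lS mE bf f0; rewrite /mean_at /Rintegral; congr fine.
have mf := bm_measurable bf.
set F := (EFin \o f) \_ S.
have F0 z : (0 <= F z)%E by apply: erestrict_ge0 => y /f0; rewrite lee_fin.
have mF : measurable_fun (setT : set RR) F.
  apply/(measurable_restrictT _ measurable_state_space).
  by apply/measurable_EFinP; exact: measurable_funS mf.
transitivity (\int[(l \; kernel_at t)%E q]_z F z)%E.
  rewrite integral_mkcond; apply: eq_measure_integral => A mA _.
  rewrite mE// /mkcomp/= /kcomp integral_state_full//.
  exact: measurableT_comp (measurable_kernel (kernel_at t) _ mA) _.
rewrite integral_kcomp// integral_state_full//; last 2 first.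
- have -> : (fun y => \int[kernel_at t (q, y)]_z F z)%E =
    (fun r : RR * RR => \int[P r]_z F z)%E \o (fun y => (t, y)) by [].
  apply: measurableT_comp; last exact: measurable_fun_pair.
  by apply: measurable_fun_integral_kernel => // U mU; exact: measurable_kernel.
- by move=> y; apply: integral_ge0.
apply: eq_integral => y /set_mem Sy.
have -> : (\int[kernel_at t (q, y)]_z F z = \int[P (t, y)]_(z in S) (f z)%:E)%E.
  by rewrite [RHS]integral_mkcond.
rewrite fineK//; apply: integrable_fin_num; first exact: measurable_state_space.
by apply: bm_integrable => //; exact: PS.
Qed.

Lemma chapman_kolmogorov (s t x : R) (f : R -> R) : 0 <= s -> 0 <= t -> 0 < x ->
  bounded_measurable f -> (forall x, 0 < x -> 0 <= f x) ->
  mean_at (s + t) x f = mean_at s x (fun y => mean_at t y f).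
Proof.
move=> s0 t0 x0; apply: (@integral_mixture P (s, x)) => //.
- exact: prob_kernel.
- exact: PS.
- by move=> A mA; exact: semigroup_add.
Qed.

Variable L : (R -> R) -> R -> R.
Hypothesis hL : has_generator P L.

Lemma dynkin_dist_le (u : R -> R) (k e h x : R) : test_function L u ->
  measurable_fun (setT : set RR) (L u) -> 0 <= h -> 0 < x ->
  (forall s, 0 <= s <= h -> `|mean_at s x (L u) - k| <= e) ->
  `|mean_at h x u - u x - h * k| <= e * h.
Proof.
move=> tu mLu h0 x0 He.
have [M uM] := test_image_bounded tu.
rewrite /mean_at (hL tu h0 x0) [u x + _]addrC addrK.
apply: Rintegral_itv_dist_le => //.
(* [measurable_mean] is stated for nonnegative functions, so [L u] is shifted by its bound. *)
pose v y := L u y + M.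
have v0 y : 0 < y -> 0 <= v y by move/uM; rewrite ler_norml /v => /andP[? _]; lra.
have mv : measurable_fun (setT : set RR) v by apply: measurable_funD.
have bLu : bounded_measurable (L u) by split => //; exists M.
apply: (@eq_measurable_fun _ _ _ _ _
   ((fun q : RR * RR => mean_at q.1 q.2 v - M) \o (fun s => (s, x)))).
  move=> s; rewrite inE/= in_itv/= => /andP[s0 _].
  have m1 := PS s0 x0.
  by rewrite /mean_at (meanD m1 bLu (bm_cst M)) (mean_cst m1) addrK.
apply: measurable_funTS; apply: measurableT_comp; last exact: measurable_fun_pair.
by apply: measurable_funB => //; exact: measurable_mean.
Qed.

(** Dynkin's formula is used twice: applied to [L u] it shows that the integrand in the formula for
    [u] varies by at most [K * s]. *)
Lemma dynkin_second_order (u : R -> R) (K h x : R) :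
  test_function L u -> test_function L (L u) ->
  measurable_fun (setT : set RR) (L u) -> measurable_fun (setT : set RR) (L (L u)) ->
  (forall y, 0 < y -> `|L (L u) y| <= K) -> 0 <= h -> 0 < x ->
  `|mean_at h x u - u x - h * L u x| <= K * h ^+ 2.
Proof.
move=> tu tLu mLu mLLu LK h0 x0.
have -> : K * h ^+ 2 = (K * h) * h by ring.
apply: dynkin_dist_le => // s /andP[s0 sh].
have K0 : 0 <= K by apply: le_trans (LK x x0).
have H : `|mean_at s x (L u) - L u x - s * 0| <= K * s.
  apply: dynkin_dist_le => // r /andP[r0 rs]; rewrite subr0.
  apply: mean_at_le => //; split => //.
  exact: test_image_bounded tLu.
move: H; rewrite mulr0 subr0 => /le_trans; apply.
by rewrite ler_wpM2l.
Qed.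

End semigroup.

(** * The generator on exponentials times polynomials *)

Section exponentials.
Context {R : realType}.
Local Notation RR := (measurableTypeR R).
Implicit Types (A B l m x : R).

(** The family is closed under the derivative, and the generator raises the degree of the polynomial
    factor by at most one; degree 2 therefore suffices for [expN l] and two applications of the
    generator. *)
Definition quadexp C0 C1 C2 l x : R := (C0 + C1 * x + C2 * x ^+ 2) * expN l x.

Lemma expN_ge0 l x : 0 <= expN l x. Proof. exact: expR_ge0. Qed.

Lemma expN_le1 l x : 0 <= l -> 0 <= x -> expN l x <= 1.
Proof. by move=> l0 x0; apply: expRN_le1; rewrite mulr_ge0. Qed.

Lemma expND l x y : expN l (x + y) = expN l x * expN l y.
Proof. by rewrite /expN -expRD; congr expR; ring. Qed.

Lemma expN_mono l m x : m <= l -> 0 <= x -> expN l x <= expN m x.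
Proof. by move=> ml x0; rewrite ler_expR lerN2 ler_wpM2r. Qed.

Lemma mul_expN_le m x : 0 < m -> x * expN m x <= m^-1.
Proof.
move=> m0; rewrite -[leRHS]mul1r ler_pdivlMr// /expN expRN mulrAC.
by rewrite ler_pdivrMr ?expR_gt0// mul1r mulrC; have := expR_ge1Dx (m * x); lra.
Qed.

Lemma sqr_expN_le m x : 0 < m -> 0 <= x -> x ^+ 2 * expN m x <= 4 / m ^+ 2.
Proof.
move=> m0 x0; have m20 : 0 < m / 2 by rewrite divr_gt0.
have -> : x ^+ 2 * expN m x = (x * expN (m / 2) x) ^+ 2.
  rewrite exprMn; congr (_ * _); rewrite expr2 -expRD; congr expR.
  by rewrite [in LHS](splitr m); ring.
have -> : 4 / m ^+ 2 = ((m / 2)^-1) ^+ 2 by field; rewrite gt_eqF.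
by rewrite !expr2 ler_pM ?mul_expN_le// mulr_ge0// expN_ge0.
Qed.

(** Uniform in [l >= m], because the exponents move when the chain is iterated. *)
Lemma quadexp_le C0 C1 C2 l m x : 0 < m -> m <= l -> 0 <= x ->
  `|quadexp C0 C1 C2 l x| <= `|C0| + `|C1| / m + `|C2| * (4 / m ^+ 2).
Proof.
move=> m0 ml x0; rewrite /quadexp normrM (ger0_norm (expN_ge0 _ _)).
apply: (@le_trans _ _ ((`|C0| + `|C1| * x + `|C2| * x ^+ 2) * expN m x)).
  apply: ler_pM; rewrite ?expN_ge0 ?normr_ge0//; last exact: expN_mono.
  apply: le_trans (ler_normD _ _) _; apply: lerD; last by rewrite normrM (ger0_norm (sqr_ge0 x)).
  by apply: le_trans (ler_normD _ _) _; rewrite lerD2l normrM (ger0_norm x0).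
rewrite 2!mulrDl -(mulrA _ x) -(mulrA _ (x ^+ 2)); apply: lerD; first apply: lerD.
- by rewrite ler_piMr// expN_le1// ltW.
- by rewrite ler_wpM2l// mul_expN_le.
- by rewrite ler_wpM2l// sqr_expN_le.
Qed.

Lemma is_derive_quadexp C0 C1 C2 l x : is_derive x 1 (quadexp C0 C1 C2 l)
  (quadexp (C1 - l * C0) (2 * C2 - l * C1) (- (l * C2)) l x).
Proof.
have H : is_derive x (1 : R) (fun x : R => C0 + C1 * x + C2 * x ^+ 2) (C1 + 2 * C2 * x).
  have -> : (fun x : R => C0 + C1 * x + C2 * x ^+ 2) =
     horner (C0%:P + C1 *: 'X + C2 *: 'X^2).
    by apply/funext => y; rewrite !hornerE.
  apply: trigger_derive (is_derive_poly _ _) _.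
  by rewrite !(derivD, derivC, derivZ, derivX, derivXn) !hornerE/=; ring.
have := is_deriveM H (is_derive_expN l x).
move=> /trigger_derive; apply.
by rewrite /GRing.scale/= /quadexp; ring.
Qed.

Lemma derivable_quadexp C0 C1 C2 l x : derivable (quadexp C0 C1 C2 l) x 1.
Proof. by have [] := is_derive_quadexp C0 C1 C2 l x. Qed.

Lemma derive1_quadexp C0 C1 C2 l : (quadexp C0 C1 C2 l)^`()%classic =
  quadexp (C1 - l * C0) (2 * C2 - l * C1) (- (l * C2)) l.
Proof.
by apply/funext => x; rewrite derive1E; have [_] := is_derive_quadexp C0 C1 C2 l x.
Qed.

Lemma continuous_quadexp C0 C1 C2 l : continuous (quadexp C0 C1 C2 l).
Proof.
move=> x; apply/differentiable_continuous/derivable1_diffP.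
exact: derivable_quadexp.
Qed.

Lemma measurable_quadexp C0 C1 C2 l :
  measurable_fun (setT : set RR) (quadexp C0 C1 C2 l).
Proof. by apply: continuous_measurable_fun; exact: continuous_quadexp. Qed.

Lemma bounded_quadexp C0 C1 C2 l : 0 < l -> bounded_on_state_space (quadexp C0 C1 C2 l).
Proof. by move=> l0; eexists => x /ltW x0; exact: (quadexp_le _ _ _ l0 (lexx l) x0). Qed.

Lemma expN_quadexp l : expN l = quadexp 1 0 0 l.
Proof. by apply/funext => x; rewrite /quadexp !mul0r !addr0 mul1r. Qed.

Variables a b c g : R.
Local Notation L := (generator a b c g).

Lemma generator_linexp A B l : L (quadexp A B 0 l) = quadexp
  (a * (B - l * A))
  (- b * (B - l * A) - a * (l * B) + c * ((A + B * g) * expN l g - A))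
  (b * (l * B) + c * B * (expN l g - 1)) l.
Proof.
by apply/funext => x; rewrite /generator derive1_quadexp /quadexp expND; ring.
Qed.

Lemma generator_expN l : L (expN l) =
  quadexp (- (a * l)) (b * l - c * (1 - expN l g)) 0 l.
Proof.
by rewrite expN_quadexp generator_linexp; apply/funext => x; rewrite /quadexp; ring.
Qed.

Lemma test_function_linexp A B l : 0 < l -> test_function L (quadexp A B 0 l).
Proof.
move=> l0; split.
- by move=> x _; exact: derivable_quadexp.
- by move=> x _; rewrite derive1_quadexp; exact: continuous_quadexp.
- exact: bounded_quadexp.
- by rewrite generator_linexp; exact: bounded_quadexp.
Qed.

End exponentials.

(** * One-step error between the semigroup and the chain *)

Section one_step.
Context {R : realType}.
Variables a b c g : R.
Hypotheses (a0 : 0 < a) (b0 : 0 < b) (c0 : 0 < c) (g0 : 0 < g).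
Local Notation RR := (measurableTypeR R).
Local Notation L := (generator a b c g).
Variable P : R.-pker (RR * RR) ~> RR.
Hypotheses (hP : markov_semigroup P) (hL : has_generator P L).

Variables m M : R.
Hypotheses (m0 : 0 < m) (mM : m <= M).

Lemma semigroup_expN_expansion : exists2 K, 0 <= K &
  forall l h x, m <= l -> l <= M -> 0 <= h -> 0 < x ->
  `|mean_at P h x (expN l) - expN l x - h * L (expN l) x| <= K * h ^+ 2.
Proof.
(* [be] bounds the coefficient of x in [L (expN l)]; [K0], [K1] and [K2] bound the three
   coefficients of [L (L (expN l))]. *)
pose be := b * M + c.
pose K0 := a * (be + M * (a * M)).
pose K1 := b * (be + M * (a * M)) + a * (M * be) + c * ((a * M + be * g) + a * M).
pose K2 := b * (M * be) + c * be.
have M0 : 0 <= M by rewrite (le_trans _ mM)// ltW.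
have ap := ltW a0; have bp := ltW b0; have cp := ltW c0; have gp := ltW g0.
have be0 : 0 <= be by rewrite /be; nneg.
have K0p : 0 <= K0 by rewrite /K0; nneg.
have K1p : 0 <= K1 by rewrite /K1; nneg.
have K2p : 0 <= K2 by rewrite /K2; nneg.
have mp := ltW m0.
exists (K0 + K1 / m + K2 * (4 / m ^+ 2)); first by nneg.
move=> l h x ml lM h0 x0.
have l0 : 0 < l by exact: lt_le_trans ml.
have lp := ltW l0.
have EL := generator_expN a b c g l.
set A := - (a * l) in EL; set B := b * l - c * (1 - expN l g) in EL.
have [G0 G1] : 0 <= expN l g /\ expN l g <= 1 by split; [exact: expN_ge0|exact: expN_le1].
have nA : `|A| <= a * M by rewrite normrN ger0_norm ?mulr_ge0// ler_wpM2l.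
have nB : `|B| <= be.
  apply: le_trans (ler_normB _ _) _; apply: lerD.
    by rewrite ger0_norm ?mulr_ge0// ler_wpM2l.
  rewrite ger0_norm; last by rewrite mulr_ge0// subr_ge0.
  by rewrite ler_piMr// lerBlDr lerDl.
have nl : `|l| <= M by rewrite ger0_norm.
have nG : `|expN l g| <= 1 by rewrite ger0_norm.
have nG1 : `|expN l g - 1| <= 1.
  by rewrite distrC ger0_norm ?subr_ge0// lerBlDr lerDl.
have nM (u v U V : R) : `|u| <= U -> `|v| <= V -> `|u * v| <= U * V.
  by move=> ? ?; rewrite normrM ler_pM.
have nD (u v U V : R) : `|u| <= U -> `|v| <= V -> `|u + v| <= U + V.
  by move=> ? ?; apply: le_trans (ler_normD _ _) _; apply: lerD.
have nN (u U : R) : `|u| <= U -> `|- u| <= U by rewrite normrN.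
have [na nb nc ng] : [/\ `|a| <= a, `|b| <= b, `|c| <= c & `|g| <= g].
  by rewrite !ger0_norm.
apply: dynkin_second_order => //.
- by rewrite expN_quadexp; exact: test_function_linexp.
- by rewrite EL; exact: test_function_linexp.
- by rewrite EL; exact: measurable_quadexp.
- by rewrite EL generator_linexp; exact: measurable_quadexp.
move=> y y0; rewrite EL generator_linexp.
apply: le_trans (quadexp_le _ _ _ m0 ml (ltW y0)) _.
have q0 : 0 <= 4 / m ^+ 2 by nneg.
apply: lerD; first apply: lerD.
- exact: (nM _ _ _ _ na (nD _ _ _ _ nB (nN _ _ (nM _ _ _ _ nl nA)))).
- rewrite ler_wpM2r ?invr_ge0//.
  have n1 := nM _ _ _ _ nb (nD _ _ _ _ nB (nN _ _ (nM _ _ _ _ nl nA))).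
  have n2 := nM _ _ _ _ na (nM _ _ _ _ nl nB).
  have := nM _ _ _ _ (nD _ _ _ _ nA (nM _ _ _ _ nB ng)) nG; rewrite mulr1 => n3.
  have n4 := nM _ _ _ _ nc (nD _ _ _ _ n3 (nN _ _ nA)).
  by rewrite mulNr; exact: (nD _ _ _ _ (nD _ _ _ _ (nN _ _ n1) (nN _ _ n2)) n4).
- rewrite ler_wpM2r//.
  have := nM _ _ _ _ (nM _ _ _ _ nc nB) nG1; rewrite mulr1.
  exact: (nD _ _ _ _ (nM _ _ _ _ nb (nM _ _ _ _ nl nB))).
Qed.

(** Both signs of [v] are needed: to the right of [a / b] the flow moves down and the exponent [v1]
    below is negative. *)
Lemma expRN_linear_dist (v : R) :
  `|expR (- v) - (1 - v)| <= v ^+ 2 * (1 + expR (- v)).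
Proof.
have e0 : 0 < expR (- v) by exact: expR_gt0.
have e1 : 0 <= expR (- v) - (1 - v) by have := expR_ge1Dx (- v); lra.
rewrite ger0_norm//; have v2 : 0 <= v ^+ 2 by exact: sqr_ge0.
have [v0|v0] := leP 0 v.
  have := expRN_le_quadratic v0; have := mulr_ge0 v2 (ltW e0); lra.
have : 1 + v <= expR v by exact: expR_ge1Dx.
have Ev : expR (- v) * expR v = 1 by rewrite -expRD addNr expR0.
move=> H; have : (1 - v) * (1 + v) <= (1 - v) * expR v by rewrite ler_wpM2l//; lra.
move=> /(ler_wpM2l (ltW e0)).
have -> : expR (- v) * ((1 - v) * expR v) = 1 - v by rewrite mulrCA Ev mulr1.
have -> : expR (- v) * ((1 - v) * (1 + v)) = expR (- v) - v ^+ 2 * expR (- v) by ring.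
by lra.
Qed.

(** A step multiplies [expN l] by exponentials of [- v1] and [- v2], which are expanded to first
    order. These numbers grow linearly in [x], so they are not uniformly small; their squares are
    absorbed by the decay of [expN]. *)
Lemma chain_expN_expansion : exists2 K, 0 <= K &
  forall l h x, m <= l -> l <= M -> 0 <= h -> h <= 1 -> b * h <= 2^-1 -> 0 < x ->
  `|chain a b c g h (expN l) x - expN l x - h * L (expN l) x| <= K * h ^+ 2.
Proof.
have M0 : 0 <= M by rewrite (le_trans _ mM)// ltW.
have ap := ltW a0; have bp := ltW b0; have cp := ltW c0; have gp := ltW g0.
have mp := ltW m0.
pose W := M * a + M * b + c.
have W0 : 0 <= W by rewrite /W; nneg.
pose N := W ^+ 2 * 2 + M * b * (a + b).
(* As [b * h <= 2^-1], the flow keeps at least half of [x], so that [expN l] after a step is still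
   below [expN mm]. *)
pose mm := m / 2.
have mm0 : 0 < mm by rewrite divr_gt0.
exists (2 * N * (1 + 2 / mm + 4 / mm ^+ 2)); first by rewrite /N; nneg.
move=> l h x ml lM h0 h1 bh x0; have xp := ltW x0.
have lp : 0 <= l by exact: le_trans ml.
rewrite generator_expN.
set G := expN l g.
have [G0 G1] : 0 <= G /\ G <= 1 by split; [exact: expN_ge0|exact: expN_le1].
set rho := expR (- (b * h)).
have rh1 : 1 - rho <= b * h by exact: one_subr_expRN_le.
have bh0 : 0 <= b * h by nneg.
have rh0 : 0 <= 1 - rho by exact: one_subr_expRN_ge0.
have rh2 : b * h - (1 - rho) <= (b * h) ^+ 2.
  by have := expRN_le_quadratic bh0; rewrite -/rho; lra.
set e := expN l x.
(* [v1] is [l] times the displacement of the flow; [v2] adds the hazard of the step. *)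
pose v1 := l * ((1 - rho) * (a / b - x)); pose v2 := v1 + c * h * x.
have fl : flow (a / b) rho x = x + (1 - rho) * (a / b - x) by rewrite /flow; ring.
have E1 : expN l (flow (a / b) rho x) = e * expR (- v1) by rewrite fl expND.
have E2 : expR (- (c * h * x)) * expN l (flow (a / b) rho x) = e * expR (- v2).
  by rewrite E1 mulrCA -expRD; congr (_ * expR _); rewrite /v2; ring.
have -> : chain a b c g h (expN l) x = e * expR (- v1) * G + e * expR (- v2) * (1 - G).
  have -> : chain a b c g h (expN l) x =
      expR (- (c * h * x)) * expN l (flow (a / b) rho x) * (1 - G) +
      expN l (flow (a / b) rho x) * G.
    by rewrite /chain /step -/rho expND -/G; ring.
  by rewrite E2 E1 addrC.
have -> : e * expR (- v1) * G + e * expR (- v2) * (1 - G) - e -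
    h * quadexp (- (a * l)) (b * l - c * (1 - G)) 0 l x =
  e * G * (expR (- v1) - (1 - v1)) + e * (1 - G) * (expR (- v2) - (1 - v2)) +
  e * (l * (a / b - x) * (b * h - (1 - rho))).
  rewrite /quadexp -/e /v2 /v1.
  have -> : a * l = b * (a / b) * l by rewrite mulrCA divff ?mulr1 ?gt_eqF.
  by ring.
have ebx : e <= expN mm x.
  by apply: expN_mono => //; rewrite (le_trans _ ml)// ler_pdivrMr// ler_peMr// ler1n.
have e0 : 0 <= e by exact: expN_ge0.
have flx : x / 2 <= flow (a / b) rho x.
  have : 0 <= (1 - rho) * (a / b) by nneg.
  rewrite fl; have : (1 - rho) * x <= 2^-1 * x by rewrite ler_wpM2r//; lra.
  lra.
have b1 : e * expR (- v1) <= expN mm x.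
  rewrite -E1 /expN ler_expR lerN2.
  apply: (@le_trans _ _ (m * (x / 2))); first by rewrite /mm; lra.
  by apply: ler_pM => //; rewrite divr_ge0.
have b2 : e * expR (- v2) <= expN mm x.
  apply: le_trans b1; rewrite ler_wpM2l// ler_expR lerN2 /v2 lerDl; nneg.
have ab0 : 0 <= a / b by nneg.
have nab : `|a / b - x| <= a / b + x.
  by apply: le_trans (ler_normB _ _) _; rewrite !ger0_norm.
have nv1 : `|v1| <= h * (M * a + M * b * x).
  rewrite /v1 !normrM (ger0_norm lp) (ger0_norm rh0).
  have -> : h * (M * a + M * b * x) = M * ((b * h) * (a / b + x)).
    by field; rewrite gt_eqF.
  apply: ler_pM; rewrite ?mulr_ge0//; apply: ler_pM => //.
have nv2 : `|v2| <= h * (W * (1 + x)).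
  apply: le_trans (ler_normD _ _) _.
  rewrite (ger0_norm (x := c * h * x)); last by nneg.
  apply: le_trans (lerD nv1 (lexx _)) _.
  have -> : h * (W * (1 + x)) = h * (M * a + M * b * x) + c * h * x +
    h * (M * b + c + M * a * x) by rewrite /W; ring.
  by rewrite lerDl; nneg.
have nv1' : `|v1| <= h * (W * (1 + x)).
  apply: le_trans nv1 _.
  have -> : h * (W * (1 + x)) = h * (M * a + M * b * x) +
    h * (M * b + c + M * a * x + c * x) by rewrite /W; ring.
  by rewrite lerDl; nneg.
have sq v : `|v| <= h * (W * (1 + x)) -> v ^+ 2 <= h ^+ 2 * W ^+ 2 * (1 + x) ^+ 2.
  move=> nv; rewrite -(real_normK (num_real v)).
  have -> : h ^+ 2 * W ^+ 2 * (1 + x) ^+ 2 = (h * (W * (1 + x))) ^+ 2 by ring.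
  by rewrite !expr2 ler_pM.
have X0 : 0 <= expN mm x by exact: expN_ge0.
have main v k : `|v| <= h * (W * (1 + x)) -> 0 <= k <= 1 -> e * expR (- v) <= expN mm x ->
   `|e * k * (expR (- v) - (1 - v))| <= 2 * h ^+ 2 * W ^+ 2 * ((1 + x) ^+ 2 * expN mm x) * k.
  move=> nv /andP[k0 k1] bv; rewrite !normrM (ger0_norm e0) (ger0_norm k0).
  rewrite mulrAC ler_wpM2r//.
  apply: (@le_trans _ _ (e * (v ^+ 2 * (1 + expR (- v))))).
    by rewrite ler_wpM2l// expRN_linear_dist.
  have -> : e * (v ^+ 2 * (1 + expR (- v))) = v ^+ 2 * (e + e * expR (- v)) by ring.
  have -> : 2 * h ^+ 2 * W ^+ 2 * ((1 + x) ^+ 2 * expN mm x) =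
     h ^+ 2 * W ^+ 2 * (1 + x) ^+ 2 * (expN mm x + expN mm x) by ring.
  apply: ler_pM; rewrite ?sqr_ge0 ?sq// ?lerD// addr_ge0// mulr_ge0// expR_ge0.
have last : `|e * (l * (a / b - x) * (b * h - (1 - rho)))| <=
   h ^+ 2 * (M * b * (a + b)) * ((1 + x) ^+ 2 * expN mm x).
  rewrite !normrM (ger0_norm e0) (ger0_norm lp).
  have -> : h ^+ 2 * (M * b * (a + b)) * ((1 + x) ^+ 2 * expN mm x) =
     expN mm x * (M * ((a / b + 1) * (1 + x) ^+ 2) * (b * h) ^+ 2).
    by field; rewrite gt_eqF.
  apply: ler_pM => //; first by rewrite !mulr_ge0.
  apply: ler_pM => //; first by rewrite mulr_ge0.
    apply: ler_pM => //; apply: le_trans nab _.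
    have -> : (a / b + 1) * (1 + x) ^+ 2 = a / b + x +
      (a / b * (2 * x + x ^+ 2) + 1 + x + x ^+ 2) by ring.
    by rewrite lerDl; nneg.
  by rewrite ger0_norm// subr_ge0.
have xb : (1 + x) ^+ 2 * expN mm x <= 1 + 2 / mm + 4 / mm ^+ 2.
  have -> : (1 + x) ^+ 2 * expN mm x = expN mm x + 2 * (x * expN mm x) + x ^+ 2 * expN mm x.
    by ring.
  apply: lerD; last exact: sqr_expN_le.
  by apply: lerD; [rewrite expN_le1// ltW|rewrite ler_wpM2l// mul_expN_le].
apply: le_trans (ler_normD _ _) _.
apply: le_trans (lerD (ler_normD _ _) (lexx _)) _.
have k1 : 0 <= G <= 1 by rewrite G0.
have k2 : 0 <= 1 - G <= 1 by rewrite subr_ge0 G1 lerBlDr lerDl.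
apply: le_trans (lerD (lerD (main _ _ nv1' k1 b1) (main _ _ nv2 k2 b2)) last) _.
set Y := (1 + x) ^+ 2 * expN mm x in xb *.
apply: (@le_trans _ _ (2 * N * h ^+ 2 * Y)).
  have : 0 <= M * b * (a + b) * h ^+ 2 * Y by rewrite /Y; nneg.
  have : 0 <= W ^+ 2 * h ^+ 2 * Y by rewrite /Y; nneg.
  by rewrite /N; lra.
have -> : 2 * N * (1 + 2 / mm + 4 / mm ^+ 2) * h ^+ 2 =
   2 * N * h ^+ 2 * (1 + 2 / mm + 4 / mm ^+ 2) by ring.
by rewrite ler_wpM2l// /N; nneg.
Qed.

Lemma one_step_error : exists2 K, 0 <= K &
  forall l h x, m <= l -> l <= M -> 0 <= h -> h <= 1 -> b * h <= 2^-1 -> 0 < x ->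
  `|mean_at P h x (expN l) - chain a b c g h (expN l) x| <= K * h ^+ 2.
Proof.
have [K1 K10 H1] := semigroup_expN_expansion.
have [K2 K20 H2] := chain_expN_expansion.
exists (K1 + K2) => [|l h x ml lM h0 h1 bh x0]; first exact: addr_ge0.
have := H1 _ _ _ ml lM h0 x0; have := H2 _ _ _ ml lM h0 h1 bh x0.
set u := mean_at _ _ _ _; set v := chain _ _ _ _ _ _ _; set w := h * _ => B2 B1.
have -> : u - v = (u - expN l x - w) - (v - expN l x - w) by ring.
by rewrite mulrDl; apply: le_trans (ler_normB _ _) _; apply: lerD.
Qed.

End one_step.

(** * Convergence of the chain to the semigroup *)

Section iterated_chain.
Context {R : realType}.
Variables a b c g : R.
Hypotheses (a0 : 0 < a) (b0 : 0 < b) (c0 : 0 < c) (g0 : 0 < g).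
Implicit Types (u v f : R -> R) (l h x t : R).

Lemma chain_lin h w1 w2 u v x :
  chain a b c g h (fun y => w1 * u y + w2 * v y) x =
  w1 * chain a b c g h u x + w2 * chain a b c g h v x.
Proof. by rewrite /chain /step; ring. Qed.

Lemma iter_chain_lin h n w1 w2 u v :
  iter n (chain a b c g h) (fun y => w1 * u y + w2 * v y) =
  (fun y => w1 * iter n (chain a b c g h) u y + w2 * iter n (chain a b c g h) v y).
Proof.
elim: n => //= n ->; apply/funext => x; exact: chain_lin.
Qed.

Lemma iter_chain_sum h n k (C : 'I_k -> R) (u : 'I_k -> R -> R) x :
  iter n (chain a b c g h) (fun y => \sum_(i < k) C i * u i y) x =
  \sum_(i < k) C i * iter n (chain a b c g h) (u i) x.
Proof.
elim: n x => //= n IH x; rewrite {1}/chain {1}/step.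
rewrite !IH !mulr_sumr -big_split/=; apply: eq_bigr => i _.
by rewrite /chain /step; ring.
Qed.

Lemma iter_chain_le h n u v x : 0 < h -> (forall y, 0 <= y -> u y <= v y) -> 0 <= x ->
  iter n (chain a b c g h) u x <= iter n (chain a b c g h) v x.
Proof.
move=> h0 uv; elim: n x => [|n IH] x x0; first exact: uv.
have r1 : expR (- (b * h)) < 1 by rewrite -expR0 ltr_expR oppr_lt0 mulr_gt0.
apply: (step_le _ (expR_gt0 _) r1 _ g0 IH x0).
  by rewrite divr_ge0 ?ltW.
by rewrite mulr_ge0 ?ltW.
Qed.

(** The flow multiplies the exponent by [expR (- (b * h))], and the survival factor adds [c * h] to
    it. For nonnegative [l] and [h] both weights are nonnegative with sum at most 1, so errors do
    not grow under iteration. *)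
Lemma chain_expN h l : chain a b c g h (expN l) =
  (fun x => (expN l (a / b * (1 - expR (- (b * h)))) * expN l g) *
              expN (l * expR (- (b * h))) x +
            (expN l (a / b * (1 - expR (- (b * h)))) * (1 - expN l g)) *
              expN (l * expR (- (b * h)) + c * h) x).
Proof.
apply/funext => x; rewrite /chain /step expND.
set rho := expR (- (b * h)).
have -> : flow (a / b) rho x = a / b * (1 - rho) + rho * x by rewrite /flow; ring.
rewrite expND; set k := expN l (a / b * _).
have -> : expN l (rho * x) = expN (l * rho) x by rewrite /expN mulrA.
have -> : expN (l * rho + c * h) x = expN (l * rho) x * expR (- (c * h * x)).
  by rewrite /expN -expRD; congr expR; ring.
by ring.
Qed.

Local Notation RR := (measurableTypeR R).
Variable P : R.-pker (RR * RR) ~> RR.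
Hypotheses (hP : markov_semigroup P) (hL : has_generator P (generator a b c g)).

Lemma bm_expN l : 0 <= l -> bounded_measurable (expN l).
Proof.
move=> l0; split.
  by rewrite expN_quadexp; exact: measurable_quadexp.
by exists 1 => x x0; rewrite ger0_norm ?expN_ge0// expN_le1// ltW.
Qed.

(** Telescoping, with the last step of the semigroup replaced by the chain at cost [K * h ^+ 2]. The
    result is again a combination of exponentials, to which the induction hypothesis applies. The
    two conditions on [l] keep every exponent met in [n] steps inside [[m, M]], where the one-step
    constant is uniform. *)
Lemma iter_chain_error m M : 0 < m -> m <= M -> exists2 K, 0 <= K &
  forall h, 0 <= h -> h <= 1 -> b * h <= 2^-1 ->
  forall n l x, m <= l * expR (- (b * h)) ^+ n -> l + c * h * n%:R <= M -> 0 < x ->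
  `|mean_at P (n%:R * h) x (expN l) - iter n (chain a b c g h) (expN l) x| <=
  n%:R * (K * h ^+ 2).
Proof.
move=> m0 mM.
have [K K0 HK] := one_step_error a0 b0 c0 g0 hP hL m0 mM.
have [K1 _ HK1] := semigroup_expN_expansion a0 b0 c0 g0 hP hL m0 mM.
exists K => // h h0 h1 bh; set rho := expR (- (b * h)).
have r0 : 0 < rho by exact: expR_gt0.
have r1 : rho <= 1 by apply: expRN_le1; rewrite mulr_ge0// ltW.
have ch0 : 0 <= c * h by rewrite mulr_ge0// ltW.
have lrange n l : m <= l * rho ^+ n -> l + c * h * n%:R <= M -> m <= l /\ l <= M.
  move=> ml lM; have l0 : 0 <= l.
    by rewrite -(pmulr_lge0 _ (exprn_gt0 n r0)) (le_trans _ ml)// ltW.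
  split.
    by apply: le_trans ml _; rewrite ler_piMr// exprn_ile1// ltW.
  by apply: le_trans lM; rewrite lerDl mulr_ge0.
elim=> [|n IH] l x ml lM x0.
  have [ml' lM'] := lrange _ _ ml lM.
  (* With step 0 the expansion has no error, which identifies the semigroup at time 0 on
     exponentials. *)
  have := HK1 _ _ _ ml' lM' (lexx 0) x0.
  by rewrite !mul0r expr0n/= mulr0 subr0.
have [ml' lM'] := lrange _ _ ml lM.
have l0 : 0 <= l by rewrite (le_trans _ ml')// ltW.
have nh0 : 0 <= n%:R * h by rewrite mulr_ge0.
have -> : n.+1%:R * h = n%:R * h + h by rewrite -natr1; ring.
rewrite (chapman_kolmogorov hP nh0 h0 x0 (bm_expN l0)); last by move=> *; exact: expN_ge0.
have m1 := semigroup_state hP nh0 x0.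
have bT : bounded_measurable (chain a b c g h (expN l)).
  rewrite chain_expN; apply: bmD; apply: bmZ; apply: bm_expN.
    by rewrite mulr_ge0// ltW.
  by rewrite addr_ge0// mulr_ge0// ltW.
have E1 : `|mean_at P (n%:R * h) x (fun y => mean_at P h y (expN l)) -
    mean_at P (n%:R * h) x (chain a b c g h (expN l))| <= K * h ^+ 2.
  apply: mean_dist_le => //.
    apply: bm_mean_at => //; first exact: bm_expN.
    by move=> *; exact: expN_ge0.
  by move=> y y0; exact: HK.
rewrite iterSr.
have E2 : `|mean_at P (n%:R * h) x (chain a b c g h (expN l)) -
    iter n (chain a b c g h) (chain a b c g h (expN l)) x| <= n%:R * (K * h ^+ 2).
  rewrite chain_expN iter_chain_lin.
  set k := expN l _; set G := expN l g.
  set l1 := l * _; set l2 := l1 + _.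
  have l10 : 0 <= l1 by rewrite mulr_ge0// ltW.
  have l20 : 0 <= l2 by rewrite addr_ge0.
  have k01 : 0 <= k /\ k <= 1.
    split; first exact: expN_ge0.
    by apply: expN_le1 => //; rewrite mulr_ge0 ?divr_ge0 ?(ltW a0) ?(ltW b0)// subr_ge0.
  have G01 : 0 <= G /\ G <= 1 by split; [exact: expN_ge0|apply: expN_le1 => //; exact: ltW].
  rewrite /mean_at (meanD m1 (bmZ _ (bm_expN l10)) (bmZ _ (bm_expN l20))).
  rewrite (meanZ m1 _ (bm_expN l10)) (meanZ m1 _ (bm_expN l20)).
  rewrite -/(mean_at P (n%:R * h) x (expN l1)) -/(mean_at P (n%:R * h) x (expN l2)).
  have l1n : m <= l1 * rho ^+ n by rewrite /l1 -mulrA -exprS.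
  have I1 : `|mean_at P (n%:R * h) x (expN l1) - iter n (chain a b c g h) (expN l1) x| <=
      n%:R * (K * h ^+ 2).
    apply: IH => //; apply: le_trans lM; apply: lerD; first by rewrite ler_piMr.
    by rewrite ler_wpM2l// ler_nat.
  have I2 : `|mean_at P (n%:R * h) x (expN l2) - iter n (chain a b c g h) (expN l2) x| <=
      n%:R * (K * h ^+ 2).
    apply: IH => //.
      by apply: le_trans l1n _; rewrite ler_wpM2r ?exprn_ge0 ?(ltW r0)// lerDl.
    apply: le_trans lM; rewrite /l2 -natr1 mulrDr mulr1.
    have : l1 <= l by rewrite ler_piMr.
    by lra.
  set A1 := mean_at _ _ _ (expN l1) in I1 *; set A2 := mean_at _ _ _ (expN l2) in I2 *.
  set B1 := iter _ _ _ _ in I1 *; set B2 := iter _ _ (expN l2) _ in I2 *.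
  set E := n%:R * _ in I1 I2 *.
  have -> : k * G * A1 + k * (1 - G) * A2 - (k * G * B1 + k * (1 - G) * B2) =
    k * (G * (A1 - B1) + (1 - G) * (A2 - B2)) by ring.
  have E0 : 0 <= E by exact: le_trans I1.
  have [[k0 k1] [G0 G1]] := (k01, G01).
  rewrite normrM (ger0_norm k0) -[leRHS]mul1r; apply: ler_pM => //.
  apply: le_trans (ler_normD _ _) _.
  rewrite !normrM (ger0_norm G0) (ger0_norm (x := 1 - G)) ?subr_ge0//.
  have -> : E = G * E + (1 - G) * E by ring.
  by apply: lerD; rewrite ler_wpM2l// subr_ge0.
have -> : n.+1%:R * (K * h ^+ 2) = K * h ^+ 2 + n%:R * (K * h ^+ 2).
  by rewrite -natr1; ring.
move: E1 E2; set u := mean_at _ _ _ _; set v := mean_at _ _ _ _; set w := iter _ _ _ _.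
move=> E1 E2; have -> : u - w = (u - v) + (v - w) by ring.
by apply: le_trans (ler_normD _ _) _; apply: lerD.
Qed.

Lemma iter_chain_cvg_expN l t x : 0 <= l -> 0 < t -> 0 < x ->
  iter n (chain a b c g (t / n%:R)) (expN l) x @[n --> \oo] --> mean_at P t x (expN l).
Proof.
(* The exponent 0 lies in no [[m, M]] with [0 < m]; for it both sides are the constant 1. *)
rewrite le_eqVlt => /predU1P[<- t0 x0|l0 t0 x0].
  have E : expN 0 = (fun=> 1) :> (R -> R).
    by apply/funext => y; rewrite /expN mul0r oppr0 expR0.
  rewrite E /mean_at (mean_cst (semigroup_state hP (ltW t0) x0)).
  have -> : (fun n => iter n (chain a b c g (t / n%:R)) (fun=> 1) x) = (fun=> 1).
    apply/funext => n; move: (t / n%:R) => h; elim: n x {x0} => //= n IH x.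
    by rewrite /chain /step !IH; ring.
  exact: cvg_cst.
(* Bounds, independent of the step, for all exponents reached up to time [t]. The error
   [n%:R * (K * (t / n%:R) ^+ 2)] then tends to 0. *)
pose m := l * expR (- (b * t)); pose M := l + c * t.
have m0 : 0 < m by rewrite mulr_gt0// expR_gt0.
have mM : m <= M.
  apply: (@le_trans _ _ l); last by rewrite lerDl mulr_ge0// ltW.
  by rewrite ler_piMr ?(ltW l0)// expRN_le1// mulr_ge0// ltW.
have [K K0 HK] := iter_chain_error m0 mM.
apply/cvgrPdist_le => e e0; near=> n.
have n0 : 0 < n%:R :> R.
  by rewrite ltr0n; near: n; exact: nbhs_infty_gt.
have h0 : 0 <= t / n%:R by rewrite divr_ge0// ltW.
have nt : n%:R * (t / n%:R) = t by rewrite mulrCA divff ?mulr1// gt_eqF.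
have := HK (t / n%:R) h0 _ _ n l x _ _ x0; rewrite nt => H.
apply: le_trans (H _ _ _ _) _ => {H}.
- by rewrite ler_pdivrMr// mul1r; near: n; exact: nbhs_infty_ger.
- rewrite mulrA ler_pdivrMr// -ler_pdivrMl ?invr_gt0// invrK.
  by near: n; exact: nbhs_infty_ger.
- by rewrite /m -expRM_natl mulrN -{1}nt; rewrite le_eqVlt; apply/orP; left;
    apply/eqP; congr (_ * expR _); ring.
- by rewrite /M -mulrA [_ / _ * _]mulrC nt.
have -> : n%:R * (K * (t / n%:R) ^+ 2) = K * t ^+ 2 / n%:R.
  by field; rewrite gt_eqF.
rewrite ler_pdivrMr// [leRHS]mulrC -ler_pdivrMr//.
by near: n; exact: nbhs_infty_ger.
Unshelve. all: by end_near. Qed.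

(** Real exponents are allowed because the bounded approximations of the cubic use multiples of a
    small real number. *)
Definition expsum k (C l : 'I_k -> R) x : R := \sum_(i < k) C i * expN (l i) x.

Lemma bm_expsum k (C l : 'I_k -> R) : (forall i, 0 <= l i) ->
  bounded_measurable (expsum C l).
Proof.
(* Any measure of mass 1 on the state space would do here; [P (0, 1)] is one at hand. *)
move=> l0; have [] // := @mean_sum _ (P (0, 1)) _ k (fun i x => C i * expN (l i) x).
  exact: semigroup_state hP _ _ (lexx 0) ltr01.
by move=> i; apply: bmZ; exact: bm_expN.
Qed.

Lemma cvg_sum_ord k (u : 'I_k -> nat -> R) (v : 'I_k -> R) :
  (forall i, u i n @[n --> \oo] --> v i) ->
  (fun n => \sum_(i < k) u i n) @ \oo --> \sum_(i < k) v i.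
Proof.
elim: k u v => [|k IH] u v uv.
  under eq_fun do rewrite big_ord0.
  by rewrite big_ord0; exact: cvg_cst.
under eq_fun do rewrite big_ord_recl.
by rewrite big_ord_recl; apply: cvgD => //; apply: IH.
Qed.

Lemma iter_chain_cvg k (C l : 'I_k -> R) t x : (forall i, 0 <= l i) -> 0 < t -> 0 < x ->
  iter n (chain a b c g (t / n%:R)) (expsum C l) x @[n --> \oo] --> mean_at P t x (expsum C l).
Proof.
move=> l0 t0 x0.
have m1 := semigroup_state hP (ltW t0) x0.
have [_ E] := mean_sum m1 (fun i => bmZ (C i) (bm_expN (l0 i))).
rewrite /mean_at /expsum E.
have -> : (fun n => iter n (chain a b c g (t / n%:R))
      (fun y => \sum_(i < k) C i * expN (l i) y) x) =
    (fun n => \sum_(i < k) C i * iter n (chain a b c g (t / n%:R)) (expN (l i)) x).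
  by apply/funext => n; rewrite iter_chain_sum.
apply: cvg_sum_ord => i; rewrite (meanZ m1); last exact: bm_expN.
apply: cvgM; first exact: cvg_cst.
exact: iter_chain_cvg_expN.
Qed.

Hypothesis p0 : 0 < b - c * g.

(** Limit of the chain with step [t / n]: [Cf] is multiplied by the step and disappears. The growth
    bound is stated for exponential sums below the cubic, since convergence of the chain is
    available on such sums; monotonicity of the chain passes from the sum to the cubic before the
    limit. *)
Lemma semigroup_estimates kap :
  0 < kap -> kap <= (b - c * g) / 2 -> kap < a * c / b ->
  exists be ga K, [/\ 0 < be, 0 < ga, 0 < K &
  forall t, 0 < t ->
    (forall q : {poly R}, (forall z, 0 <= z <= 1 -> `|q.[z]| <= 1) ->
      forall x y, 0 < x -> x <= y ->
      `|mean_at P t y (exp_poly q) - mean_at P t x (exp_poly q)| <=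
      K * (1 + t) * expR (- (kap * t)) * (1 + (cubic be ga x + cubic be ga y))) /\
    (forall k (C l : 'I_k -> R), (forall i, 0 <= l i) ->
      (forall x, 0 <= x -> expsum C l x <= cubic be ga x) ->
      forall x, 0 < x -> mean_at P t x (expsum C l) <=
        expR (- ((b - c * g) / 2 * t)) * cubic be ga x + K)].
Proof.
move=> kap0 kap_p kap_ac.
have [be [ga [K [h0 [be0 ga0 K0 h00 H]]]]] := chain_estimates a0 b0 c0 g0 p0 kap0 kap_p kap_ac.
exists be, ga, K; split=> // t t0.
have near_h : \forall n \near \oo, [/\ (0 < n)%N, 0 < t / n%:R, t / n%:R <= h0 &
     n%:R * (t / n%:R) = t].
  near=> n; have n0 : (0 < n)%N by near: n; exact: nbhs_infty_gt.
  have n0' : 0 < n%:R :> R by rewrite ltr0n.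
  split=> //; first by rewrite divr_gt0.
    rewrite ler_pdivrMr// mulrC -ler_pdivrMr//.
    by near: n; exact: nbhs_infty_ger.
  by rewrite mulrCA divff ?mulr1// gt_eqF.
split.
  move=> q q1 x y x0 xy; have y0 := lt_le_trans x0 xy.
  have [Cf fF] := exp_poly_antiderivative q1; have Cf0 := ab_ge0 fF.
  have qE : exp_poly q = expsum (fun i : 'I_(size q) => q`_i) (fun i => i%:R).
    by apply/funext => z; rewrite exp_polyE.
  have cx : iter n (chain a b c g (t / n%:R)) (exp_poly q) x @[n --> \oo] -->
      mean_at P t x (exp_poly q).
    by rewrite qE; apply: iter_chain_cvg.
  have cy : iter n (chain a b c g (t / n%:R)) (exp_poly q) y @[n --> \oo] -->
      mean_at P t y (exp_poly q).
    by rewrite qE; apply: iter_chain_cvg.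
  have cxy : `|iter n (chain a b c g (t / n%:R)) (exp_poly q) y -
      iter n (chain a b c g (t / n%:R)) (exp_poly q) x| @[n --> \oo] -->
      `|mean_at P t y (exp_poly q) - mean_at P t x (exp_poly q)|.
    by apply: cvg_norm; exact: cvgB.
  set W := 1 + (_ + _).
  have xp := ltW x0; have yp := ltW y0; have bep := ltW be0; have gap := ltW ga0.
  have W0 : 0 <= W by rewrite /W /cubic; nneg.
  apply/ler_addgt0Pr => e e0.
  apply: (cvgr_to_le cxy); near=> n.
  have [n0 hp hh0 nt] : [/\ (0 < n)%N, 0 < t / n%:R, t / n%:R <= h0 &
     n%:R * (t / n%:R) = t] by near: n.
  have [_ Hn] := H _ hp hh0.
  have := Hn _ _ _ n _ _ fF n0 xp xy; rewrite nt -/W => /le_trans; apply.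
  set B := K * (1 + t) * expR (- (kap * t)).
  have -> : B * (1 + t / n%:R * Cf) * W = B * W + B * W * t * Cf / n%:R by ring.
  rewrite lerD2l ler_pdivrMr ?ltr0n// [leRHS]mulrC -ler_pdivrMr//.
  by near: n; exact: nbhs_infty_ger.
move=> k C l l0 CV x x0.
apply: (cvgr_to_le (iter_chain_cvg l0 t0 x0)); near=> n.
have [n0 hp hh0 nt] : [/\ (0 < n)%N, 0 < t / n%:R, t / n%:R <= h0 &
   n%:R * (t / n%:R) = t] by near: n.
have [Hn _] := H _ hp hh0.
have := Hn n x (ltW x0); rewrite nt => /(le_trans _); apply.
by apply: iter_chain_le => //; exact: ltW.
Unshelve. all: by end_near. Qed.

End iterated_chain.

(** * Approximation of indicators by polynomials in exp(-x) *)

Section mean_dominated.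
Context {R : realType}.
Local Notation RR := (measurableTypeR R).
Local Notation S := (@state_space R).
Variable m : {measure set RR -> \bar R}.
Hypothesis m1 : m S = 1%E.

Lemma mean_dominated_convergence (f_ : nat -> R -> R) (f : R -> R) (M : R) :
  (forall n, measurable_fun (setT : set RR) (f_ n)) ->
  measurable_fun (setT : set RR) f ->
  (forall n x, 0 < x -> `|f_ n x| <= M) ->
  (forall x, 0 < x -> f_ n x @[n --> \oo] --> f x) ->
  \int[m]_(x in S) `|f_ n x - f x| @[n --> \oo] --> (0 : R).
Proof.
move=> mf_ mf f_M f_f.
have mS := @measurable_state_space R.
have mf_S n : measurable_fun S (fun x => (f_ n x)%:E).
  by apply/measurable_EFinP; apply: measurable_funS (mf_ n).
have mfS : measurable_fun S (fun x => (f x)%:E).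
  by apply/measurable_EFinP; apply: measurable_funS mf.
have iM : m.-integrable S (fun=> M%:E).
  by apply: (bm_integrable m1 (f := fun=> M)); exact: bm_cst.
have f_fE x : S x -> (f_ n x)%:E @[n --> \oo] --> (f x)%:E.
  by move=> Sx; apply: cvg_EFin; [exact: nearW|exact: f_f].
have [_ H _] := dominated_convergence mS mf_S mfS (aeW m f_fE) iM
  (aeW m (fun x n Sx => f_M n x Sx)).
exact: fine_cvg H.
Qed.

End mean_dominated.

Section poly_approximation.
Context {R : realType}.
Local Notation RR := (measurableTypeR R).
Local Notation S := (@state_space R).
Implicit Types (q : {poly R}) (A B : set RR) (m : {measure set RR -> \bar R}).

Definition unit_poly q := forall z : R, 0 <= z <= 1 -> 0 <= q.[z] <= 1.

Lemma exp_poly_unit q x : unit_poly q -> 0 < x -> 0 <= exp_poly q x <= 1.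
Proof. by move=> q1 x0; apply: q1; rewrite expR_ge0 expRN_le1// ltW. Qed.

Lemma measurable_exp_poly q : measurable_fun (setT : set RR) (exp_poly q).
Proof.
have -> : exp_poly q = horner q \o expN 1.
  by apply/funext => x; rewrite /exp_poly /expN /= mul1r.
apply: measurableT_comp.
  by apply: continuous_measurable_fun; exact: continuous_horner.
by rewrite expN_quadexp; exact: measurable_quadexp.
Qed.

Lemma bm_exp_poly q : unit_poly q -> bounded_measurable (exp_poly q).
Proof.
move=> q1; split; first exact: measurable_exp_poly.
by exists 1 => x x0; have /andP[q0 ?] := exp_poly_unit q1 x0; rewrite ger0_norm.
Qed.

Lemma bm_indic A : measurable A -> bounded_measurable (\1_A : RR -> R).
Proof.
move=> mA; split; first exact: measurable_indic.
by exists 1 => x _; rewrite indicE ger0_norm ?ler0n// lern1 leq_b1.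
Qed.

End poly_approximation.

Section two_measures.
Context {R : realType}.
Local Notation RR := (measurableTypeR R).
Local Notation S := (@state_space R).
Variables mu nu : {measure set RR -> \bar R}.
Hypotheses (mu1 : mu S = 1%E) (nu1 : nu S = 1%E).

Local Notation err m A q := (\int[m]_(x in S) `|\1_A x - exp_poly q x|).

(** One polynomial has to serve both measures, and its values must stay in [0, 1] for the uniform
    estimate to apply. The sets with this property form a sigma-algebra that contains the rays. *)
Definition jointly_approximable (A : set RR) : Prop := measurable A /\
  forall e : R, 0 < e -> exists2 q, unit_poly q & err mu A q <= e /\ err nu A q <= e.

Let bmd A q : measurable A -> unit_poly q ->
  bounded_measurable (fun x => `|(\1_A x : R) - exp_poly q x|).
Proof. by move=> mA q1; apply: bm_norm; apply: bmB; [exact: bm_indic|exact: bm_exp_poly]. Qed.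

Lemma jointly_approximable_set0 : jointly_approximable set0.
Proof.
split=> // e e0; exists 0; first by move=> z _; rewrite horner0 lexx ler01.
have E : (fun x : R => `|(\1_(set0 : set RR) x : R) - exp_poly 0 x|) = (fun=> 0).
  by apply/funext => x; rewrite indic0 /exp_poly horner0 subrr normr0.
by rewrite E !mean_cst//; split; exact: ltW.
Qed.

Lemma jointly_approximable_setC A : jointly_approximable A -> jointly_approximable (~` A).
Proof.
move=> [mA HA]; split; first exact: measurableC.
move=> e /HA[q q1 Hq]; exists (1 - q).
  by move=> z /q1/andP[? ?]; rewrite !hornerE subr_ge0; apply/andP; split=> //; rewrite gerBl.
have E : (fun x : R => `|(\1_(~` A) x : R) - exp_poly (1 - q) x|) =
  (fun x => `|(\1_A x : R) - exp_poly q x|).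
  apply/funext => x; rewrite /exp_poly !hornerE !indicE in_setC.
  by case: (x \in A) => /=; rewrite -normrN; congr `|_|; ring.
by rewrite E.
Qed.

Lemma jointly_approximable_setU A B : jointly_approximable A -> jointly_approximable B ->
  jointly_approximable (A `|` B).
Proof.
move=> [mA HA] [mB HB]; split; first exact: measurableU.
move=> e e0; have e20 : 0 < e / 2 by rewrite divr_gt0.
have [q q1 [Hq Hq']] := HA _ e20; have [r r1 [Hr Hr']] := HB _ e20.
(* The union formula for indicators: it keeps values in [0, 1], and its pointwise error is at most
   the sum of the two errors. *)
have p1 : unit_poly (1 - (1 - q) * (1 - r)).
  move=> z z01; rewrite !hornerE; have /andP[? ?] := q1 z z01; have /andP[? ?] := r1 z z01.
  have ? : 0 <= (1 - q.[z]) * (1 - r.[z]) by rewrite mulr_ge0 ?subr_ge0.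
  have ? : (1 - q.[z]) * (1 - r.[z]) <= 1 by rewrite mulr_ile1 ?subr_ge0 ?gerBl.
  by apply/andP; lra.
have key (m : {measure set RR -> \bar R}) : m S = 1%E -> err m A q <= e / 2 -> err m B r <= e / 2 ->
    err m (A `|` B) (1 - (1 - q) * (1 - r)) <= e.
  move=> m1 eA eB; rewrite (splitr e); apply: le_trans (lerD eA eB).
  rewrite -meanD//; try exact: bmd.
  apply: mean_le => //.
  - by apply: bmd => //; exact: measurableU.
  - by apply: bmD; exact: bmd.
  move=> x x0; have /andP[qx0 qx1] := exp_poly_unit q1 x0.
  have /andP[rx0 rx1] := exp_poly_unit r1 x0.
  have -> : exp_poly (1 - (1 - q) * (1 - r)) x = 1 - (1 - exp_poly q x) * (1 - exp_poly r x).
    by rewrite /exp_poly !hornerE.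
  rewrite !indicE in_setU; set u := exp_poly q x in qx0 qx1 *; set v := exp_poly r x in rx0 rx1 *.
  have uv0 : 0 <= (1 - u) * (1 - v) by rewrite mulr_ge0// subr_ge0.
  have u1 : (1 - u) * (1 - v) <= 1 - u by rewrite ler_piMr ?subr_ge0 ?gerBl.
  have v1 : (1 - u) * (1 - v) <= 1 - v by rewrite ler_piMl ?subr_ge0 ?gerBl.
  have nu0 : 0 <= u * v by rewrite mulr_ge0.
  case: (x \in A) => /=; [|case: (x \in B) => /=].
  - have -> : (1 : R) - (1 - (1 - u) * (1 - v)) = (1 - u) * (1 - v) by ring.
    rewrite ger0_norm//; apply: (le_trans u1); rewrite (ger0_norm (x := 1 - u)) ?subr_ge0//.
    by rewrite lerDl.
  - have -> : (1 : R) - (1 - (1 - u) * (1 - v)) = (1 - u) * (1 - v) by ring.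
    rewrite ger0_norm//; apply: (le_trans v1); rewrite (ger0_norm (x := 1 - v)) ?subr_ge0//.
    by rewrite lerDr.
  - rewrite !sub0r !normrN ger0_norm; last by lra.
    by rewrite !ger0_norm//; lra.
by exists (1 - (1 - q) * (1 - r)) => //; split; apply: key.
Qed.

Lemma jointly_approximable_limit (A_ : nat -> set RR) (A : set RR) :
  (forall n, jointly_approximable (A_ n)) -> measurable A ->
  (forall x, 0 < x -> (\1_(A_ n) x : R) @[n --> \oo] --> (\1_A x : R)) ->
  jointly_approximable A.
Proof.
move=> HA mA A_A; split => // e e0.
have e20 : 0 < e / 2 by rewrite divr_gt0.
have mA_ n := (HA n).1.
have I1 n x : `|\1_(A_ n) x : R| <= 1.
  by rewrite indicE ger0_norm ?ler0n// lern1 leq_b1.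
have near_small (m : {measure set RR -> \bar R}) : m S = 1%E -> \forall n \near \oo,
    \int[m]_(x in S) `|(\1_(A_ n) x : R) - \1_A x| <= e / 2.
  move=> m1; have := mean_dominated_convergence m1 (fun n => bm_measurable (bm_indic (mA_ n)))
    (bm_measurable (bm_indic mA)) (fun n x _ => I1 n x) A_A.
  by move=> /cvgr_le; apply.
have [n [nmu nnu]] : exists n, \int[mu]_(x in S) `|(\1_(A_ n) x : R) - \1_A x| <= e / 2 /\
    \int[nu]_(x in S) `|(\1_(A_ n) x : R) - \1_A x| <= e / 2.
  near \oo => n; exists n; split; near: n; exact: near_small.
have [q q1 [Hq Hq']] := (HA n).2 _ e20.
have key (m : {measure set RR -> \bar R}) : m S = 1%E -> \int[m]_(x in S) `|(\1_(A_ n) x : R) - \1_A x| <= e / 2 ->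
    err m (A_ n) q <= e / 2 -> err m A q <= e.
  move=> m1 E1 E2; rewrite (splitr e); apply: le_trans (lerD E1 E2).
  have bmn : bounded_measurable (fun x => `|(\1_(A_ n) x : R) - \1_A x|).
    by apply: bm_norm; apply: bmB; exact: bm_indic.
  rewrite -(meanD m1 bmn (bmd (mA_ n) q1)).
  apply: (mean_le m1 (bmd mA q1) (bmD bmn (bmd (mA_ n) q1))).
  move=> x x0; rewrite addrC (distrC (\1_(A_ n) x) (\1_A x)) addrC.
  exact: ler_distD.
by exists q => //; split; apply: key.
Unshelve. all: by end_near. Qed.

Lemma jointly_approximable_bigcup (F : nat -> set RR) : (forall n, jointly_approximable (F n)) ->
  jointly_approximable (\bigcup_n F n).
Proof.
move=> HF; pose U n := \big[setU/set0]_(i < n) F i.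
have HU n : jointly_approximable (U n).
  elim: n => [|n IH]; first by rewrite /U big_ord0; exact: jointly_approximable_set0.
  by rewrite /U big_ord_recr/=; exact: jointly_approximable_setU.
apply: (jointly_approximable_limit HU); first by apply: bigcupT_measurable => n; exact: (HF n).1.
move=> x _; have [xF|xF] := pselect ((\bigcup_n F n) x).
  have [k _ Fkx] := xF.
  rewrite indicE mem_set//; apply: cvg_near_cst; near=> n.
  rewrite indicE mem_set// /U -bigcup_mkord; exists k => //=.
  by near: n; exact: nbhs_infty_gt.
rewrite indicE memNset//; apply: cvg_near_cst; apply: nearW => n.
rewrite indicE memNset// /U -bigcup_mkord => -[k _ Fkx]; apply: xF.
by exists k.
Unshelve. all: by end_near. Qed.

Definition ray_poly (u : R) (n : nat) : {poly R} :=
  (1 - 'X^n) ^+ (Num.trunc (n%:R * expR (n%:R * u))).+1.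

Lemma unit_ray_poly u n : unit_poly (ray_poly u n).
Proof.
move=> z /andP[z0 z1]; rewrite /ray_poly horner_exp !hornerE.
have zn0 : 0 <= z ^+ n by exact: exprn_ge0.
have zn1 : z ^+ n <= 1 by exact: exprn_ile1.
by rewrite exprn_ge0 ?subr_ge0//= exprn_ile1 ?subr_ge0// gerBl.
Qed.

Lemma bernoulli_ineq (y : R) n : 0 <= y <= 1 -> 1 - n%:R * y <= (1 - y) ^+ n.
Proof.
move=> /andP[y0 y1]; elim: n => [|n IH]; first by rewrite mul0r subr0 expr0.
rewrite exprS; have := ler_wpM2l (_ : 0 <= 1 - y) IH; rewrite subr_ge0 => /(_ y1).
apply: le_trans; rewrite -natr1.
have : 0 <= n%:R * y * y by rewrite !mulr_ge0.
by lra.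
Qed.

(* [(1 - e^{-nx})^N] with [N] of order [n e^{nu}] is at most [e^{-n}] for
   [x <= u], and tends to 1 for [x > u]. *)
Lemma ray_poly_cvg u x : 0 < u -> 0 < x ->
  exp_poly (ray_poly u n) x @[n --> \oo] --> (\1_(`]u, +oo[%classic : set RR) x : R).
Proof.
move=> u0 x0.
suff [K HK] : exists K : R, forall n, (0 < n)%N ->
    `|(\1_(`]u, +oo[%classic : set RR) x : R) - exp_poly (ray_poly u n) x| <= K / n%:R.
  apply/cvgrPdist_le => e e0; near=> n.
  have n0 : (0 < n)%N by near: n; exact: nbhs_infty_gt.
  apply: le_trans (HK n n0) _; rewrite ler_pdivrMr ?ltr0n// [leRHS]mulrC -ler_pdivrMr//.
  by near: n; exact: nbhs_infty_ger.
pose N n := (Num.trunc (n%:R * expR (n%:R * u))).+1.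
have polyE n : exp_poly (ray_poly u n) x = (1 - expN n%:R x) ^+ N n.
  by rewrite /exp_poly /ray_poly horner_exp !hornerE /expN -mulrN -/(N n) expRM_natl.
have N1 n : n%:R * expR (n%:R * u) <= (N n)%:R /\
    (N n)%:R <= n%:R * expR (n%:R * u) + 1.
  have /truncn_itv/andP[? ?] : 0 <= n%:R * expR (n%:R * u) by rewrite mulr_ge0// expR_ge0.
  by split; [exact: ltW|rewrite /N -natr1 lerD2r].
have e01 n : 0 <= expN n%:R x <= 1.
  by rewrite expR_ge0 expRN_le1// mulr_ge0// ltW.
have h01 n : 0 <= exp_poly (ray_poly u n) x <= 1.
  exact: exp_poly_unit (unit_ray_poly u n) x0.
have [xu|ux] := leP x u.
  exists 1 => n n0; rewrite indicE memNset; last first.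
    by rewrite /= in_itv/= andbT => /(le_lt_trans xu); rewrite ltxx.
  have /andP[h0 h1] := h01 n.
  rewrite sub0r normrN ger0_norm// polyE mul1r.
  apply: (@le_trans _ _ (expR (- n%:R))); last first.
    rewrite expRN lef_pV2 ?posrE ?expR_gt0 ?ltr0n//.
    by apply: le_trans (expR_ge1Dx _); rewrite lerDr.
  apply: (@le_trans _ _ (expR (- expN n%:R x) ^+ N n)).
    have /andP[_ e1] := e01 n.
    apply: lerXn2r; rewrite ?nnegrE ?expR_ge0 ?subr_ge0//.
    by have := expR_ge1Dx (- expN n%:R x).
  rewrite -expRM_natl ler_expR mulrN lerN2.
  apply: (@le_trans _ _ (n%:R * expR (n%:R * u) * expN n%:R x)); last first.
    by rewrite ler_wpM2r ?(N1 n).1//; have /andP[] := e01 n.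
  rewrite -mulrA ler_peMr// -expRD -[leLHS]expR0 ler_expR -mulrBr.
  by rewrite mulr_ge0// subr_ge0.
have d0 : 0 < x - u by rewrite subr_gt0.
exists (2 * (4 / (x - u) ^+ 2)) => n n0; rewrite indicE mem_set; last first.
  by rewrite /= in_itv/= andbT.
have /andP[h0 h1] := h01 n.
rewrite ger0_norm ?subr_ge0// polyE.
have n1 : 1 <= n%:R :> R by rewrite ler1n.
have n0' : 0 < n%:R :> R by rewrite ltr0n.
apply: (@le_trans _ _ ((N n)%:R * expN n%:R x)).
  by have := bernoulli_ineq (N n) (e01 n); rewrite mulr1n; lra.
apply: (@le_trans _ _ (2 * (n%:R * expN n%:R (x - u)))).
  apply: (@le_trans _ _ ((n%:R * expR (n%:R * u) + 1) * expN n%:R x)).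
    by rewrite ler_wpM2r ?(N1 n).2//; have /andP[] := e01 n.
  have -> : (n%:R * expR (n%:R * u) + 1) * expN n%:R x =
      n%:R * expN n%:R (x - u) + expN n%:R x.
    rewrite mulrDl mul1r -mulrA /expN -expRD; congr (_ * expR _ + _); ring.
  have -> : 2 * (n%:R * expN n%:R (x - u)) =
     n%:R * expN n%:R (x - u) + n%:R * expN n%:R (x - u) by ring.
  rewrite lerD2l; apply: (@le_trans _ _ (expN n%:R (x - u))).
    by rewrite ler_expR lerN2 ler_wpM2l// gerBl ltW.
  by rewrite ler_peMl// expR_ge0.
rewrite -mulrA ler_wpM2l// ler_pdivlMr//.
have := sqr_expN_le d0 (ltW n0').
by rewrite /expN [(x - u) * _]mulrC expr2; apply: le_trans; rewrite mulrAC.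
Unshelve. all: by end_near. Qed.

Lemma jointly_approximable_ray u : jointly_approximable `]u, +oo[%classic.
Proof.
have mr : measurable (`]u, +oo[%classic : set RR) by exact: measurable_itv.
(* For [u <= 0] the ray contains the state space, and the constant polynomial 1 is exact there. *)
have [u0|u0] := leP u 0.
  split=> // e e0; exists 1; first by move=> z _; rewrite hornerC ler01 lexx.
  have key (m : {measure set RR -> \bar R}) : m S = 1%E -> err m `]u, +oo[%classic 1 <= e.
    move=> m1; apply: le_trans (ltW e0).
    rewrite -[leRHS](mean_cst m1 0).
    apply: (mean_le m1) => [| |x x0].
    - by apply: bmd => // z _; rewrite hornerC ler01 lexx.
    - exact: bm_cst.
    rewrite indicE mem_set ?/exp_poly ?hornerC ?subrr ?normr0//=.
    by rewrite in_itv/= andbT (le_lt_trans u0).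
  by split; exact: key.
split=> // e e0.
have near_small (m : {measure set RR -> \bar R}) : m S = 1%E ->
    \forall n \near \oo, err m `]u, +oo[%classic (ray_poly u n) <= e.
  move=> m1.
  have b1 n x : 0 < x -> `|exp_poly (ray_poly u n) x| <= 1.
    by move=> x0; have /andP[? ?] := exp_poly_unit (unit_ray_poly u n) x0; rewrite ger0_norm.
  have := mean_dominated_convergence m1
    (fun n => bm_measurable (bm_exp_poly (unit_ray_poly u n)))
    (bm_measurable (bm_indic mr)) b1 (fun x x0 => ray_poly_cvg u0 x0).
  move=> /cvgr_le /(_ _ e0); apply: filterS => n.
  by congr (_ <= _); apply: eq_Rintegral => x _; rewrite distrC.
have [n [nmu nnu]] : exists n, err mu `]u, +oo[%classic (ray_poly u n) <= e /\
    err nu `]u, +oo[%classic (ray_poly u n) <= e.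
  near \oo => n; exists n; split; near: n; exact: near_small.
by exists (ray_poly u n) => //; exact: unit_ray_poly.
Unshelve. all: by end_near. Qed.

Lemma measurable_jointly_approximable A : measurable A -> jointly_approximable A.
Proof.
have -> : @measurable _ RR = <<s @RGenOInfty.G R >>.
  exact: RGenOInfty.measurableE.
apply: smallest_sub.
  split; [exact: jointly_approximable_set0|move=> B /jointly_approximable_setC; by rewrite setTD|exact: jointly_approximable_bigcup].
by move=> B [u ->]; exact: jointly_approximable_ray.
Qed.

(** Nothing is lost in [K], the approximation error being arbitrary. Sets are cut down to the state
    space, the only place where the polynomials approximate. *)
Lemma measure_dist_le_poly (K : R) :
  (forall q, unit_poly q ->
    `|\int[mu]_(x in S) exp_poly q x - \int[nu]_(x in S) exp_poly q x| <= K) ->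
  forall A, measurable A -> `|fine (mu (A `&` S)) - fine (nu (A `&` S))| <= K.
Proof.
move=> HK A mA; have [_ HA] := measurable_jointly_approximable mA.
have meanI (m : {measure set RR -> \bar R}) :
    fine (m (A `&` S)) = \int[m]_(x in S) (\1_A x).
  by rewrite /Rintegral integral_indic//; exact: measurable_state_space.
apply/ler_addgt0Pr => e e0; have e20 : 0 < e / 2 by rewrite divr_gt0.
have [q q1 [Hq Hq']] := HA _ e20.
have key (m : {measure set RR -> \bar R}) : m S = 1%E -> err m A q <= e / 2 ->
    `|fine (m (A `&` S)) - \int[m]_(x in S) exp_poly q x| <= e / 2.
  move=> m1; apply: le_trans; rewrite meanI -meanB//.
  - apply: le_normr_Rintegral; first exact: measurable_state_space.
    by apply: bm_integrable => //; apply: bmB; [exact: bm_indic|exact: bm_exp_poly].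
  - exact: bm_indic.
  - exact: bm_exp_poly.
have H1 := key _ mu1 Hq; have H2 := key _ nu1 Hq'; have H3 := HK _ q1.
move: H1 H2 H3; set u := fine _; set v := fine _; set u' := Rintegral _ _ _.
set v' := Rintegral _ _ _ => H1 H2 H3.
have -> : u - v = (u - u') - (v - v') + (u' - v') by ring.
apply: le_trans (ler_normD _ _) _; rewrite addrC; apply: lerD => //.
by apply: le_trans (ler_normB _ _) _; rewrite (splitr e) lerD.
Qed.

End two_measures.

(** * Integrability of the cubic *)

Section integrable_mean.
Context {R : realType}.
Local Notation RR := (measurableTypeR R).
Local Notation S := (@state_space R).
Variable m : {measure set RR -> \bar R}.
Hypothesis m1 : m S = 1%E.

Lemma mean_le_affine (f V : R -> R) (k D : R) :
  m.-integrable S (EFin \o f) -> m.-integrable S (EFin \o V) ->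
  (forall x, 0 < x -> f x <= k + D * V x) ->
  \int[m]_(x in S) f x <= k + D * \int[m]_(x in S) V x.
Proof.
move=> intf iV fV; have mS := @measurable_state_space R.
have ik : m.-integrable S (EFin \o (fun=> k)) by apply: bm_integrable => //; exact: bm_cst.
have iDV : m.-integrable S (EFin \o (fun x => D * V x)).
  by have := integrableZl mS D iV; apply: eq_integrable.
have E : \int[m]_(x in S) (k + D * V x) = k + D * \int[m]_(x in S) V x.
  by rewrite RintegralD// mean_cst// RintegralZl.
rewrite -E; apply: le_Rintegral => //.
by have := integrableD mS ik iDV; apply: eq_integrable.
Qed.

Lemma integrable_truncations (V : R -> R) (K : R) :
  measurable_fun (setT : set RR) V -> (forall x, 0 < x -> 0 <= V x) ->
  (forall n, \int[m]_(x in S) (V x * \1_(`]-oo, n%:R]%classic : set RR) x) <= K) ->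
  (forall n, bounded_measurable (fun x => V x * \1_(`]-oo, n%:R]%classic : set RR) x)) ->
  m.-integrable S (EFin \o V).
Proof.
move=> mV V0 VK bV; have mS := @measurable_state_space R.
have mVS : measurable_fun S (EFin \o V).
  by apply/measurable_EFinP; exact: measurable_funS mV.
apply/integrableP; split=> //.
pose g n (x : R) := (V x * \1_(`]-oo, n%:R]%classic : set RR) x)%:E.
have g0 n x : S x -> (0 <= g n x)%E.
  by move=> /V0 ?; rewrite lee_fin mulr_ge0// indicE.
have mg n : measurable_fun S (g n).
  by apply/measurable_EFinP; apply: measurable_funS (bm_measurable (bV n)).
have ndg x : S x -> nondecreasing_seq (g ^~ x).
  move=> /V0 Vx a b ab; rewrite lee_fin ler_wpM2l// !indicE ler_nat.
  have [/set_mem /=|//] := boolP (x \in `]-oo, a%:R]%classic).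
  rewrite in_itv/= => xa; rewrite mem_set//= in_itv/=.
  by apply: le_trans xa _; rewrite ler_nat.
have -> : (\int[m]_(x in S) `|(EFin \o V) x| = \int[m]_(x in S) limn (g ^~ x))%E.
  apply: eq_integral => x /set_mem Sx; rewrite /= ger0_norm ?V0//.
  apply/esym/lim_near_cst => //; near=> n.
  rewrite /g indicE mem_set ?mulr1//= in_itv/=.
  by near: n; exact: nbhs_infty_ger.
rewrite (monotone_convergence m mS mg g0 ndg).
apply: (@le_lt_trans _ _ K%:E); last exact: ltry.
apply: lime_le.
  apply: ereal_nondecreasing_is_cvgn => a b ab.
  apply: ge0_le_integral => //; first exact: g0.
  by move=> x Sx; exact: ndg.
apply: nearW => n; have := VK n; rewrite -lee_fin; apply: le_trans.
rewrite /Rintegral fineK//; apply: integrable_fin_num => //.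
exact: bm_integrable.
Unshelve. all: by end_near. Qed.

End integrable_mean.

Lemma min_shift_dist_le {R : realType} (M K u : R) : 0 <= u ->
  `|Num.min M K - Num.min M (u + K)| <= u.
Proof.
move=> u0; rewrite ler_norml.
by case: (leP M K) => ?; case: (leP M (u + K)) => ?; apply/andP; split; lra.
Qed.

Section invariant_moments.
Context {R : realType}.
Local Notation RR := (measurableTypeR R).
Local Notation S := (@state_space R).
Variable P : R.-pker (RR * RR) ~> RR.
Hypothesis hP : markov_semigroup P.
Variable mu : probability RR R.
Hypothesis hmu : invariant_distribution P mu.

Lemma mean_invariant (t : R) (f : R -> R) : 0 <= t ->
  bounded_measurable f -> (forall x, 0 < x -> 0 <= f x) ->
  \int[mu]_(x in S) f x = \int[mu]_(x in S) mean_at P t x f.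
Proof.
move=> t0 bf f0; have [mu1 inv] := hmu.
have mc : measurable_fun (setT : set (RR * RR)) (cst (mu : pprobability RR R)).
  exact: measurable_cst.
(* The distribution is seen as a constant kernel, evaluated at an arbitrary source point. *)
apply: (@integral_mixture _ _ hP (kprobability mc) (0, 0)) => //.
- exact: probability_setT.
- by move=> A mA; exact: esym (inv t A t0 mA).
Qed.

(** [V] is not known to be integrable, so its bound is capped at [M] before integration. The capped
    bounds [w n] tend pointwise to [Num.min M K], and dominated convergence carries this over to
    their means. *)
Lemma invariant_mean_le (f V : R -> R) (M c K : R) : 0 < c -> 0 <= K ->
  bounded_measurable f -> (forall x, 0 < x -> 0 <= f x <= M) ->
  measurable_fun (setT : set RR) V -> (forall x, 0 < x -> 0 <= V x) ->
  (forall t x, 0 < t -> 0 < x -> mean_at P t x f <= expR (- (c * t)) * V x + K) ->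
  \int[mu]_(x in S) f x <= K.
Proof.
move=> c0 K0 bf fM mV V0 H; have [mu1 _] := hmu.
have f0 x : 0 < x -> 0 <= f x by move=> /fM /andP[].
pose w n (x : R) := Num.min M (expR (- (c * n%:R)) * V x + K).
have M0 : 0 <= M by have /andP[] := fM 1 ltr01; exact: le_trans.
have MK0 : 0 <= Num.min M K by rewrite le_min M0.
have a0 n x : 0 < x -> 0 <= expR (- (c * n%:R)) * V x.
  by move=> /V0 ?; rewrite mulr_ge0 ?expR_ge0.
have w01 n x : 0 < x -> `|w n x| <= M.
  by move=> x0; rewrite ger0_norm ?ge_min ?lexx// le_min M0 addr_ge0// a0.
have mw n : measurable_fun (setT : set RR) (w n).
  apply: measurable_minr => //; apply: measurable_funD => //.
  exact: measurable_funM.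
have bw n : bounded_measurable (w n) by split=> //; exists M; exact: w01.
have w_w x : 0 < x -> w n x @[n --> \oo] --> Num.min M K.
  move=> x0; apply/cvgrPdist_le => e e0; near=> n.
  have n0 : 0 < n%:R :> R by rewrite ltr0n; near: n; exact: nbhs_infty_gt.
  apply: (@le_trans _ _ (expR (- (c * n%:R)) * V x)).
    rewrite /w; move: (a0 n x x0); set u := expR _ * _ => u0.
    exact: min_shift_dist_le.
  apply: (@le_trans _ _ (V x / (c * n%:R))).
    rewrite mulrC ler_wpM2l ?V0// expRN lef_pV2 ?posrE ?expR_gt0 ?mulr_gt0//.
    by apply: le_trans (expR_ge1Dx _); rewrite lerDr.
  rewrite ler_pdivrMr ?mulr_gt0// mulrA -ler_pdivrMl ?mulr_gt0//.
  by near: n; exact: nbhs_infty_ger.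
have cv := mean_dominated_convergence mu1 mw (measurable_cst (Num.min M K)) w01 w_w.
apply/ler_addgt0Pr => e e0.
have [n n0 ne] : exists2 n, (0 < n)%N &
    \int[mu]_(x in S) `|w n x - Num.min M K| <= e.
  near \oo => n; exists n; first by near: n; exact: nbhs_infty_gt.
  by near: n; move/cvgr_le: cv => /(_ _ e0).
have n0' : 0 < n%:R :> R by rewrite ltr0n.
have bmm : bounded_measurable (fun=> Num.min M K : R) by exact: bm_cst.
have bd : bounded_measurable (fun x => `|w n x - Num.min M K|).
  by apply: bm_norm; apply: bmB.
rewrite (mean_invariant (ltW n0') bf f0).
apply: (@le_trans _ _ (\int[mu]_(x in S) (Num.min M K + `|w n x - Num.min M K|))).
  apply: (mean_le mu1); [by apply: bm_mean_at => //; exact: ltW|exact: bmD|].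
  move=> x x0; apply: (@le_trans _ _ (w n x)).
    rewrite le_min H// andbT.
    have := @mean_at_le _ _ hP M n%:R x f bf _ (ltW n0') x0.
    move=> /(_ _)/ler_normlW; apply => y y0.
    by rewrite ger0_norm ?f0//; have /andP[] := fM y y0.
  by rewrite -lerBlDl ler_norm.
rewrite (meanD mu1 bmm bd) (mean_cst mu1); apply: lerD => //.
by rewrite ge_min lexx orbT.
Unshelve. all: by end_near. Qed.

End invariant_moments.

Section lyapunov_integrable.
Context {R : realType}.
Local Notation RR := (measurableTypeR R).
Local Notation S := (@state_space R).
Variables be ga : R.
Hypotheses (be0 : 0 < be) (ga0 : 0 < ga).

Lemma cubic_ge0 (x : R) : 0 <= x -> 0 <= cubic be ga x.
Proof. by move=> x0; have := ltW be0; have := ltW ga0; rewrite /cubic => *; nneg. Qed.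

Lemma cubic_le (x y : R) : 0 <= x -> x <= y -> cubic be ga x <= cubic be ga y.
Proof.
move=> x0 xy; have y0 := le_trans x0 xy.
by rewrite /cubic !lerD// ler_wpM2l ?lerXn2r ?nnegrE// ltW.
Qed.

Lemma measurable_cubic : measurable_fun (setT : set RR) (cubic be ga).
Proof.
apply: measurable_funD; last first.
  by apply: measurable_funM => //; exact: exprn_measurable.
apply: measurable_funD => //.
by apply: measurable_funM => //; exact: exprn_measurable.
Qed.

(** A bounded substitute for x that lies below x and tends to it as [l] tends to 0; a polynomial in
    it is an exponential sum. *)
Definition saturation (l x : R) : R := (1 - expN l x) / l.

Lemma saturation_ge0 l x : 0 < l -> 0 <= x -> 0 <= saturation l x.
Proof.
by move=> l0 x0; rewrite divr_ge0 ?(ltW l0)// one_subr_expRN_ge0// mulr_ge0// ltW.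
Qed.

Lemma saturation_le l x : 0 < l -> saturation l x <= x.
Proof.
move=> l0; rewrite ler_pdivrMr// [x * l]mulrC.
exact: one_subr_expRN_le.
Qed.

Lemma saturation_le_inv l x : 0 < l -> saturation l x <= l^-1.
Proof.
move=> l0; rewrite -[leRHS]mul1r ler_pM2r ?invr_gt0// lerBlDr lerDl.
exact: expR_ge0.
Qed.

Lemma le_saturation l x : 0 < l -> 0 <= x -> l * x <= 1 -> x <= 2 * saturation l x.
Proof.
move=> l0 x0 lx.
rewrite /saturation mulrA ler_pdivlMr// /expN.
have : expR (- (l * x)) <= (1 + l * x)^-1.
  rewrite expRN lef_pV2 ?posrE ?expR_gt0 ?expR_ge1Dx//.
  by rewrite ltr_pwDl// mulr_ge0// ltW.
have u0 : 0 <= l * x by rewrite mulr_ge0// ltW.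
move: lx u0; rewrite [x * l]mulrC; set u := l * x => u1 u0 E.
have : (1 + u)^-1 <= 1 - u / 2.
  by rewrite -[leLHS]mul1r ler_pdivrMr; nra.
by lra.
Qed.

(** Coefficients of the cubic at (1 - z) / l in powers of z = exp(-l x). *)
Definition cubic_coef (l : R) (i : 'I_4) : R :=
  [:: l^-1 + be / l ^+ 2 + ga / l ^+ 3;
      - (l^-1 + 2 * be / l ^+ 2 + 3 * ga / l ^+ 3);
      be / l ^+ 2 + 3 * ga / l ^+ 3;
      - (ga / l ^+ 3)]`_i.

Lemma cubic_saturation l : 0 < l ->
  (fun x => cubic be ga (saturation l x)) = expsum (cubic_coef l) (fun i => i%:R * l).
Proof.
move=> l0; apply/funext => x; rewrite /expsum !big_ord_recl big_ord0 /cubic_coef /=.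
have E k : expN (k%:R * l) x = expN l x ^+ k.
  by rewrite /expN -expRM_natl; congr expR; ring.
rewrite !E /cubic /saturation /bump /=; field.
by rewrite gt_eqF.
Qed.

Lemma bm_cubic_truncation (n : nat) :
  bounded_measurable (fun x => cubic be ga x * \1_(`]-oo, n%:R]%classic : set RR) x).
Proof.
split; first by apply: measurable_funM; [exact: measurable_cubic|exact: measurable_indic].
exists (cubic be ga n%:R) => x x0; rewrite indicE.
have [/set_mem /=|_] := boolP (x \in `]-oo, n%:R]%classic).
  rewrite in_itv/= mulr1 => xn; rewrite ger0_norm ?cubic_ge0 ?(ltW x0)//.
  by rewrite cubic_le// ltW.
by rewrite mulr0 normr0 cubic_ge0.
Qed.

(** With [l] the inverse of [n.+1], a point x <= n has l x <= 1 and is at most twice its saturation;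
    doubling the argument of the cubic costs at most 8 = 2^3. *)
Lemma integrable_cubic_saturation (m : {measure set RR -> \bar R}) (K : R) :
  m S = 1%E ->
  (forall l, 0 < l -> bounded_measurable (fun x => cubic be ga (saturation l x))) ->
  (forall l, 0 < l -> \int[m]_(x in S) cubic be ga (saturation l x) <= K) ->
  m.-integrable S (EFin \o cubic be ga).
Proof.
move=> m1 bsat HK; apply: (@integrable_truncations _ _ m1 _ (8 * K)).
- exact: measurable_cubic.
- by move=> x /ltW; exact: cubic_ge0.
- move=> n; pose l : R := n.+1%:R^-1.
  have l0 : 0 < l by rewrite invr_gt0 ltr0n.
  apply: (@le_trans _ _ (8 * \int[m]_(x in S) cubic be ga (saturation l x))); last first.
    by rewrite ler_wpM2l// HK.
  rewrite -(meanZ m1)//; last exact: bsat.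
  apply: (mean_le m1); [exact: bm_cubic_truncation|by apply: bmZ; exact: bsat|].
  move=> x x0; have v0 := saturation_ge0 l0 (ltW x0).
  rewrite indicE; have [/set_mem /=|_] := boolP (x \in `]-oo, n%:R]%classic); last first.
    by rewrite mulr0 mulr_ge0// cubic_ge0.
  rewrite in_itv/= mulr1 => xn.
  have xv : x <= 2 * saturation l x.
    apply: le_saturation => //; first exact: ltW.
    rewrite mulrC ler_pdivrMr ?ltr0n// mul1r; apply: le_trans xn _.
    by rewrite ler_nat.
  apply: le_trans (cubic_le (ltW x0) xv) _; rewrite /cubic.
  move: v0; set v := saturation l x => v0.
  have b0 := ltW be0; have c0 := ltW ga0.
  have B : 0 <= be * v ^+ 2 by nneg.
  have C : 0 <= ga * v ^+ 3 by nneg.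
  have -> : 2 * v + be * (2 * v) ^+ 2 + ga * (2 * v) ^+ 3 =
    2 * v + 4 * (be * v ^+ 2) + 8 * (ga * v ^+ 3) by ring.
  move: B C; set B := be * _; set C := ga * _; lra.
- exact: bm_cubic_truncation.
Qed.

Lemma integrable_cubic_moments (m : {measure set RR -> \bar R}) :
  (forall n : nat, m.-integrable S (fun x => (x ^+ n)%:E)) ->
  m.-integrable S (EFin \o cubic be ga).
Proof.
move=> H; have mS := @measurable_state_space R.
have i2 := integrableZl mS be (H 2%N); have i3 := integrableZl mS ga (H 3%N).
have := integrableD mS (integrableD mS (H 1%N) i2) i3.
by apply: eq_integrable.
Qed.

End lyapunov_integrable.

(** * From pointwise bounds on transition probabilities to total variation *)

Section total_variation.
Context {R : realType}.
Local Notation RR := (measurableTypeR R).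
Local Notation S := (@state_space R).
Variable P : R.-pker (RR * RR) ~> RR.
Hypothesis hP : markov_semigroup P.

Definition transition (t : R) (A : set RR) (x : R) : R := fine (P (t, x) A).

Lemma transitionE t A x : 0 <= t -> 0 < x -> measurable A ->
  [/\ P (t, x) A = (transition t A x)%:E, 0 <= transition t A x <= 1 &
    transition t A x = fine (P (t, x) (A `&` S))].
Proof.
move=> t0 x0 mA; have P1 := semigroup_state hP t0 x0.
have mS := @measurable_state_space R.
have Ple : (P (t, x) A <= 1)%E.
  by have <- := @prob_kernel _ _ _ _ _ P (t, x); apply: le_measure; rewrite ?inE.
have Pfin : P (t, x) A \is a fin_num by rewrite ge0_fin_numE// (le_lt_trans Ple)// ltry.
split; first by rewrite /transition fineK.
  rewrite /transition fine_ge0//=.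
  by rewrite -lee_fin fineK.
rewrite /transition; congr fine.
have PT : P (t, x) setT = 1%E by exact: prob_kernel.
have mf : measurable_fun setT (fun y : RR => (\1_A y)%:E : \bar R).
  by apply/measurable_EFinP; exact: measurable_indic.
have := integral_state_full PT P1 mf (fun y => _).
by rewrite !integral_indic ?setIT//; apply => y; rewrite lee_fin indicE.
Qed.

Lemma bm_transition t A : 0 <= t -> measurable A -> bounded_measurable (transition t A).
Proof.
move=> t0 mA; split.
  apply: measurableT_comp => //.
  apply: (@measurableT_comp _ _ _ _ _ _ (fun z => P z A)); first exact: measurable_kernel.
  exact: measurable_pair1.
exists 1 => x x0; have [_ /andP[? ?] _] := transitionE t0 x0 mA.
by rewrite ger0_norm.
Qed.

Lemma law_atE (mu : probability RR R) t A : mu S = 1%E -> 0 <= t -> measurable A ->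
  law_at P mu t A = (\int[mu]_(x in S) transition t A x)%:E.
Proof.
move=> mu1 t0 mA; rewrite /law_at /Rintegral fineK; last first.
  apply: integrable_fin_num; first exact: measurable_state_space.
  by apply: bm_integrable => //; exact: bm_transition.
by apply: eq_integral => x /set_mem x0; have [-> _ _] := transitionE t0 x0 mA.
Qed.

(** This integrates the pointwise bound over the independent coupling of [mu] and [nu], one variable
    at a time so that no product measure is formed. *)
Lemma mean_dist_le_lyapunov (mu nu : {measure set RR -> \bar R}) (f V : R -> R) (D : R) :
  mu S = 1%E -> nu S = 1%E -> 0 <= D ->
  mu.-integrable S (EFin \o V) -> nu.-integrable S (EFin \o V) ->
  bounded_measurable f ->
  (forall x y, 0 < x -> x <= y -> `|f y - f x| <= D * (1 + (V x + V y))) ->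
  `|\int[mu]_(x in S) f x - \int[nu]_(x in S) f x| <=
    D * (1 + (\int[mu]_(x in S) V x + \int[nu]_(x in S) V x)).
Proof.
move=> mu1 nu1 D0 iVmu iVnu bf H.
have Hs x y : 0 < x -> 0 < y -> `|f x - f y| <= D * (1 + (V x + V y)).
  move=> x0 y0; have [xy|/ltW yx] := leP x y; first by rewrite distrC H.
  by rewrite [V x + _]addrC H.
have imu := bm_integrable mu1 bf; have inu := bm_integrable nu1 bf.
have half (m m' : {measure set RR -> \bar R}) : m S = 1%E -> m' S = 1%E ->
    m.-integrable S (EFin \o V) -> m'.-integrable S (EFin \o V) ->
    \int[m]_(x in S) f x - \int[m']_(x in S) f x <=
    D * (1 + (\int[m]_(x in S) V x + \int[m']_(x in S) V x)).
  move=> m1 m1' i i'.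
  have E1 y : 0 < y -> \int[m]_(x in S) f x <=
      f y + D * (1 + V y) + D * \int[m]_(x in S) V x.
    move=> y0; apply: (mean_le_affine m1) => //; first exact: bm_integrable.
    move=> x x0; have := Hs x y x0 y0; move/ler_normlW; lra.
  have bfN : bounded_measurable (fun y => - 1 * f y) by exact: bmZ.
  have : \int[m']_(y in S) (- 1 * f y) <=
      D + D * \int[m]_(x in S) V x - \int[m]_(x in S) f x + D * \int[m']_(x in S) V x.
    apply: (mean_le_affine m1') => //; first exact: bm_integrable.
    by move=> y y0; have := E1 y y0; lra.
  rewrite (meanZ m1')//; lra.
rewrite ler_norml; apply/andP; split; last exact: half.
have := half nu mu nu1 mu1 iVnu iVmu; lra.
Qed.

End total_variation.

(** * The rate [alpha * p] and the loss of [eps] *)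

Lemma affine_expR_le {R : realType} (e t : R) : 0 < e -> 0 <= t ->
  1 + t <= (1 + e^-1) * expR (e * t).
Proof.
move=> e0 t0; have E := expR_ge1Dx (e * t).
have i0 : 0 <= 1 + e^-1 by rewrite addr_ge0// invr_ge0 ltW.
apply: le_trans (ler_wpM2l i0 E); rewrite -subr_ge0.
have -> : (1 + e^-1) * (1 + e * t) - (1 + t) = e^-1 + e * t by field; rewrite gt_eqF.
by rewrite addr_ge0 ?invr_ge0 ?mulr_ge0 ?(ltW e0).
Qed.

Theorem theorem3p4 (R : realType) (a b c g : R)
    (P : R.-pker (measurableTypeR R * measurableTypeR R) ~> measurableTypeR R)
    (mu_inf mu0 : probability (measurableTypeR R) R) :
  0 < a -> 0 < b -> 0 < c -> 0 < g ->
  let p := b - c * g in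
  let alpha := 1 / (2 + b * p / (a * c)) in
  0 < p ->
  markov_semigroup P ->
  has_generator P (generator a b c g) ->
  invariant_distribution P mu_inf ->
  on_state_space mu0 ->
  has_all_moments mu0 ->
  forall eps : R, 0 < eps ->
  exists2 C : R, 0 < C &
    forall t : R, 0 <= t ->
      (tv_dist (law_at P mu0 t) (law_at P mu_inf t)
         <= (C * expR (- (alpha * p - eps) * t))%:E)%E.
Proof.
move=> a0 b0 c0 g0 p alpha p0 hP hL hinf mu01 hmom eps eps0.
have [muinf1 _] := hinf.
have r0 : 0 < b * p / (a * c) by rewrite divr_gt0 ?mulr_gt0.
have alpha0 : 0 < alpha by rewrite /alpha divr_gt0// addr_gt0.
have kap0 : 0 < alpha * p by rewrite mulr_gt0.
have kap_p : alpha * p <= p / 2.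
  rewrite mulrC ler_wpM2l ?(ltW p0)// /alpha div1r lef_pV2 ?posrE ?addr_gt0//.
  by rewrite lerDl ltW.
have kap_ac : alpha * p < a * c / b.
  rewrite /alpha mulrAC mul1r ltr_pdivrMr ?addr_gt0//.
  have -> : a * c / b * (2 + b * p / (a * c)) = p + 2 * (a * c / b).
    by field; rewrite !gt_eqF.
  by rewrite ltrDl mulr_gt0// divr_gt0// mulr_gt0.
have [be [ga [K [be0 ga0 K0 H]]]] := semigroup_estimates a0 b0 c0 g0 hP hL p0 kap0 kap_p kap_ac.
have bsat l : 0 < l -> bounded_measurable (fun x => cubic be ga (saturation l x)).
  move=> l0; rewrite cubic_saturation//; apply: (bm_expsum hP) => i.
  by rewrite mulr_ge0// ltW.
have iinf : mu_inf.-integrable (@state_space R) (EFin \o cubic be ga).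
  (* The saturated cubic is bounded by the cubic at [l^-1], while the bound [K] on its mean does not
     depend on [l]. *)
  apply: (@integrable_cubic_saturation _ _ _ be0 ga0 _ K) => // l l0.
  apply: (@invariant_mean_le _ _ hP _ hinf _ (cubic be ga) (cubic be ga l^-1) (p / 2)) => //.
  - by rewrite divr_gt0.
  - exact: ltW.
  - exact: bsat.
  - move=> x /ltW x0; have v0 := saturation_ge0 l0 x0.
    by rewrite cubic_ge0// cubic_le// saturation_le_inv.
  - exact: measurable_cubic.
  - by move=> x /ltW; exact: cubic_ge0.
  - move=> t x t0 x0; rewrite cubic_saturation//.
    have [_ Ht] := H t t0; apply: Ht => //.
      by move=> i; rewrite mulr_ge0// ltW.
    move=> y y0; rewrite -(cubic_saturation be ga l0).
    by apply: cubic_le => //; [exact: saturation_ge0|exact: saturation_le].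
have i0 : mu0.-integrable (@state_space R) (EFin \o cubic be ga).
  exact: integrable_cubic_moments.
pose M := \int[mu0]_(x in state_space) cubic be ga x +
  \int[mu_inf]_(x in state_space) cubic be ga x.
have M0 : 0 <= M.
  by apply: addr_ge0; apply: Rintegral_ge0 => x /ltW; exact: cubic_ge0.
have M10 : 0 <= 1 + M by exact: addr_ge0.
have Kp := ltW K0; have ep := ltW eps0.
(* The summand 1 serves for [t = 0], which the estimates for positive times leave out and where the
   distance is at most 1. *)
pose C := K * (1 + eps^-1) * (1 + M) + 1.
have C1 : 1 <= C.
  rewrite lerDr; apply: mulr_ge0 => //; apply: mulr_ge0 => //.
  by apply: addr_ge0 => //; rewrite invr_ge0.
exists C; first exact: lt_le_trans C1.
move=> t t0; apply: ge_ereal_sup => _ [A mA <-].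
rewrite !(law_atE hP)//; rewrite -EFinB abse_EFin lee_fin.
have btr := bm_transition hP t0 mA.
move: t0; rewrite le_eqVlt => /predU1P[t0|t0].
  subst t; rewrite mulr0 expR0 mulr1; apply: le_trans C1.
  have m01 (m : {measure set (measurableTypeR R) -> \bar R}) : m state_space = 1%E ->
      0 <= \int[m]_(x in state_space) transition P 0 A x <= 1.
    move=> m1; have := mean_le m1 (bm_cst 0) btr; have := mean_le m1 btr (bm_cst 1).
    rewrite !(mean_cst m1) => -> => [-> // x x0|x x0].
      by have [_ /andP[]] := transitionE hP (lexx 0) x0 mA.
    by have [_ /andP[]] := transitionE hP (lexx 0) x0 mA.
  by have := m01 _ mu01; have := m01 _ muinf1; rewrite ler_norml; lra.
pose D := K * (1 + t) * expR (- (alpha * p * t)).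
have D0 : 0 <= D by rewrite !mulr_ge0 ?expR_ge0 ?addr_ge0// ltW.
apply: (@le_trans _ _ (D * (1 + M))).
  apply: (@mean_dist_le_lyapunov R) => // x y x0 xy.
  have y0 := lt_le_trans x0 xy.
  have [_ _ ->] := transitionE hP (ltW t0) x0 mA.
  have [_ _ ->] := transitionE hP (ltW t0) y0 mA.
  apply: measure_dist_le_poly => //.
  - exact: (semigroup_state hP (ltW t0) y0).
  - exact: (semigroup_state hP (ltW t0) x0).
  - move=> q q01; have [Ht _] := H t t0; apply: Ht => // z z01.
    by have /andP[? ?] := q01 z z01; rewrite ger0_norm.
have -> : - (alpha * p - eps) * t = - (alpha * p * t) + eps * t by ring.
rewrite expRD /C /D; set e := expR (- _); have e0 : 0 <= e by exact: expR_ge0.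
have := affine_expR_le eps0 (ltW t0); set f := expR _; set h := 1 + eps^-1 => tf.
have f0 : 0 <= f by exact: expR_ge0.
rewrite mulrDl mul1r; apply: ler_wpDr; first exact: mulr_ge0.
have -> : K * h * (1 + M) * (e * f) = K * e * (1 + M) * (h * f) by ring.
have -> : K * (1 + t) * e * (1 + M) = K * e * (1 + M) * (1 + t) by ring.
by apply: ler_wpM2l => //; apply: mulr_ge0 => //; exact: mulr_ge0.
Qed.
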